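(* Let $z$ be complex with $|\arg(z)|<\pi$ and let $0<c<1$. Then \begin{align*} \psi_1(z+1)-\frac{1}{2}\log^{2}(z)=\frac{1}{2\pi i}\int_{c-i\infty}^{c+i\infty}\frac{\pi\zeta(1-s)}{\sin(\pi s)}\left(\gamma-\log(z)+\psi(s)\right)z^{-s}\, ds. \end{align*}
   Context: $\log$ is the principal branch of the logarithm and $z^{-s}=e^{-s\log z}$; $\gamma$ is Euler's constant, $\psi=\Gamma'/\Gamma$ the digamma function, and $\zeta$ the Riemann zeta function. $\gamma_1=\lim_{n\to\infty}\left(\sum_{j=1}^{n}\frac{\log(j)}{j}-\frac{\log^{2}(n)}{2}\right)$ is the first Stieltjes constant, and for $z\in\mathbb{C}\setminus(-\infty,0]$, $\psi_1(z)=-\gamma_1-\frac{\log(z)}{z}-\sum_{n=1}^{\infty}\left(\frac{\log(n+z)}{n+z}-\frac{\log(n)}{n}\right)$. *)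

(* Defs.v *)
From Stdlib Require Import Reals Factorial.
From Coquelicot Require Import Coquelicot.
Open Scope R_scope.

Definition Cexp (z : C) : C :=
  (exp (Re z) * cos (Im z), exp (Re z) * sin (Im z)).

Definition Csin (z : C) : C :=
  ((Cexp (Ci * z) - Cexp (- (Ci * z))) / (2 * Ci))%C.

(** The value lies in (-PI, PI]; meaningless at 0. *)
Definition Carg (z : C) : R :=
  if Rlt_dec (Im z) 0 then - acos (Re z / Cmod z) else acos (Re z / Cmod z).

Definition Clog (z : C) : C := (ln (Cmod z), Carg z).

(** The principal value of [z ^ w], for [z <> 0]. *)
Definition Cpower (z w : C) : C := Cexp (w * Clog z)%C.

(** Componentwise, in the style of [C_lim]: the limit of [u] whenever [u]
    converges in C, an irrelevant value otherwise. *)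
Definition Clim_seq (u : nat -> C) : C :=
  (real (Lim_seq (fun n => Re (u n))), real (Lim_seq (fun n => Im (u n)))).

Definition Cseries (a : nat -> C) : C := Clim_seq (fun N => sum_n a N).

Definition euler_gamma : R :=
  real (Lim_seq (fun n => sum_n_m (fun j => / INR j) 1 n - ln (INR n))).

Definition stieltjes_gamma1 : R :=
  real (Lim_seq (fun n =>
    sum_n_m (fun j => ln (INR j) / INR j) 1 n - ln (INR n) ^ 2 / 2)).

Fixpoint Crising (s : C) (n : nat) : C :=
  match n with
  | O => s
  | S m => (Crising s m * (s + INR n))%C
  end.

(** Euler's limit
    [Gamma s = lim_n  n! n^s / (s (s + 1) ... (s + n))],
    valid for every [s] outside [{0, -1, -2, ...}]. *)
Definition CGamma (s : C) : C :=
  Clim_seq (fun n =>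
    (INR (fact n) * Cpower (INR n) s / Crising s n)%C).

Definition digamma (s : C) : C := (C_derive CGamma s / CGamma s)%C.

Definition analytic_at (f : C -> C) (z0 : C) : Prop :=
  exists (a : nat -> C) (r : R), 0 < r /\
    forall z : C, Cmod (z - z0) < r ->
      is_pseries (K := C_AbsRing) (V := C_NormedModule) a (z - z0)%C (f z).

(** [f] is the analytic continuation to [C \ {1}] of the Dirichlet series
    [sum_(n >= 1) n^(-s)]. By the identity theorem this determines [f] on
    [C \ {1}]; the value of [f] at the pole 1 is unconstrained. *)
Definition is_riemann_zeta (f : C -> C) : Prop :=
  (forall s : C, 1 < Re s ->
     is_series (K := C_AbsRing) (V := C_NormedModule)
       (fun n => Cpower (INR (S n)) (- s)%C) (f s)) /\
  (forall s : C, s <> RtoC 1 -> analytic_at f s).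

Definition psi1 (z : C) : C :=
  (- stieltjes_gamma1 - Clog z / z
   - Cseries (fun k =>
       let n := INR (S k) in Clog (n + z) / (n + z) - Clog n / n))%C.

(** [is_vline_int f c l]: the improper integral of [f] along the upward line
    [s = c + i t], t from -oo to +oo, converges to [l]; here [ds = i dt]. *)
Definition is_vline_int (f : C -> C) (c : R) (l : C) : Prop :=
  is_RInt_gen (V := C_R_NormedModule)
    (fun t : R => (f (c + Ci * t) * Ci)%C)
    (Rbar_locally m_infty) (Rbar_locally p_infty) l.

(* Main.v *)
(** Write [x = z / u] and [phi s = gamma + psi s]. The proof rests on the Mellin
    pair, for [0 < c < 1] and [|arg x| < PI],
    [1/(2 PI i) int PI / sin (PI s) x^(-s) ds = 1 / (1 + x)],
    obtained by moving the line from [c] to [c - 1], which multiplies the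
    integral by [- x] and picks up the pole at 0. Dividing the integrand by
    [s + n] amounts to integrating in [log u]; summing
    [phi s = sum_n (1/(n+1) - 1/(n+s))] then gives the transform
    [(log x - log (1 + x)) / (1 + x)] of [PI / sin (PI s) phi s], so that
    [u^(s-1)] is transformed by the kernel of the theorem into
    [- log (u + z) / (u + z)]. In the strip, [zeta (1 - s)] is the limit of
    [sum_(n <= N) n^(s-1) - int_0^N u^(s-1) du], with an error
    [O(|s| N^(c-1))], hence the integral of the theorem is the limit of
    [1/2 log^2 (N + z) - 1/2 log^2 z - sum_(n <= N) log (n + z) / (n + z)],
    which is the left-hand side. *)

Require Import Defs.
From Stdlib Require Import Reals Factorial Lra Lia Psatz Classical.
From Coquelicot Require Import Coquelicot.
Open Scope R_scope.

(** * Calculus of complex-valued functions *)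

(** Complex functions are handled through real variables: a holomorphic function enters by its
    derivatives along horizontal and vertical lines, and a mean value inequality for curves in [C]
    replaces Cauchy's theorem. Constants of integration in [y = log u] are fixed by letting [y] tend
    to minus infinity. Integrals are taken in [t], without the factor [PI]; hence [2 / (1 + x)]
    appears where the Mellin pair has [1 / (1 + x)]. The approximation of [zeta (1 - s)] comes from
    the Dirichlet series, so only for [Re s < 0]; the identity theorem carries to the strip the
    formula [zeta (1 - s) = 1 - 1/s + (s - 1) int_1^oo {u} u^(s-2) du], whose truncations are
    exactly the approximations. For the digamma function, defined from Euler's limit, a second-order
    estimate uniform in n replaces the differentiation of a limit of holomorphic functions. *)

Definition ccont {U : UniformSpace} (f : U -> C) (x : U) : Prop :=
  continuous (fun u => fst (f u)) x /\ continuous (fun u => snd (f u)) x.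

(** Derivative along a real parameter, by components. Complex differentiation proper occurs only for
    [CGamma], through [digamma]. *)
Definition derive_RC (F : R -> C) (x : R) (l : C) : Prop :=
  is_derive (fun y => fst (F y)) x (fst l) /\
  is_derive (fun y => snd (F y)) x (snd l).

Lemma ccont_const {U : UniformSpace} (a : C) (x : U) : ccont (fun _ => a) x.
Proof. split; apply continuous_const. Qed.

Lemma ccont_ext {U : UniformSpace} (f g : U -> C) (x : U) :
  (forall u, f u = g u) -> ccont f x -> ccont g x.
Proof.
  intros H [H1 H2]; split.
  - apply continuous_ext with (2 := H1); intros u; now rewrite H.
  - apply continuous_ext with (2 := H2); intros u; now rewrite H.
Qed.

Lemma ccont_RtoC {U : UniformSpace} (f : U -> R) (x : U) :
  continuous f x -> ccont (fun u => RtoC (f u)) x.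
Proof. intros H; split; [exact H | apply continuous_const]. Qed.

Lemma ccont_pair {U : UniformSpace} (f g : U -> R) (x : U) :
  continuous f x -> continuous g x -> ccont (fun u => (f u, g u) : C) x.
Proof. now split. Qed.

Lemma ccont_plus {U : UniformSpace} (f g : U -> C) (x : U) :
  ccont f x -> ccont g x -> ccont (fun u => (f u + g u)%C) x.
Proof.
  intros [H1 H2] [H3 H4]; split.
  - exact (continuous_plus (V := R_NormedModule) _ _ _ H1 H3).
  - exact (continuous_plus (V := R_NormedModule) _ _ _ H2 H4).
Qed.

Lemma ccont_opp {U : UniformSpace} (f : U -> C) (x : U) :
  ccont f x -> ccont (fun u => (- f u)%C) x.
Proof.
  intros [H1 H2]; split.
  - exact (continuous_opp (V := R_NormedModule) _ _ H1).
  - exact (continuous_opp (V := R_NormedModule) _ _ H2).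
Qed.

Lemma ccont_minus {U : UniformSpace} (f g : U -> C) (x : U) :
  ccont f x -> ccont g x -> ccont (fun u => (f u - g u)%C) x.
Proof. intros; apply ccont_plus; [easy | now apply ccont_opp]. Qed.

Lemma continuous_Rmult {U : UniformSpace} (f g : U -> R) (x : U) :
  continuous f x -> continuous g x -> continuous (fun u => f u * g u) x.
Proof. exact (continuous_mult (K := R_AbsRing) f g x). Qed.

Lemma continuous_Rplus {U : UniformSpace} (f g : U -> R) (x : U) :
  continuous f x -> continuous g x -> continuous (fun u => f u + g u) x.
Proof. exact (continuous_plus (V := R_NormedModule) f g x). Qed.

Lemma continuous_Ropp {U : UniformSpace} (f : U -> R) (x : U) :
  continuous f x -> continuous (fun u => - f u) x.
Proof. exact (continuous_opp (V := R_NormedModule) f x). Qed.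

Lemma ccont_mult {U : UniformSpace} (f g : U -> C) (x : U) :
  ccont f x -> ccont g x -> ccont (fun u => (f u * g u)%C) x.
Proof.
  intros [H1 H2] [H3 H4]; split; cbn.
  - apply continuous_Rplus; [|apply continuous_Ropp]; now apply continuous_Rmult.
  - apply continuous_Rplus; now apply continuous_Rmult.
Qed.

Lemma sqr_norm_neq_0 (z : C) : z <> RtoC 0 -> fst z ^ 2 + snd z ^ 2 <> 0.
Proof.
  intros Hz H; apply Hz.
  destruct z as [x y]; cbn in H |- *.
  assert (x = 0) by nra. assert (y = 0) by nra. now subst.
Qed.

Lemma continuous_Rinv_comp {U : UniformSpace} (f : U -> R) (x : U) :
  continuous f x -> f x <> 0 -> continuous (fun u => / f u) x.
Proof.
  intros H1 H2.
  apply (continuous_comp f Rinv x H1).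
  now apply continuous_Rinv.
Qed.

Lemma ccont_inv {U : UniformSpace} (f : U -> C) (x : U) :
  ccont f x -> f x <> RtoC 0 -> ccont (fun u => (/ f u)%C) x.
Proof.
  intros [H1 H2] H. apply sqr_norm_neq_0 in H.
  assert (Hn : continuous (fun u => / (fst (f u) ^ 2 + snd (f u) ^ 2)) x).
  { apply (continuous_Rinv_comp (fun u => fst (f u) ^ 2 + snd (f u) ^ 2)); [|easy].
    assert (Hs : forall g : U -> R, continuous g x -> continuous (fun u => g u ^ 2) x).
    { intros g Hg. apply (continuous_Rmult g (fun u => g u * 1)); [easy|].
      apply (continuous_Rmult g (fun _ => 1)); [easy | apply continuous_const]. }
    apply continuous_Rplus; now apply Hs. }
  split; cbn; unfold Rdiv; apply continuous_Rmult; try easy.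
  now apply continuous_Ropp.
Qed.

Lemma ccont_div {U : UniformSpace} (f g : U -> C) (x : U) :
  ccont f x -> ccont g x -> g x <> RtoC 0 -> ccont (fun u => (f u / g u)%C) x.
Proof. intros; apply ccont_mult; [easy | now apply ccont_inv]. Qed.

Lemma ccont_Cexp {U : UniformSpace} (f : U -> C) (x : U) :
  ccont f x -> ccont (fun u => Cexp (f u)) x.
Proof.
  intros [H1 H2].
  assert (continuous (fun u => exp (fst (f u))) x) by
    (apply (continuous_comp (fun u => fst (f u)) exp); [easy | apply continuous_exp]).
  split; cbn; apply continuous_Rmult; try easy.
  - apply (continuous_comp (fun u => snd (f u)) cos); [easy | apply continuous_cos].
  - apply (continuous_comp (fun u => snd (f u)) sin); [easy | apply continuous_sin].
Qed.

Lemma ccont_Csin {U : UniformSpace} (f : U -> C) (x : U) :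
  ccont f x -> ccont (fun u => Csin (f u)) x.
Proof.
  intros H. unfold Csin, Cdiv.
  apply ccont_mult; [|apply ccont_const].
  apply ccont_minus; apply ccont_Cexp.
  - apply ccont_mult; [apply ccont_const | easy].
  - apply ccont_opp, ccont_mult; [apply ccont_const | easy].
Qed.

Lemma fst_le_Cmod (z : C) : Rabs (fst z) <= Cmod z.
Proof. apply Rle_trans with (2 := Rmax_Cmod z), Rmax_l. Qed.

Lemma snd_le_Cmod (z : C) : Rabs (snd z) <= Cmod z.
Proof. apply Rle_trans with (2 := Rmax_Cmod z), Rmax_r. Qed.

Lemma ccont_eps {U : UniformSpace} (f : U -> C) (x : U) :
  (forall eps, 0 < eps -> locally x (fun y => Cmod (f y - f x) < eps)) ->
  ccont f x.
Proof.
  intros H; split; apply filterlim_locally; intros eps;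
    generalize (H eps (cond_pos eps)); apply filter_imp; intros y Hy.
  - change (Rabs (fst (f y - f x)%C) < eps).
    apply Rle_lt_trans with (2 := Hy), fst_le_Cmod.
  - change (Rabs (snd (f y - f x)%C) < eps).
    apply Rle_lt_trans with (2 := Hy), snd_le_Cmod.
Qed.

Lemma Cmod_le_Rabs (z : C) : Cmod z <= Rabs (fst z) + Rabs (snd z).
Proof.
  destruct z as [x y]. replace ((x, y) : C) with (RtoC x + Ci * RtoC y)%C.
  - eapply Rle_trans; [apply Cmod_triangle|].
    rewrite Cmod_mult, Cmod_Ci, !Cmod_R, Rmult_1_l. cbn.
    replace (x + (0 * y - 1 * 0)) with x by ring.
    replace (0 + (0 * 0 + 1 * y)) with y by ring. lra.
  - unfold RtoC, Ci, Cplus, Cmult; cbn; f_equal; ring.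
Qed.

Lemma ccont_locally {U : UniformSpace} (f : U -> C) (x : U) (eps : R) :
  ccont f x -> 0 < eps -> locally x (fun y => Cmod (f y - f x) < eps).
Proof.
  intros [H1 H2] He.
  assert (He2 : 0 < eps / 2) by lra.
  apply filterlim_locally with (eps := mkposreal _ He2) in H1.
  apply filterlim_locally with (eps := mkposreal _ He2) in H2.
  generalize (filter_and _ _ H1 H2). apply filter_imp. intros y [A B].
  change (Rabs (fst (f y) - fst (f x)) < eps / 2) in A.
  change (Rabs (snd (f y) - snd (f x)) < eps / 2) in B.
  eapply Rle_lt_trans; [apply Cmod_le_Rabs|].
  cbn. unfold Rminus in A, B. lra.
Qed.

Lemma derive_RC_const (a : C) (x : R) : derive_RC (fun _ => a) x 0%C.
Proof.
  split; [change (is_derive (fun _ : R => fst a) x 0)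
         |change (is_derive (fun _ : R => snd a) x 0)]; now auto_derive.
Qed.

Lemma derive_RC_ext (F G : R -> C) (x : R) (l : C) :
  (forall y, F y = G y) -> derive_RC F x l -> derive_RC G x l.
Proof.
  intros H [H1 H2]; split.
  - apply is_derive_ext with (2 := H1); intros u; now rewrite H.
  - apply is_derive_ext with (2 := H2); intros u; now rewrite H.
Qed.

Lemma derive_RC_RtoC (F : R -> R) (x l : R) :
  is_derive F x l -> derive_RC (fun y => RtoC (F y)) x (RtoC l).
Proof. intros H; split; [exact H|].
  change (is_derive (fun _ : R => 0) x 0). now auto_derive.
Qed.

Lemma derive_RC_id (x : R) : derive_RC (fun y => RtoC y) x 1%C.
Proof. apply derive_RC_RtoC. apply (is_derive_id (K := R_AbsRing)). Qed.

Lemma derive_RC_plus (F G : R -> C) (x : R) (l m : C) :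
  derive_RC F x l -> derive_RC G x m -> derive_RC (fun y => (F y + G y)%C) x (l + m)%C.
Proof.
  intros [H1 H2] [H3 H4]; split.
  - exact (is_derive_plus (V := R_NormedModule) _ _ _ _ _ H1 H3).
  - exact (is_derive_plus (V := R_NormedModule) _ _ _ _ _ H2 H4).
Qed.

Lemma derive_RC_opp (F : R -> C) (x : R) (l : C) :
  derive_RC F x l -> derive_RC (fun y => (- F y)%C) x (- l)%C.
Proof.
  intros [H1 H2]; split.
  - exact (is_derive_opp (V := R_NormedModule) _ _ _ H1).
  - exact (is_derive_opp (V := R_NormedModule) _ _ _ H2).
Qed.

Lemma derive_RC_minus (F G : R -> C) (x : R) (l m : C) :
  derive_RC F x l -> derive_RC G x m -> derive_RC (fun y => (F y - G y)%C) x (l - m)%C.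
Proof. intros; apply derive_RC_plus; [easy | now apply derive_RC_opp]. Qed.

Lemma derive_RC_eq (F : R -> C) (x : R) (l m : C) : derive_RC F x l -> l = m -> derive_RC F x m.
Proof. now intros H <-. Qed.

Lemma derive_RC_mult (F G : R -> C) (x : R) (l m : C) :
  derive_RC F x l -> derive_RC G x m -> derive_RC (fun y => (F y * G y)%C) x (l * G x + F x * m)%C.
Proof.
  intros [H1 H2] [H3 H4]; split; cbn.
  - evar_last.
    + apply (is_derive_minus (V := R_NormedModule)
        (fun u => fst (F u) * fst (G u)) (fun u => snd (F u) * snd (G u)));
      apply (is_derive_mult (K := R_AbsRing)); try eassumption; exact Rmult_comm.
    + cbn; unfold minus, plus, opp, mult; cbn; ring.
  - evar_last.
    + apply (is_derive_plus (V := R_NormedModule)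
        (fun u => fst (F u) * snd (G u)) (fun u => snd (F u) * fst (G u)));
      apply (is_derive_mult (K := R_AbsRing)); try eassumption; exact Rmult_comm.
    + cbn; unfold minus, plus, opp, mult; cbn; ring.
Qed.

Lemma derive_RC_scal (a : C) (F : R -> C) (x : R) (l : C) :
  derive_RC F x l -> derive_RC (fun y => (a * F y)%C) x (a * l)%C.
Proof.
  intros H. eapply derive_RC_eq.
  - apply (derive_RC_mult (fun _ => a) F); [apply derive_RC_const | exact H].
  - cbn; ring.
Qed.

Lemma derive_RC_inv (F : R -> C) (x : R) (l : C) :
  derive_RC F x l -> F x <> RtoC 0 -> derive_RC (fun y => (/ F y)%C) x (- l / (F x * F x))%C.
Proof.
  intros [H1 H2] H. assert (Hn := sqr_norm_neq_0 _ H).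
  assert (E1 : Derive (fun y => fst (F y)) x = fst l) by (now apply is_derive_unique).
  assert (E2 : Derive (fun y => snd (F y)) x = snd l) by (now apply is_derive_unique).
  assert (X1 : ex_derive (fun y => fst (F y)) x) by (eexists; eassumption).
  assert (X2 : ex_derive (fun y => snd (F y)) x) by (eexists; eassumption).
  set (u := fun y => fst (F y)) in *. set (v := fun y => snd (F y)) in *.
  assert (Hn' : u x * (u x * 1) + v x * (v x * 1) <> 0) by exact Hn.
  destruct l as [l1 l2]; cbn in *.
  change (fst (F x)) with (u x) in *. change (snd (F x)) with (v x) in *.
  (* The squared norm of [F x * F x] is the square of that of [F x]; [field] asks for it to be
     nonzero. *)
  assert (Hn2 : (u x * u x - v x * v x) ^ 2 + (u x * v x + v x * u x) ^ 2 <> 0).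
  { replace ((u x * u x - v x * v x) ^ 2 + (u x * v x + v x * u x) ^ 2)
      with ((u x * (u x * 1) + v x * (v x * 1)) ^ 2) by ring.
    apply pow_nonzero, Hn'. }
  split.
  - change (is_derive (fun y => u y / (u y * (u y * 1) + v y * (v y * 1))) x
     (fst (- (l1, l2) / (F x * F x)))%C).
    auto_derive; [repeat split; easy|].
    change (Derive (fun x : R => u x) x) with (Derive u x);
    change (Derive (fun x : R => v x) x) with (Derive v x);
    rewrite E1, E2; cbn. change (fst (F x)) with (u x). change (snd (F x)) with (v x).
    field. split; intro Q; [apply Hn2; rewrite <- Q | apply Hn'; rewrite <- Q]; ring.
  - change (is_derive (fun y => - v y / (u y * (u y * 1) + v y * (v y * 1))) x
     (snd (- (l1, l2) / (F x * F x)))%C).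
    auto_derive; [repeat split; easy|].
    change (Derive (fun x : R => u x) x) with (Derive u x);
    change (Derive (fun x : R => v x) x) with (Derive v x);
    rewrite E1, E2; cbn. change (fst (F x)) with (u x). change (snd (F x)) with (v x).
    field. split; intro Q; [apply Hn2; rewrite <- Q | apply Hn'; rewrite <- Q]; ring.
Qed.

Lemma derive_RC_Cexp (F : R -> C) (x : R) (l : C) :
  derive_RC F x l -> derive_RC (fun y => Cexp (F y)) x (l * Cexp (F x))%C.
Proof.
  intros [H1 H2].
  assert (E1 : Derive (fun y => fst (F y)) x = fst l) by (now apply is_derive_unique).
  assert (E2 : Derive (fun y => snd (F y)) x = snd l) by (now apply is_derive_unique).
  assert (X1 : ex_derive (fun y => fst (F y)) x) by (eexists; eassumption).
  assert (X2 : ex_derive (fun y => snd (F y)) x) by (eexists; eassumption).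
  set (u := fun y => fst (F y)) in *. set (v := fun y => snd (F y)) in *.
  split.
  - change (is_derive (fun y => exp (u y) * cos (v y)) x (fst (l * Cexp (F x))%C)).
    auto_derive; [repeat split; easy|].
    change (Derive (fun x : R => u x) x) with (Derive u x);
    change (Derive (fun x : R => v x) x) with (Derive v x);
    rewrite E1, E2; cbn. change (Re (F x)) with (u x). change (Im (F x)) with (v x). ring.
  - change (is_derive (fun y => exp (u y) * sin (v y)) x (snd (l * Cexp (F x))%C)).
    auto_derive; [repeat split; easy|].
    change (Derive (fun x : R => u x) x) with (Derive u x);
    change (Derive (fun x : R => v x) x) with (Derive v x);
    rewrite E1, E2; cbn. change (Re (F x)) with (u x). change (Im (F x)) with (v x). ring.
Qed.

Lemma derive_RC_ccont (F : R -> C) (x : R) (l : C) : derive_RC F x l -> ccont F x.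
Proof.
  intros [H1 H2]; split; apply (ex_derive_continuous (V := R_NormedModule)); eexists; eassumption.
Qed.

(* Project the increment on its own direction and apply the real mean value theorem. *)
Lemma derive_RC_increment_le (F f : R -> C) (G g : R -> R) (a b : R) :
  a <= b ->
  (forall x, a <= x <= b -> derive_RC F x (f x)) ->
  (forall x, a <= x <= b -> is_derive G x (g x)) ->
  (forall x, a <= x <= b -> Cmod (f x) <= g x) ->
  Cmod (F b - F a) <= G b - G a.
Proof.
  intros Hab HF HG Hfg.
  set (v := (F b - F a)%C).
  (* A zero increment has no direction to project on; then only [G a <= G b] is left to prove. *)
  destruct (Req_dec (Cmod v) 0) as [Hv | Hv].
  - rewrite Hv.
    destruct (MVT_gen G a b g) as [x [Hx ->]].
    + intros x Hx. rewrite Rmin_left, Rmax_right in Hx by easy. apply HG; lra.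
    + intros x Hx. rewrite Rmin_left, Rmax_right in Hx by easy.
      apply continuity_pt_filterlim.
      exact (ex_derive_continuous (V := R_NormedModule) _ x (ex_intro _ _ (HG x Hx))).
    + rewrite Rmin_left, Rmax_right in Hx by easy.
      assert (0 <= g x) by (eapply Rle_trans; [apply Cmod_ge_0 | now apply Hfg]).
      apply Rmult_le_pos; lra.
  - assert (Hp : 0 < Cmod v) by (generalize (Cmod_ge_0 v); lra).
    set (r := fun x => fst v * fst (F x) + snd v * snd (F x)).
    assert (Dr : forall x, a <= x <= b ->
      is_derive (fun x => Cmod v * G x - r x) x
        (Cmod v * g x - (fst v * fst (f x) + snd v * snd (f x)))).
    { intros x Hx. unfold r. destruct (HF x Hx) as [D1 D2]. assert (D3 := HG x Hx).
      apply (is_derive_minus (V := R_NormedModule) (fun x => Cmod v * G x)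
        (fun x => fst v * fst (F x) + snd v * snd (F x))).
      - now apply is_derive_scal.
      - apply (is_derive_plus (V := R_NormedModule)
          (fun x => fst v * fst (F x)) (fun x => snd v * snd (F x)));
        now apply is_derive_scal. }
    destruct (MVT_gen (fun x => Cmod v * G x - r x) a b
       (fun x => Cmod v * g x - (fst v * fst (f x) + snd v * snd (f x)))) as [x [Hx E]].
    + intros x Hx. rewrite Rmin_left, Rmax_right in Hx by easy.
      apply (Dr x); lra.
    + intros x Hx. rewrite Rmin_left, Rmax_right in Hx by easy.
      apply continuity_pt_filterlim.
      exact (ex_derive_continuous (V := R_NormedModule) _ x (ex_intro _ _ (Dr x Hx))).
    + rewrite Rmin_left, Rmax_right in Hx by easy.
      (* Cauchy-Schwarz, read off from the real part of [Cconj v * f x]. *)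
      assert (Hcs : fst v * fst (f x) + snd v * snd (f x) <= Cmod v * Cmod (f x)).
      { replace (fst v * fst (f x) + snd v * snd (f x)) with (fst (Cconj v * f x)%C)
          by (cbn; ring).
        rewrite <- (Cmod_conj v), <- Cmod_mult.
        eapply Rle_trans; [apply Rle_abs|].
        eapply Rle_trans; [|apply Rmax_Cmod]. apply Rmax_l. }
      assert (Hg := Hfg x Hx).
      assert (Hpos : 0 <= Cmod v * g x - (fst v * fst (f x) + snd v * snd (f x))) by nra.
      assert (Er : r b - r a = Cmod v * Cmod v).
      { unfold r. assert (E2 := Cmod2_alt v). unfold Re, Im in E2.
        replace (Cmod v * Cmod v) with (Cmod v ^ 2) by ring. rewrite E2.
        unfold v; cbn; ring. }
      assert (0 <= Cmod v * (G b - G a) - Cmod v * Cmod v).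
      { rewrite <- Er. replace (Cmod v * (G b - G a) - (r b - r a)) with
          (Cmod v * G b - r b - (Cmod v * G a - r a)) by ring. rewrite E.
        apply Rmult_le_pos; lra. }
      apply Rmult_le_reg_l with (Cmod v); lra.
Qed.

(** * The complex exponential and logarithm *)

Lemma C_ext (a b : C) : fst a = fst b -> snd a = snd b -> a = b.
Proof. destruct a, b; cbn; now intros -> ->. Qed.

Lemma Cexp_plus (a b : C) : Cexp (a + b)%C = (Cexp a * Cexp b)%C.
Proof.
  apply C_ext; cbn; rewrite exp_plus, ?cos_plus, ?sin_plus; unfold Re, Im; ring.
Qed.

Lemma Cexp_RtoC (x : R) : Cexp (RtoC x) = RtoC (exp x).
Proof. apply C_ext; cbn; rewrite ?cos_0, ?sin_0; ring. Qed.

Lemma Cexp_0 : Cexp 0%C = 1%C.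
Proof. now rewrite Cexp_RtoC, exp_0. Qed.

Lemma Cmod_Cexp (a : C) : Cmod (Cexp a) = exp (Re a).
Proof.
  unfold Cmod; cbn.
  replace (exp (Re a) * cos (Im a) * (exp (Re a) * cos (Im a) * 1) +
   exp (Re a) * sin (Im a) * (exp (Re a) * sin (Im a) * 1))
   with (exp (Re a) * exp (Re a) * (Rsqr (sin (Im a)) + Rsqr (cos (Im a))))
   by (unfold Rsqr; ring).
  rewrite sin2_cos2, Rmult_1_r. apply sqrt_square, Rlt_le, exp_pos.
Qed.

Lemma Cexp_neq_0 (a : C) : Cexp a <> RtoC 0.
Proof. apply Cmod_gt_0. rewrite Cmod_Cexp. apply exp_pos. Qed.

Lemma Cexp_opp (a : C) : Cexp (- a)%C = (/ Cexp a)%C.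
Proof.
  assert (H : (Cexp (- a) * Cexp a = 1)%C).
  { rewrite <- Cexp_plus, <- Cexp_0. f_equal. ring. }
  rewrite <- (Cmult_1_l (/ Cexp a)), <- H. field. apply Cexp_neq_0.
Qed.

Lemma Cexp_minus (a b : C) : Cexp (a - b)%C = (Cexp a / Cexp b)%C.
Proof. unfold Cminus. now rewrite Cexp_plus, Cexp_opp. Qed.

(** Only the terms of degree below [n], so that differentiating along a ray takes [Cexp_sum (S n)]
    to [Cexp_sum n]. *)
Fixpoint Cexp_sum (n : nat) (u : C) : C :=
  match n with
  | O => 0%C
  | S k => (Cexp_sum k u + u ^ k * / INR (fact k))%C
  end.

Lemma derive_RC_ray_pow (u : C) (k : nat) (x : R) :
  derive_RC (fun y => ((y * u) ^ S k)%C) x (INR (S k) * u * (x * u) ^ k)%C.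
Proof.
  induction k as [|k IH].
  - eapply derive_RC_eq.
    + apply (derive_RC_ext (fun y => (u * y)%C)); [intros; cbn; ring|].
      apply derive_RC_scal, derive_RC_id.
    + cbn; ring.
  - eapply derive_RC_eq.
    + apply (derive_RC_ext (fun y => ((u * y) * (y * u) ^ S k)%C)); [intros; cbn; ring|].
      apply (derive_RC_mult (fun y => (u * y)%C)); [apply derive_RC_scal, derive_RC_id | apply IH].
    + rewrite (S_INR (S k)), RtoC_plus. cbn -[INR]. ring.
Qed.

Lemma INR_fact_C (n : nat) : RtoC (INR (fact n)) <> RtoC 0.
Proof. intros H. apply RtoC_inj in H. now apply (INR_fact_neq_0 n). Qed.

Lemma derive_RC_ray_Cexp_sum (u : C) (n : nat) (x : R) :
  derive_RC (fun y => Cexp_sum (S n) (y * u)) x (u * Cexp_sum n (x * u))%C.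
Proof.
  induction n as [|n IH].
  - eapply derive_RC_eq.
    + apply (derive_RC_ext (fun _ => 1%C)); [|apply derive_RC_const].
      intros; cbn. field.
    + cbn; ring.
  - eapply derive_RC_eq.
    + apply (derive_RC_plus (fun y => Cexp_sum (S n) (y * u))
               (fun y => (((y * u) ^ S n) * / INR (fact (S n)))%C)); [exact IH|].
      apply (derive_RC_ext (fun y => (/ INR (fact (S n)) * (y * u) ^ S n)%C));
        [intros; ring|].
      apply derive_RC_scal, derive_RC_ray_pow.
    + change (Cexp_sum (S n) (x * u)) with
        (Cexp_sum n (x * u) + (x * u) ^ n * / INR (fact n))%C.
      rewrite fact_simpl, mult_INR, RtoC_mult. field.
      split; [apply INR_fact_C|].
      intros H; apply RtoC_inj in H; now apply (not_0_INR (S n)).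
Qed.

Lemma derive_RC_ray_Cexp (u : C) (x : R) :
  derive_RC (fun y => Cexp (y * u)) x (u * Cexp (x * u))%C.
Proof.
  eapply derive_RC_eq.
  - apply derive_RC_Cexp. apply (derive_RC_ext (fun y => (u * y)%C)); [intros; ring|].
    apply derive_RC_scal, derive_RC_id.
  - cbn. ring.
Qed.

(** Along the ray [y -> y u] the derivative of the remainder of order [S n] is [u] times that of
    order [n], so the bound follows by integrating [y^n]. The exponential of [|Re u|], not of [|u|],
    keeps the bound useful for [u = h s] with [s] on a vertical line. *)
Lemma Cexp_remainder (n : nat) (u : C) :
  Cmod (Cexp u - Cexp_sum n u) <=
  Cmod u ^ n / INR (fact n) * exp (Rabs (Re u)).
Proof.
  revert u; induction n as [|n IH]; intros u.
  - cbn. replace (Cexp u - 0)%C with (Cexp u) by ring. rewrite Cmod_Cexp.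
    apply Rle_trans with (exp (Rabs (Re u))); [|lra].
    destruct (Rle_abs (Re u)) as [H|H]; [left; now apply exp_increasing | right; now rewrite <- H].
  - set (F := fun y : R => (Cexp (y * u) - Cexp_sum (S n) (y * u))%C).
    replace (Cexp u - Cexp_sum (S n) u)%C with (F 1 - F 0)%C.
    2:{ unfold F. replace (RtoC 0 * u)%C with (RtoC 0) by ring.
        replace (RtoC 1 * u)%C with u by ring. rewrite Cexp_0.
        replace (Cexp_sum (S n) 0) with (RtoC 1); [ring|].
        clear. induction n as [|n IH].
        - cbn. field.
        - change (RtoC 1 = Cexp_sum (S n) 0 + 0 ^ S n * / INR (fact (S n)))%C.
          rewrite <- IH. cbn -[fact INR]. ring. }
    set (A := Cmod u ^ S n / INR (fact (S n)) * exp (Rabs (Re u))).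
    set (G := fun y => A * y ^ S n).
    replace A with (G 1 - G 0) by (unfold G; rewrite pow1; cbn; ring).
    apply (derive_RC_increment_le F (fun x => u * (Cexp (x * u) - Cexp_sum n (x * u)))%C
      G (fun y => A * (INR (S n) * y ^ n))); [lra| | |].
    + intros x _. eapply derive_RC_eq; [apply derive_RC_minus; [apply derive_RC_ray_Cexp | apply derive_RC_ray_Cexp_sum]|].
      ring.
    + intros x _. unfold G. apply is_derive_scal.
      replace (INR (S n) * x ^ n) with (INR (S n) * 1 * x ^ pred (S n)) by (cbn -[INR]; ring).
      apply (is_derive_pow (fun y => y)). now auto_derive.
    + intros x Hx. rewrite Cmod_mult.
      assert (Hn := INR_fact_lt_0 n).
      eapply Rle_trans; [apply Rmult_le_compat_l; [apply Cmod_ge_0 | apply IH]|].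
      rewrite Cmod_mult, Cmod_R, Rabs_pos_eq by easy.
      unfold A. rewrite fact_simpl, mult_INR.
      assert (Hs := lt_0_INR (S n) (Nat.lt_0_succ n)).
      replace (Cmod u ^ S n / (INR (S n) * INR (fact n)) * exp (Rabs (Re u)) *
        (INR (S n) * x ^ n)) with
        (Cmod u * ((x * Cmod u) ^ n / INR (fact n) * exp (Rabs (Re u)))).
      2:{ rewrite Rpow_mult_distr. cbn -[INR]. field. split; lra. }
      apply Rmult_le_compat_l; [apply Cmod_ge_0|].
      apply Rmult_le_compat_l.
      { apply Rdiv_le_0_compat; [|easy]. apply pow_le, Rmult_le_pos; [easy | apply Cmod_ge_0]. }
      replace (Re (x * u)%C) with (x * Re u) by (cbn; unfold Re; ring).
      rewrite Rabs_mult, (Rabs_pos_eq x) by easy.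
      destruct (Rle_lt_or_eq_dec (x * Rabs (Re u)) (Rabs (Re u))) as [H|H].
      * generalize (Rabs_pos (Re u)); nra.
      * left; now apply exp_increasing.
      * rewrite H; lra.
Qed.

Lemma exp_le (a b : R) : a <= b -> exp a <= exp b.
Proof. intros [H|H]; [left; now apply exp_increasing | right; now rewrite H]. Qed.

Lemma Cexp_quadratic (u : C) :
  Cmod (Cexp u - 1 - u) <= Cmod u ^ 2 * exp (Rabs (Re u)).
Proof.
  assert (H := Cexp_remainder 2 u).
  replace (Cexp u - 1 - u)%C with (Cexp u - Cexp_sum 2 u)%C.
  2:{ cbn. field. }
  eapply Rle_trans; [exact H|]. cbn [fact INR Nat.mul Nat.add].
  assert (0 <= Cmod u ^ 2) by (apply pow2_ge_0).
  assert (0 < exp (Rabs (Re u))) by apply exp_pos.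
  apply Rmult_le_compat_r; [lra|]. lra.
Qed.

(** The plane cut along the nonpositive reals, where the principal logarithm is smooth; nonreal
    points satisfy the implication vacuously. *)
Definition offcut (z : C) : Prop := Im z = 0 -> 0 < Re z.

Lemma offcut_neq_0 (z : C) : offcut z -> z <> RtoC 0.
Proof. intros H ->. unfold offcut in H; cbn in H. lra. Qed.

Lemma offcut_Re_pos (z : C) : 0 < Re z -> offcut z.
Proof. now intros H _. Qed.

Lemma Cmod_sqr (z : C) : Cmod z * Cmod z = Re z * Re z + Im z * Im z.
Proof. generalize (Cmod2_alt z). cbn. lra. Qed.

(** This is the denominator of the half-angle formula for the argument; it vanishes exactly on the
    cut. *)
Lemma offcut_den_pos (z : C) : offcut z -> 0 < Cmod z + Re z.
Proof.
  intros H. assert (E := Cmod_sqr z). assert (P := Cmod_ge_0 z).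
  unfold offcut in H. destruct (Rlt_dec 0 (Re z)); [lra|].
  destruct (Req_dec (Im z) 0) as [E0|E0]; [specialize (H E0); lra|].
  assert (0 < Im z * Im z) by nra. nra.
Qed.

(** Half of the difference has sine zero and lies strictly between [- PI] and [PI]; one strict upper
    bound suffices for that. *)
Lemma cos_sin_unique (a b : R) :
  - PI < a < PI -> - PI < b <= PI -> cos a = cos b -> sin a = sin b -> a = b.
Proof.
  intros Ha Hb Hc Hs.
  assert (H1 : cos (a - b) = 1).
  { rewrite cos_minus, Hc, Hs. generalize (sin2_cos2 b). unfold Rsqr. lra. }
  assert (H2 : sin ((a - b) / 2) = 0).
  { replace (a - b) with (2 * ((a - b) / 2)) in H1 by field.
    rewrite cos_2a_sin in H1. nra. }
  destruct (Rtotal_order ((a - b) / 2) 0) as [L|[E|G]]; [|lra|].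
  - assert (sin (- ((a - b) / 2)) > 0) by (apply sin_gt_0; lra).
    rewrite sin_neg in H. lra.
  - assert (sin ((a - b) / 2) > 0) by (apply sin_gt_0; lra). lra.
Qed.

Lemma Carg_spec (z : C) : z <> RtoC 0 ->
  (- PI < Carg z <= PI) /\ Cmod z * cos (Carg z) = Re z /\ Cmod z * sin (Carg z) = Im z.
Proof.
  intros Hz. apply Cmod_gt_0 in Hz. assert (E := Cmod_sqr z).
  assert (B : -1 <= Re z / Cmod z <= 1).
  { split; apply Rmult_le_reg_r with (Cmod z); try easy;
    unfold Rdiv; rewrite Rmult_assoc, Rinv_l by lra; nra. }
  assert (Hs : Cmod z * sqrt (1 - Rsqr (Re z / Cmod z)) = Rabs (Im z)).
  { replace (1 - Rsqr (Re z / Cmod z)) with (Rsqr (Im z / Cmod z)).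
    - rewrite sqrt_Rsqr_abs. unfold Rdiv. rewrite Rabs_mult, Rabs_inv.
      rewrite (Rabs_pos_eq (Cmod z)) by lra. field; lra.
    - unfold Rsqr. apply Rmult_eq_reg_r with (Cmod z * Cmod z); [|nra].
      field_simplify; try lra. }
  assert (A := acos_bound (Re z / Cmod z)).
  unfold Carg. destruct (Rlt_dec (Im z) 0) as [L|L].
  - rewrite cos_neg, sin_neg, cos_acos, sin_acos by easy.
    rewrite Rabs_left in Hs by easy.
    repeat split; try lra; [|field; lra].
    (* The argument [- PI] is excluded: the sine would vanish, and with it the imaginary part, which
       is negative here. *)
    destruct (Req_dec (acos (Re z / Cmod z)) PI) as [P|P]; [|lra].
    assert (F := sin_acos _ B). rewrite P, sin_PI in F.
    rewrite <- F in Hs. lra.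
  - rewrite cos_acos, sin_acos by easy.
    rewrite Rabs_pos_eq in Hs by lra.
    assert (PI_p := PI_RGT_0). repeat split; try lra. field; lra.
Qed.

Lemma Cexp_Clog (z : C) : z <> RtoC 0 -> Cexp (Clog z) = z.
Proof.
  intros Hz. destruct (Carg_spec z Hz) as [_ [H1 H2]]. apply Cmod_gt_0 in Hz.
  apply C_ext; cbn; rewrite exp_ln by easy; easy.
Qed.

Lemma Clog_Cexp (w : C) : - PI < Im w < PI -> Clog (Cexp w) = w.
Proof.
  intros H. destruct (Carg_spec (Cexp w) (Cexp_neq_0 w)) as [H0 [H1 H2]].
  rewrite Cmod_Cexp in H1, H2.
  change (Re (Cexp w)) with (exp (Re w) * cos (Im w)) in H1.
  change (Im (Cexp w)) with (exp (Re w) * sin (Im w)) in H2.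
  assert (P := exp_pos (Re w)).
  apply C_ext.
  - change (ln (Cmod (Cexp w)) = Re w). now rewrite Cmod_Cexp, ln_exp.
  - change (Carg (Cexp w) = Im w). symmetry. apply cos_sin_unique; try easy.
    + apply Rmult_eq_reg_l with (exp (Re w)); lra.
    + apply Rmult_eq_reg_l with (exp (Re w)); lra.
Qed.

(* The half-angle formula, a single smooth expression off the cut. *)
Lemma Carg_atan (z : C) : offcut z -> Carg z = 2 * atan (Im z / (Cmod z + Re z)).
Proof.
  intros Ho. assert (Hd := offcut_den_pos z Ho).
  destruct (Carg_spec z (offcut_neq_0 z Ho)) as [H0 [H1 H2]].
  assert (Hp : 0 < Cmod z) by (apply Cmod_gt_0, offcut_neq_0, Ho).
  assert (E := Cmod_sqr z).
  set (t := Im z / (Cmod z + Re z)). assert (A := atan_bound t).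
  assert (Et : t * (Cmod z + Re z) = Im z) by (unfold t; field; lra).
  assert (C0 : 0 < cos (atan t)) by (apply cos_gt_0; lra).
  assert (S0 : sin (atan t) = t * cos (atan t)).
  { rewrite <- (tan_atan t) at 2. unfold tan. field. lra. }
  assert (Q := sin2_cos2 (atan t)). unfold Rsqr in Q. rewrite S0 in Q.
  assert (C2 : cos (atan t) * cos (atan t) = (Cmod z + Re z) / (2 * Cmod z)).
  { apply Rmult_eq_reg_r with (2 * Cmod z); [|lra].
    replace ((Cmod z + Re z) / (2 * Cmod z) * (2 * Cmod z)) with (Cmod z + Re z) by (field; lra).
    set (c := cos (atan t)) in *.
    apply Rmult_eq_reg_r with (Cmod z + Re z); [|lra].
    assert (X : (t * t + 1) * (Cmod z + Re z) = 2 * Cmod z).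
    { apply Rmult_eq_reg_r with (Cmod z + Re z); [|lra].
      replace ((t * t + 1) * (Cmod z + Re z) * (Cmod z + Re z)) with
        ((t * (Cmod z + Re z)) * (t * (Cmod z + Re z)) + (Cmod z + Re z) * (Cmod z + Re z)) by ring.
      rewrite Et. lra. }
    rewrite <- X. replace (c * c * ((t * t + 1) * (Cmod z + Re z)) * (Cmod z + Re z))
      with ((t * c * (t * c) + c * c) * (Cmod z + Re z) * (Cmod z + Re z)) by ring.
    rewrite Q. ring. }
  symmetry. apply cos_sin_unique; [lra | easy | |].
  - apply Rmult_eq_reg_l with (Cmod z); [|lra]. rewrite H1, cos_2a_cos.
    replace (2 * cos (atan t) * cos (atan t)) with (2 * (cos (atan t) * cos (atan t))) by ring.
    rewrite C2. field. lra.
  - apply Rmult_eq_reg_l with (Cmod z); [|lra]. rewrite H2, sin_2a, S0.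
    replace (2 * (t * cos (atan t)) * cos (atan t)) with (2 * t * (cos (atan t) * cos (atan t))) by ring.
    rewrite C2, <- Et. field. lra.
Qed.

Lemma Carg_offcut_bound (z : C) : offcut z -> - PI < Carg z < PI.
Proof. intros H. rewrite Carg_atan by easy. generalize (atan_bound (Im z / (Cmod z + Re z))). lra. Qed.

Lemma offcut_of_Carg (z : C) : z <> RtoC 0 -> Rabs (Carg z) < PI -> offcut z.
Proof.
  intros Hz Ha Hi. destruct (Carg_spec z Hz) as [_ [H1 H2]].
  apply Cmod_gt_0 in Hz. apply Rabs_def2 in Ha.
  assert (S0 : sin (Carg z) = 0) by (apply Rmult_eq_reg_l with (Cmod z); lra).
  destruct (Rtotal_order (Carg z) 0) as [L|[E|G]].
  - assert (sin (- Carg z) > 0) by (apply sin_gt_0; lra). rewrite sin_neg in H. lra.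
  - rewrite E, cos_0 in H1. lra.
  - assert (sin (Carg z) > 0) by (apply sin_gt_0; lra). lra.
Qed.

Lemma offcut_Cexp (w : C) : - PI < Im w < PI -> offcut (Cexp w).
Proof.
  intros H. apply offcut_of_Carg; [apply Cexp_neq_0|].
  assert (E := Clog_Cexp w H). apply (f_equal snd) in E.
  change (Carg (Cexp w) = Im w) in E. rewrite E.
  apply Rabs_def1; lra.
Qed.

Lemma locally_offcut (F : R -> C) (x : R) :
  ccont F x -> offcut (F x) -> locally x (fun y => offcut (F y)).
Proof.
  intros Hc Ho. assert (Hd := offcut_den_pos _ Ho).
  (* Moving [F x] by less than [e] changes [Cmod + Re] by less than [2 e], so the sum stays
     positive, whereas it is zero at a nonpositive real. *)
  set (e := (Cmod (F x) + Re (F x)) / 2). assert (He : 0 < e) by (unfold e; lra).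
  generalize (ccont_locally F x e Hc He). apply filter_imp. intros y Hy.
  assert (H1 : Cmod (F x) <= Cmod (F y) + Cmod (F y - F x)).
  { replace (F x) with (F y + - (F y - F x))%C at 1 by ring.
    eapply Rle_trans; [apply Cmod_triangle|]. rewrite Cmod_opp. lra. }
  assert (H2 : Rabs (Re (F y) - Re (F x)) <= Cmod (F y - F x)).
  { apply Rle_trans with (2 := re_le_Cmod _). right; reflexivity. }
  apply Rabs_le_between in H2. unfold e in Hy.
  intros Hi. assert (E := Cmod_sqr (F y)). rewrite Hi in E.
  assert (P := Cmod_ge_0 (F y)). nra.
Qed.

Lemma derive_RC_Clog (F : R -> C) (x : R) (l : C) :
  derive_RC F x l -> offcut (F x) -> derive_RC (fun y => Clog (F y)) x (l / F x)%C.
Proof.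
  intros HF Ho. assert (Hl := locally_offcut F x (derive_RC_ccont F x l HF) Ho).
  destruct HF as [H1 H2].
  assert (Hn := sqr_norm_neq_0 _ (offcut_neq_0 _ Ho)).
  assert (Hp : 0 < Cmod (F x)) by (apply Cmod_gt_0, offcut_neq_0, Ho).
  assert (Hd := offcut_den_pos _ Ho).
  assert (E := Cmod_sqr (F x)).
  assert (E1 : Derive (fun y => fst (F y)) x = fst l) by (now apply is_derive_unique).
  assert (E2 : Derive (fun y => snd (F y)) x = snd l) by (now apply is_derive_unique).
  assert (X1 : ex_derive (fun y => fst (F y)) x) by (eexists; eassumption).
  assert (X2 : ex_derive (fun y => snd (F y)) x) by (eexists; eassumption).
  set (u := fun y => fst (F y)) in *. set (v := fun y => snd (F y)) in *.
  destruct l as [l1 l2]; cbn [fst snd] in *.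
  assert (Em : Cmod (F x) = sqrt (u x * (u x * 1) + v x * (v x * 1))) by reflexivity.
  assert (Hq : 0 < u x * (u x * 1) + v x * (v x * 1)).
  { destruct (Rle_lt_or_eq_dec 0 (u x * (u x * 1) + v x * (v x * 1))); [nra|easy|].
    rewrite <- e, sqrt_0 in Em. lra. }
  change (Re (F x)) with (u x) in *. change (Im (F x)) with (v x) in *.
  split.
  - change (is_derive (fun y => ln (sqrt (u y * (u y * 1) + v y * (v y * 1)))) x
     (fst ((l1, l2) / F x)%C)).
    auto_derive; [repeat split; try easy; rewrite <- Em; easy|].
    change (Derive (fun x : R => u x) x) with (Derive u x);
    change (Derive (fun x : R => v x) x) with (Derive v x).
    rewrite E1, E2, <- Em. cbn. change (fst (F x)) with (u x). change (snd (F x)) with (v x).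
    set (m := Cmod (F x)) in *.
    replace (u x * (u x * 1) + v x * (v x * 1)) with (m * m) by lra. field. lra.
  (* Near [x] the curve stays off the cut, so the argument can be replaced by its half-angle form,
     which is differentiable at once. *)
  - apply is_derive_ext_loc with
      (fun y => 2 * atan (v y / (sqrt (u y * (u y * 1) + v y * (v y * 1)) + u y))).
    { generalize Hl. apply filter_imp. intros y Hy. symmetry. exact (Carg_atan _ Hy). }
    auto_derive; [repeat split; try easy; rewrite <- Em; lra|].
    change (Derive (fun x : R => u x) x) with (Derive u x);
    change (Derive (fun x : R => v x) x) with (Derive v x).
    rewrite E1, E2, <- Em. cbn. change (fst (F x)) with (u x). change (snd (F x)) with (v x).
    set (m := Cmod (F x)) in *.
    replace (u x * (u x * 1) + v x * (v x * 1)) with (m * m) by lra.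
    assert (V2 : v x * v x = m * m - u x * u x) by lra.
    (* With [tan (arg / 2) = v / (m + u)], this is [1 + tan^2 = 2 m / (m + u)]. *)
    assert (E3 : 1 + v x * / (m + u x) * (v x * / (m + u x) * 1) = 2 * m / (m + u x)).
    { replace (1 + v x * / (m + u x) * (v x * / (m + u x) * 1))
        with (1 + v x * v x / ((m + u x) * (m + u x))) by (field; lra).
      rewrite V2. field. lra. }
    rewrite E3.
    match goal with |- ?A = _ => replace A with
      ((l2 * m * (m + u x) - v x * l1 * (m + u x) - l2 * (v x * v x)) / (m * m * (m + u x)))
      by (field; lra) end.
    rewrite V2. field. lra.
Qed.

Lemma Cmod_minus_sym (a b : C) : Cmod (a - b) = Cmod (b - a).
Proof. rewrite <- Cmod_opp. f_equal. ring. Qed.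

Lemma Cmod_triangle_inv (a b : C) : Cmod a - Cmod b <= Cmod (a + b).
Proof.
  assert (H := Cmod_triangle (a + b) (- b)). rewrite Cmod_opp in H.
  replace (a + b + - b)%C with a in H by ring. lra.
Qed.

Lemma Clog_1 : Clog 1%C = 0%C.
Proof.
  rewrite <- Cexp_0. apply Clog_Cexp. cbn. generalize PI_RGT_0; lra.
Qed.

(** Along the ray, the remainder has derivative [- x h^2 / (1 + x h)]; since [|1 + x h| >= 1/2] it
    is at most [2 x |h|^2], which integrates to [|h|^2]. *)
Lemma Clog_taylor_1 (h : C) : Cmod h <= / 2 -> Cmod (Clog (1 + h) - h) <= Cmod h ^ 2.
Proof.
  intros Hh.
  set (F := fun y : R => (Clog (1 + y * h) - y * h)%C).
  replace (Clog (1 + h) - h)%C with (F 1 - F 0)%C.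
  2:{ unfold F. replace (RtoC 0 * h)%C with (RtoC 0) by ring.
      replace (RtoC 1 * h)%C with h by ring.
      replace (1 + 0)%C with (RtoC 1) by ring. rewrite Clog_1. ring. }
  set (G := fun y => Cmod h ^ 2 * y ^ 2).
  replace (Cmod h ^ 2) with (G 1 - G 0) by (unfold G; ring).
  assert (Hm : forall x, 0 <= x <= 1 -> / 2 <= Cmod (1 + x * h)).
  { intros x Hx. eapply Rle_trans; [|apply Cmod_triangle_inv].
    rewrite Cmod_1, Cmod_mult, Cmod_R, Rabs_pos_eq by easy.
    assert (P := Cmod_ge_0 h). nra. }
  assert (Hr : forall x, 0 <= x <= 1 -> 0 < Re (1 + x * h)).
  { intros x Hx. assert (R1 := re_le_Cmod h). apply Rabs_le_between in R1.
    replace (Re (1 + x * h)%C) with (1 + x * Re h) by (cbn; unfold Re; ring). nra. }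
  apply (derive_RC_increment_le F (fun x => - (x * h * h) / (1 + x * h))%C
     G (fun y => Cmod h ^ 2 * (2 * y))); [lra| | |].
  - intros x Hx. unfold F.
    assert (D1 : derive_RC (fun y : R => (y * h)%C) x h).
    { eapply derive_RC_eq.
      - apply (derive_RC_ext (fun y : R => (h * y)%C)); [intros; ring|]. apply derive_RC_scal, derive_RC_id.
      - ring. }
    eapply derive_RC_eq.
    + apply derive_RC_minus; [|exact D1]. apply derive_RC_Clog; [|apply offcut_Re_pos, Hr, Hx].
      apply derive_RC_plus; [apply derive_RC_const | exact D1].
    + cbv beta. field. apply Cmod_gt_0. specialize (Hm x Hx). lra.
  - intros x _. unfold G. auto_derive; [easy|]. ring.
  - intros x Hx. specialize (Hm x Hx).
    rewrite Cmod_div by (apply Cmod_gt_0; lra).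
    rewrite Cmod_opp, !Cmod_mult, Cmod_R, Rabs_pos_eq by easy.
    apply Rmult_le_reg_r with (Cmod (1 + x * h)); [lra|].
    unfold Rdiv. rewrite Rmult_assoc, Rinv_l, Rmult_1_r by lra.
    assert (P : 0 <= x * (Cmod h * Cmod h)) by (apply Rmult_le_pos; [easy | nra]).
    cbn. nra.
Qed.

Lemma Clog_near_1 (h : C) : Cmod h <= / 2 -> Cmod (Clog (1 + h)) <= 2 * Cmod h.
Proof.
  intros Hh. assert (H := Clog_taylor_1 h Hh). assert (P := Cmod_ge_0 h).
  replace (Clog (1 + h)) with ((Clog (1 + h) - h) + h)%C by ring.
  eapply Rle_trans; [apply Cmod_triangle|]. cbn in H. nra.
Qed.

(** * Absolutely convergent integrals over a line *)

Definition contC (f : R -> C) : Prop := forall t, ccont f t.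

(** A total value by components; [Cint_is_RInt] links it to the integral used in the statement. *)
Definition Cint (f : R -> C) (a b : R) : C :=
  (RInt (fun t => fst (f t)) a b, RInt (fun t => snd (f t)) a b).

Lemma ex_RInt_contR (f : R -> R) (a b : R) :
  (forall t, continuous f t) -> ex_RInt f a b.
Proof. intros H. apply (ex_RInt_continuous (V := R_CompleteNormedModule)). easy. Qed.

Lemma Cint_is_RInt (f : R -> C) (a b : R) :
  contC f -> is_RInt (V := C_R_NormedModule) f a b (Cint f a b).
Proof.
  intros H. apply (is_RInt_fct_extend_pair (U := R_NormedModule) (V := R_NormedModule));
  apply (RInt_correct (V := R_CompleteNormedModule)), ex_RInt_contR; intros t; apply H.
Qed.

Lemma Cint_ext (f g : R -> C) (a b : R) :
  (forall t, f t = g t) -> Cint f a b = Cint g a b.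
Proof.
  intros H. unfold Cint.
  f_equal; apply RInt_ext; intros; now rewrite H.
Qed.

Lemma Cint_derive_RC (f : R -> C) (a x : R) : contC f -> derive_RC (fun y => Cint f a y) x (f x).
Proof.
  intros H. split.
  - apply (is_derive_RInt (V := R_CompleteNormedModule) (fun t => fst (f t)) _ a);
    [|apply H]. apply filter_forall. intros y.
    apply (RInt_correct (V := R_CompleteNormedModule)), ex_RInt_contR; intros t; apply H.
  - apply (is_derive_RInt (V := R_CompleteNormedModule) (fun t => snd (f t)) _ a);
    [|apply H]. apply filter_forall. intros y.
    apply (RInt_correct (V := R_CompleteNormedModule)), ex_RInt_contR; intros t; apply H.
Qed.

Lemma Cint_point (f : R -> C) (a : R) : Cint f a a = 0%C.
Proof. unfold Cint. now rewrite !RInt_point. Qed.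

Lemma derive_RC_zero_const (F : R -> C) (a b : R) : a <= b ->
  (forall x, a <= x <= b -> derive_RC F x 0%C) -> F b = F a.
Proof.
  intros Hab H.
  assert (E : Cmod (F b - F a) <= (fun _ : R => 0) b - (fun _ : R => 0) a).
  { apply (derive_RC_increment_le F (fun _ => 0%C) (fun _ => 0) (fun _ => 0)); try easy.
    - intros; now auto_derive.
    - intros; rewrite Cmod_0; lra. }
  cbv beta in E. rewrite Rminus_0_r in E.
  assert (E0 : (F b - F a)%C = 0%C) by (apply Cmod_eq_0; generalize (Cmod_ge_0 (F b - F a)); lra).
  replace (F b) with ((F b - F a) + F a)%C by ring. rewrite E0. ring.
Qed.

(** Besides evaluating integrals, this yields their linearity: both sides have the same derivative
    in the upper end. *)
Lemma Cint_unique (f F : R -> C) (a b : R) : a <= b -> contC f ->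
  (forall x, a <= x <= b -> derive_RC F x (f x)) -> Cint f a b = (F b - F a)%C.
Proof.
  intros Hab Hf HF.
  assert (E := derive_RC_zero_const (fun x => Cint f a x - F x)%C a b Hab).
  cbv beta in E. rewrite Cint_point in E.
  replace (Cint f a b) with (Cint f a b - F b + F b)%C by ring. rewrite E; [ring|].
  intros x Hx. eapply derive_RC_eq; [apply derive_RC_minus; [now apply Cint_derive_RC | now apply HF]|]. ring.
Qed.

Lemma Cint_Chasles (f : R -> C) (a b c : R) : contC f ->
  (Cint f a b + Cint f b c)%C = Cint f a c.
Proof.
  intros H. apply C_ext; cbn.
  - apply (RInt_Chasles (V := R_CompleteNormedModule) (fun t => fst (f t)));
      apply ex_RInt_contR; intros t; apply H.
  - apply (RInt_Chasles (V := R_CompleteNormedModule) (fun t => snd (f t)));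
      apply ex_RInt_contR; intros t; apply H.
Qed.

Lemma contC_plus (f g : R -> C) : contC f -> contC g -> contC (fun t => f t + g t)%C.
Proof. intros Hf Hg t. now apply ccont_plus. Qed.

Lemma contC_mult (f g : R -> C) : contC f -> contC g -> contC (fun t => f t * g t)%C.
Proof. intros Hf Hg t. now apply ccont_mult. Qed.

Lemma contC_const (a : C) : contC (fun _ => a).
Proof. intros t. apply ccont_const. Qed.

Lemma Cint_plus (f g : R -> C) (a b : R) : a <= b -> contC f -> contC g ->
  Cint (fun t => f t + g t)%C a b = (Cint f a b + Cint g a b)%C.
Proof.
  intros Hab Hf Hg.
  rewrite (Cint_unique _ (fun x => Cint f a x + Cint g a x)%C a b Hab).
  - rewrite !Cint_point. ring.
  - now apply contC_plus.
  - intros x _. apply derive_RC_plus; now apply Cint_derive_RC.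
Qed.

Lemma Cint_scal (k : C) (f : R -> C) (a b : R) : a <= b -> contC f ->
  Cint (fun t => k * f t)%C a b = (k * Cint f a b)%C.
Proof.
  intros Hab Hf.
  rewrite (Cint_unique _ (fun x => k * Cint f a x)%C a b Hab).
  - rewrite !Cint_point. ring.
  - apply contC_mult; [apply contC_const | easy].
  - intros x _. apply derive_RC_scal; now apply Cint_derive_RC.
Qed.

(** The dominating function comes with a primitive, so that no real integral has to be computed. *)
Lemma Cint_bound (f : R -> C) (G g : R -> R) (a b : R) : a <= b -> contC f ->
  (forall x, a <= x <= b -> is_derive G x (g x)) ->
  (forall x, a <= x <= b -> Cmod (f x) <= g x) ->
  Cmod (Cint f a b) <= G b - G a.
Proof.
  intros Hab Hf HG Hg.
  replace (Cint f a b) with (Cint f a b - Cint f a a)%C by (rewrite Cint_point; ring).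
  apply (derive_RC_increment_le (fun x => Cint f a x) f G g); try easy.
  intros; now apply Cint_derive_RC.
Qed.

(** The two ends go to infinity independently, as the improper integral of the statement
    requires. *)
Definition is_line_int (f : R -> C) (l : C) : Prop :=
  forall eps, 0 < eps -> exists A, 0 < A /\
    forall a b, a <= - A -> A <= b -> Cmod (Cint f a b - l) < eps.

Lemma is_line_int_RInt_gen (f : R -> C) (l : C) : contC f -> is_line_int f l ->
  is_RInt_gen (V := C_R_NormedModule) f
    (Rbar_locally m_infty) (Rbar_locally p_infty) l.
Proof.
  intros Hf Hl P [eps HP].
  destruct (Hl eps (cond_pos eps)) as [A [HA H]].
  exists (fun a => a < - A) (fun b => A < b).
  - exists (- A). easy.
  - exists A. easy.
  - intros a b Ha Hb. exists (Cint f a b). split; [now apply Cint_is_RInt|].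
    apply HP. specialize (H a b (Rlt_le _ _ Ha) (Rlt_le _ _ Hb)).
    split.
    + change (Rabs (fst (Cint f a b - l)%C) < eps).
      apply Rle_lt_trans with (2 := H), fst_le_Cmod.
    + change (Rabs (snd (Cint f a b - l)%C) < eps).
      apply Rle_lt_trans with (2 := H), snd_le_Cmod.
Qed.

Lemma is_line_int_plus (f g : R -> C) (l m : C) : contC f -> contC g ->
  is_line_int f l -> is_line_int g m -> is_line_int (fun t => f t + g t)%C (l + m)%C.
Proof.
  intros Cf Cg Hf Hg eps He.
  destruct (Hf (eps / 2)) as [A [HA H1]]; [lra|].
  destruct (Hg (eps / 2)) as [B [HB H2]]; [lra|].
  exists (Rmax A B). split; [apply Rlt_le_trans with (1 := HA), Rmax_l|].
  intros a b Ha Hb.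
  assert (M1 := Rmax_l A B). assert (M2 := Rmax_r A B).
  rewrite Cint_plus by (easy || lra).
  replace (Cint f a b + Cint g a b - (l + m))%C
    with ((Cint f a b - l) + (Cint g a b - m))%C by ring.
  eapply Rle_lt_trans; [apply Cmod_triangle|].
  specialize (H1 a b ltac:(lra) ltac:(lra)). specialize (H2 a b ltac:(lra) ltac:(lra)). lra.
Qed.

Lemma is_line_int_scal (k : C) (f : R -> C) (l : C) : contC f ->
  is_line_int f l -> is_line_int (fun t => k * f t)%C (k * l)%C.
Proof.
  intros Cf Hf eps He. assert (P := Cmod_ge_0 k).
  destruct (Hf (eps / (Cmod k + 1))) as [A [HA H1]]; [apply Rdiv_lt_0_compat; lra|].
  exists A. split; [easy|]. intros a b Ha Hb. rewrite Cint_scal by (easy || lra).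
  replace (k * Cint f a b - k * l)%C with (k * (Cint f a b - l))%C by ring.
  rewrite Cmod_mult. specialize (H1 a b Ha Hb).
  assert (Q := Cmod_ge_0 (Cint f a b - l)).
  assert (E : eps = eps / (Cmod k + 1) * (Cmod k + 1)) by (field; lra).
  nra.
Qed.

Lemma is_line_int_ext (f g : R -> C) (l : C) : (forall t, f t = g t) -> is_line_int f l -> is_line_int g l.
Proof.
  intros H Hf eps He. destruct (Hf eps He) as [A [HA H1]]. exists A. split; [easy|].
  intros a b Ha Hb. rewrite <- (Cint_ext f g) by easy. now apply H1.
Qed.

Lemma is_derive_exp_decay (M d x : R) : d <> 0 ->
  is_derive (fun t => - M / d * exp (- d * t)) x (M * exp (- d * x)).
Proof. intros Hd. auto_derive; [easy|]. field. easy. Qed.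

Lemma is_derive_exp_growth (M d x : R) : d <> 0 ->
  is_derive (fun t => M / d * exp (d * t)) x (M * exp (d * x)).
Proof. intros Hd. auto_derive; [easy|]. field. easy. Qed.

Lemma Cint_decay_pos (f : R -> C) (M d a b : R) : contC f -> 0 < d -> 0 <= M ->
  (forall t, Cmod (f t) <= M * exp (- d * Rabs t)) -> 0 <= a <= b ->
  Cmod (Cint f a b) <= M / d * exp (- d * a) - M / d * exp (- d * b).
Proof.
  intros Cf Hd HM Hf Hab.
  eapply Rle_trans.
  - apply (Cint_bound f (fun t => - M / d * exp (- d * t)) (fun t => M * exp (- d * t)));
      [easy|easy| |].
    + intros x _. apply is_derive_exp_decay. lra.
    + intros x Hx. generalize (Hf x). now rewrite (Rabs_pos_eq x) by lra.
  - unfold Rdiv. lra.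
Qed.

Lemma Cint_decay_neg (f : R -> C) (M d a b : R) : contC f -> 0 < d -> 0 <= M ->
  (forall t, Cmod (f t) <= M * exp (- d * Rabs t)) -> a <= b <= 0 ->
  Cmod (Cint f a b) <= M / d * exp (d * b) - M / d * exp (d * a).
Proof.
  intros Cf Hd HM Hf Hab.
  apply (Cint_bound f (fun t => M / d * exp (d * t)) (fun t => M * exp (d * t))); [easy|easy| |].
  - intros x _. apply is_derive_exp_growth. lra.
  - intros x Hx. generalize (Hf x). rewrite (Rabs_left1 x) by lra.
    now replace (- d * - x) with (d * x) by ring.
Qed.

Lemma exp_decay_small (K d eps : R) : 0 < d -> 0 <= K -> 0 < eps ->
  exists A, 0 < A /\ forall x, A <= x -> K * exp (- d * x) < eps.
Proof.
  (* From [exp (d x) > d x], every [x] above [K / (d eps)] is large enough. *)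
  intros Hd HK He. exists (K / (d * eps) + 1).
  assert (Hp : 0 <= K / (d * eps)) by (apply Rdiv_le_0_compat; nra).
  split; [lra|]. intros x Hx.
  assert (Hx0 : 0 < x) by lra.
  assert (E := exp_ineq1 (d * x)). assert (0 < d * x) by nra.
  specialize (E ltac:(lra)).
  replace (- d * x) with (- (d * x)) by ring. rewrite exp_Ropp.
  assert (Pe := exp_pos (d * x)).
  apply Rmult_lt_reg_r with (exp (d * x)); [easy|].
  rewrite Rmult_assoc, Rinv_l, Rmult_1_r by lra.
  assert (Q : K / (d * eps) * (d * eps) = K) by (field; nra).
  assert (K < eps * (d * x)).
  { rewrite <- Q. apply Rlt_le_trans with (x * (d * eps)); [|right; ring].
    apply Rmult_lt_compat_r; nra. }
  nra.
Qed.

(** * Limits of complex sequences *)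

Definition Clim (u : nat -> C) (l : C) : Prop :=
  forall eps, 0 < eps -> exists N, forall n, (N <= n)%nat -> Cmod (u n - l) < eps.

(** The increments are dominated by the decrease of a null sequence, so the tail after [n] is at
    most [v n]: convergence and its rate come together. The digamma series, the Euler products and
    the sawtooth integrals all converge this way. *)
Lemma Clim_of_telescoping (u : nat -> C) (v : nat -> R) (N0 : nat) : is_lim_seq v 0 ->
  (forall n, (N0 <= n)%nat -> Cmod (u (S n) - u n) <= v n - v (S n)) ->
  exists l, Clim u l /\ forall n, (N0 <= n)%nat -> Cmod (u n - l) <= v n.
Proof.
  intros Hv H.
  assert (T : forall n k, (N0 <= n)%nat -> Cmod (u (n + k)%nat - u n) <= v n - v (n + k)%nat).
  { intros n k Hn. induction k as [|k IH].
    - rewrite Nat.add_0_r. replace (u n - u n)%C with (RtoC 0) by ring. rewrite Cmod_0. lra.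
    - rewrite <- plus_n_Sm.
      replace (u (S (n + k)) - u n)%C with ((u (S (n + k)) - u (n + k)%nat) + (u (n + k)%nat - u n))%C by ring.
      eapply Rle_trans; [apply Cmod_triangle|].
      specialize (H (n + k)%nat ltac:(lia)). lra. }
  assert (T' : forall n m, (N0 <= n <= m)%nat -> Cmod (u m - u n) <= v n).
  { intros n m Hn. assert (L := Hv). apply (is_lim_seq_incr_n v n) in L.
    (* From [N0] on [v] is nonincreasing, by the domination itself, and tends to 0. *)
    assert (0 <= v n).
    { refine (is_lim_seq_le (fun k => v (k + n)%nat) (fun _ => v n) 0 (v n) _ L (is_lim_seq_const _)).
      intros k. rewrite Nat.add_comm. specialize (T n k ltac:(lia)).
      generalize (Cmod_ge_0 (u (n + k)%nat - u n)). lra. }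
    apply (is_lim_seq_incr_n v m) in Hv.
    assert (0 <= v m).
    { refine (is_lim_seq_le (fun k => v (k + m)%nat) (fun _ => v m) 0 (v m) _ Hv (is_lim_seq_const _)).
      intros k. rewrite Nat.add_comm. specialize (T m k ltac:(lia)).
      generalize (Cmod_ge_0 (u (m + k)%nat - u m)). lra. }
    specialize (T n (m - n)%nat ltac:(lia)). replace (n + (m - n))%nat with m in T by lia. lra. }
  assert (HR : forall pr : C -> R, (forall a b, Rabs (pr a - pr b) <= Cmod (a - b)) ->
    ex_finite_lim_seq (fun n => pr (u n))).
  { intros pr Hpr. apply ex_lim_seq_cauchy_corr. intros eps.
    destruct (proj2 (is_lim_seq_spec _ _) Hv (pos_div_2 eps)) as [N HN].
    set (m := Nat.max N N0). specialize (HN m (Nat.le_max_l _ _)). cbn in HN.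
    rewrite Rminus_0_r in HN. apply Rabs_def2 in HN.
    assert (X : forall p, (m <= p)%nat -> Rabs (pr (u p) - pr (u m)) < eps / 2).
    { intros p Hp. eapply Rle_lt_trans; [apply Hpr|]. specialize (T' m p ltac:(lia)). lra. }
    exists m. intros p q Hp Hq. apply X in Hp. apply X in Hq.
    replace (pr (u p) - pr (u q)) with ((pr (u p) - pr (u m)) + - (pr (u q) - pr (u m))) by ring.
    eapply Rle_lt_trans; [apply Rabs_triang|]. rewrite Rabs_Ropp. lra. }
  destruct (HR fst) as [l1 H1]; [intros a b; apply (fst_le_Cmod (a - b)%C)|].
  destruct (HR snd) as [l2 H2]; [intros a b; apply (snd_le_Cmod (a - b)%C)|].
  assert (L : Clim u (l1, l2)).
  { intros eps He. assert (He2 : 0 < eps / 2) by lra.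
    destruct (proj2 (is_lim_seq_spec _ _) H1 (mkposreal _ He2)) as [N1 HN1].
    destruct (proj2 (is_lim_seq_spec _ _) H2 (mkposreal _ He2)) as [N2 HN2].
    exists (Nat.max N1 N2). intros n Hn.
    specialize (HN1 n ltac:(lia)). specialize (HN2 n ltac:(lia)). cbn in HN1, HN2.
    eapply Rle_lt_trans; [apply Cmod_le_Rabs|]. cbn. unfold Rminus in *. lra. }
  exists (l1, l2). split; [easy|]. intros n Hn.
  apply le_epsilon. intros eps He. destruct (L eps He) as [N HN].
  specialize (HN (n + N)%nat ltac:(lia)). specialize (T' n (n + N)%nat ltac:(lia)).
  replace (u n - (l1, l2))%C with (- (u (n + N)%nat - u n) + (u (n + N)%nat - (l1, l2)))%C by ring.
  eapply Rle_trans; [apply Cmod_triangle|]. rewrite Cmod_opp. lra.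
Qed.

Lemma is_lim_seq_exp_decay (K d : R) : 0 < d -> 0 <= K ->
  is_lim_seq (fun n => K * exp (- d * INR n)) 0.
Proof.
  intros Hd HK. apply is_lim_seq_spec. intros eps.
  destruct (exp_decay_small K d eps Hd HK (cond_pos eps)) as [A [HA H]].
  destruct (nfloor_ex A) as [N HN]; [lra|]. exists (S N). intros n Hn.
  rewrite Rminus_0_r, Rabs_pos_eq by (apply Rmult_le_pos; [easy | left; apply exp_pos]).
  apply H. apply le_INR in Hn. rewrite S_INR in Hn. lra.
Qed.

(** The limit is found along the integers; for a real [x] the bound passes through the next integer,
    where the two differences telescope. *)
Lemma Cauchy_at_infty (h : R -> C) (K d : R) : 0 < d -> 0 <= K ->
  (forall x y, 0 <= x <= y -> Cmod (h y - h x) <= K * exp (- d * x) - K * exp (- d * y)) ->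
  exists l : C, forall x, 0 <= x -> Cmod (h x - l) <= K * exp (- d * x).
Proof.
  intros Hd HK H.
  destruct (Clim_of_telescoping (fun n => h (INR n)) (fun n => K * exp (- d * INR n)) 0)
    as [l [_ Hl]].
  - now apply is_lim_seq_exp_decay.
  - intros n _. apply H. rewrite S_INR. generalize (pos_INR n). lra.
  - exists l. intros x Hx. destruct (nfloor_ex x Hx) as [N HN].
    replace (h x - l)%C with (- (h (INR (S N)) - h x) + (h (INR (S N)) - l))%C by ring.
    eapply Rle_trans; [apply Cmod_triangle|]. rewrite Cmod_opp.
    specialize (H x (INR (S N)) ltac:(rewrite S_INR; lra)). specialize (Hl (S N) ltac:(lia)). lra.
Qed.

(** Powers such as [(n + 1)^(- d)] are written as exponentials of logarithms throughout. *)
Lemma is_lim_seq_power_decay (K d : R) : 0 < d -> 0 <= K ->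
  is_lim_seq (fun n => K * exp (- d * ln (INR (S n)))) 0.
Proof.
  intros Hd HK. apply is_lim_seq_spec. intros eps.
  destruct (exp_decay_small K d eps Hd HK (cond_pos eps)) as [A [_ H]].
  destruct (nfloor_ex (exp A)) as [N HN]; [left; apply exp_pos|].
  exists N. intros n Hn.
  rewrite Rminus_0_r, Rabs_pos_eq by (apply Rmult_le_pos; [easy | left; apply exp_pos]).
  apply H. apply le_INR in Hn. rewrite <- (ln_exp A). left.
  apply ln_increasing; [apply exp_pos|]. rewrite S_INR. lra.
Qed.

Lemma Clim_squeeze (u : nat -> C) (l : C) (v : nat -> R) (N0 : nat) : is_lim_seq v 0 ->
  (forall n, (N0 <= n)%nat -> Cmod (u n - l) <= v n) -> Clim u l.
Proof.
  intros Hv H eps He. destruct (proj2 (is_lim_seq_spec _ _) Hv (mkposreal eps He)) as [N HN].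
  exists (Nat.max N N0). intros n Hn. eapply Rle_lt_trans; [apply H; lia|].
  specialize (HN n ltac:(lia)). cbn in HN. rewrite Rminus_0_r in HN.
  apply Rabs_def2 in HN. lra.
Qed.

(** * Existence, size and linearity of integrals with exponential decay *)

Lemma is_line_int_exists (f : R -> C) (M d : R) : contC f -> 0 < d -> 0 <= M ->
  (forall t, Cmod (f t) <= M * exp (- d * Rabs t)) -> exists l, is_line_int f l.
Proof.
  intros Cf Hd HM Hf.
  assert (HK : 0 <= M / d) by (apply Rdiv_le_0_compat; lra).
  destruct (Cauchy_at_infty (fun x => Cint f 0 x) (M / d) d Hd HK) as [l1 H1].
  { intros x y Hxy.
    rewrite <- (Cint_Chasles f 0 x y) by easy.
    replace (Cint f 0 x + Cint f x y - Cint f 0 x)%C with (Cint f x y) by ring.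
    now apply Cint_decay_pos. }
  destruct (Cauchy_at_infty (fun x => Cint f (- x) 0) (M / d) d Hd HK) as [l2 H2].
  { intros x y Hxy.
    rewrite <- (Cint_Chasles f (- y) (- x) 0) by easy.
    replace (Cint f (- y) (- x) + Cint f (- x) 0 - Cint f (- x) 0)%C
      with (Cint f (- y) (- x)) by ring.
    replace (- d * x) with (d * - x) by ring. replace (- d * y) with (d * - y) by ring.
    apply Cint_decay_neg; try easy. lra. }
  exists (l1 + l2)%C. intros eps He.
  destruct (exp_decay_small (M / d) d (eps / 2) Hd) as [A [HA HA2]]; [lra|lra|].
  exists A. split; [easy|]. intros a b Ha Hb.
  rewrite <- (Cint_Chasles f a 0 b) by easy.
  replace (Cint f a 0 + Cint f 0 b - (l1 + l2))%C
    with ((Cint f 0 b - l1) + (Cint f a 0 - l2))%C by ring.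
  eapply Rle_lt_trans; [apply Cmod_triangle|].
  assert (Q1 := H1 b ltac:(lra)). assert (Q2 := H2 (- a) ltac:(lra)).
  rewrite Ropp_involutive in Q2.
  assert (Q3 := HA2 b Hb). assert (Q4 := HA2 (- a) ltac:(lra)). lra.
Qed.

Lemma is_line_int_bound (f : R -> C) (l : C) (M d : R) : contC f -> 0 < d -> 0 <= M ->
  (forall t, Cmod (f t) <= M * exp (- d * Rabs t)) -> is_line_int f l ->
  Cmod l <= 2 * M / d.
Proof.
  intros Cf Hd HM Hf Hl. apply le_epsilon. intros eps He.
  destruct (Hl eps He) as [A [HA H]]. specialize (H (- A) A ltac:(lra) ltac:(lra)).
  rewrite <- (Cint_Chasles f (- A) 0 A) in H by easy.
  assert (H1 := Cint_decay_pos f M d 0 A Cf Hd HM Hf ltac:(lra)).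
  assert (H2 := Cint_decay_neg f M d (- A) 0 Cf Hd HM Hf ltac:(lra)).
  rewrite Rmult_0_r, exp_0, Rmult_1_r in H1, H2.
  assert (X : forall x, 0 <= M / d * exp x).
  { intros x. apply Rmult_le_pos; [apply Rdiv_le_0_compat; lra | left; apply exp_pos]. }
  assert (X1 := X (- d * A)). assert (X2 := X (d * - A)).
  set (I := (Cint f (- A) 0 + Cint f 0 A)%C) in H.
  replace l with (I + - (I - l))%C by ring.
  eapply Rle_trans; [apply Cmod_triangle|]. rewrite Cmod_opp.
  assert (H3 : Cmod I <= M / d + M / d) by (eapply Rle_trans; [apply Cmod_triangle|]; lra).
  unfold Rdiv in *. lra.
Qed.

Lemma Clim_fst (u : nat -> C) (l : C) : Clim u l ->
  is_lim_seq (fun n => fst (u n)) (fst l) /\ is_lim_seq (fun n => snd (u n)) (snd l).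
Proof.
  intros H. split; apply is_lim_seq_spec; intros eps;
    destruct (H eps (cond_pos eps)) as [N HN]; exists N; intros n Hn;
    apply Rle_lt_trans with (2 := HN n Hn).
  - change (Rabs (fst (u n - l)%C) <= Cmod (u n - l)).
    apply fst_le_Cmod.
  - change (Rabs (snd (u n - l)%C) <= Cmod (u n - l)).
    apply snd_le_Cmod.
Qed.

Lemma Clim_seq_unique (u : nat -> C) (l : C) : Clim u l -> Clim_seq u = l.
Proof.
  intros H. destruct (Clim_fst u l H) as [H1 H2]. unfold Clim_seq, Re, Im.
  rewrite (is_lim_seq_unique _ _ H1), (is_lim_seq_unique _ _ H2). now destruct l.
Qed.

(** A total functional, through the intervals [[- n, n]]; for [decaying] integrands it is the
    improper integral, by [line_int_correct]. *)
Definition line_int (f : R -> C) : C := Clim_seq (fun n => Cint f (- INR n) (INR n)).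

Lemma line_int_unique (f : R -> C) (l : C) : is_line_int f l -> line_int f = l.
Proof.
  intros H. apply Clim_seq_unique. intros eps He.
  destruct (H eps He) as [A [HA HA2]]. destruct (nfloor_ex A) as [N HN]; [lra|].
  exists (S N). intros n Hn. apply le_INR in Hn. rewrite S_INR in Hn.
  apply HA2; lra.
Qed.

(** The class of all integrands: 1 / sin provides the decay, and by [decaying_mult] it survives
    multiplication by the [poly_bounded] factors, such as the approximations of phi and zeta on the
    line. *)
Definition decaying (f : R -> C) : Prop :=
  contC f /\ exists M d, 0 <= M /\ 0 < d /\
    forall t, Cmod (f t) <= M * exp (- d * Rabs t).

Definition poly_bounded (p : R -> C) : Prop :=
  contC p /\ exists A n, forall t, Cmod (p t) <= A * (1 + Rabs t) ^ n.

Lemma line_int_correct (f : R -> C) : decaying f -> is_line_int f (line_int f).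
Proof.
  intros [Cf [M [d [HM [Hd H]]]]].
  destruct (is_line_int_exists f M d Cf Hd HM H) as [l Hl]. now rewrite (line_int_unique f l Hl).
Qed.

Lemma line_int_ext (f g : R -> C) : (forall t, f t = g t) -> line_int f = line_int g.
Proof.
  intros H. unfold line_int, Clim_seq. do 2 f_equal; apply Lim_seq_ext; intros n;
  now rewrite (Cint_ext f g).
Qed.

Lemma line_int_plus (f g : R -> C) : decaying f -> decaying g ->
  line_int (fun t => f t + g t)%C = (line_int f + line_int g)%C.
Proof.
  intros Df Dg. apply line_int_unique, is_line_int_plus; try apply line_int_correct; try easy; [apply Df | apply Dg].
Qed.

Lemma line_int_scal (k : C) (f : R -> C) : decaying f -> line_int (fun t => k * f t)%C = (k * line_int f)%C.
Proof.
  intros Df. apply line_int_unique, is_line_int_scal; [apply Df | now apply line_int_correct].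
Qed.

Lemma line_int_bound (f : R -> C) (M d : R) : contC f -> 0 < d -> 0 <= M ->
  (forall t, Cmod (f t) <= M * exp (- d * Rabs t)) -> Cmod (line_int f) <= 2 * M / d.
Proof.
  intros Cf Hd HM H. apply (is_line_int_bound f (line_int f) M d Cf Hd HM H), line_int_correct.
  split; [easy|]. now exists M, d.
Qed.

Lemma decaying_ext (f g : R -> C) : (forall t, f t = g t) -> decaying f -> decaying g.
Proof.
  intros H [Cf [M [d [HM [Hd Hf]]]]]. split.
  - intros t. apply ccont_ext with (2 := Cf t). easy.
  - exists M, d. repeat split; try easy. intros t. now rewrite <- H.
Qed.

Lemma decaying_plus (f g : R -> C) : decaying f -> decaying g -> decaying (fun t => f t + g t)%C.
Proof.
  intros [Cf [M [d [HM [Hd Hf]]]]] [Cg [N [e [HN [He Hg]]]]].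
  split; [now apply contC_plus|]. exists (M + N), (Rmin d e).
  split; [lra|]. split; [now apply Rmin_pos|]. intros t.
  eapply Rle_trans; [apply Cmod_triangle|]. rewrite Rmult_plus_distr_r.
  assert (P := Rabs_pos t).
  apply Rplus_le_compat.
  - apply Rle_trans with (1 := Hf t), Rmult_le_compat_l; [easy|].
    apply exp_le. generalize (Rmin_l d e); nra.
  - apply Rle_trans with (1 := Hg t), Rmult_le_compat_l; [easy|].
    apply exp_le. generalize (Rmin_r d e); nra.
Qed.

(** Each factor [1 + x] is at most [(1 + 2 / d) exp (d x / 2)]; the remaining half of the rate is
    left to the other factors. *)
Lemma pow_le_exp (n : nat) (d : R) : 0 < d ->
  exists K, 0 <= K /\ forall x, 0 <= x -> (1 + x) ^ n <= K * exp (d * x).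
Proof.
  intros Hd. revert d Hd. induction n as [|n IH]; intros d Hd.
  - exists 1. split; [lra|]. intros x Hx. cbn.
    rewrite Rmult_1_l. rewrite <- exp_0. apply exp_le. nra.
  - destruct (IH (d / 2)) as [K [HK H]]; [lra|].
    exists ((1 + 2 / d) * K). assert (0 < 2 / d) by (apply Rdiv_lt_0_compat; lra).
    split; [nra|]. intros x Hx. cbn.
    assert (E : 1 + x <= (1 + 2 / d) * exp (d / 2 * x)).
    { assert (F : 1 + d / 2 * x <= exp (d / 2 * x)).
      { destruct (Req_dec x 0) as [->|N]; [rewrite Rmult_0_r, exp_0; lra|].
        left. apply exp_ineq1. nra. }
      assert (x = 2 / d * (d / 2 * x)) by (field; lra). nra. }
    replace (d * x) with (d / 2 * x + d / 2 * x) by field. rewrite exp_plus.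
    replace ((1 + 2 / d) * K * (exp (d / 2 * x) * exp (d / 2 * x)))
      with (((1 + 2 / d) * exp (d / 2 * x)) * (K * exp (d / 2 * x))) by ring.
    apply Rmult_le_compat; try easy; [lra | apply pow_le; lra | now apply H].
Qed.

Lemma decaying_mult (f p : R -> C) : decaying f -> poly_bounded p -> decaying (fun t => f t * p t)%C.
Proof.
  intros [Cf [M [d [HM [Hd Hf]]]]] [Cp [A [n Hp]]].
  split; [now apply contC_mult|].
  destruct (pow_le_exp n (d / 2)) as [K [HK H]]; [lra|].
  exists (M * (Rabs A * K)), (d / 2). split; [|split; [lra|]].
  { apply Rmult_le_pos; [easy|]. apply Rmult_le_pos; [apply Rabs_pos | easy]. }
  intros t. rewrite Cmod_mult. specialize (Hf t). specialize (Hp t).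
  specialize (H (Rabs t) (Rabs_pos t)).
  replace (M * (Rabs A * K) * exp (- (d / 2) * Rabs t)) with
    ((M * exp (- d * Rabs t)) * (Rabs A * (K * exp (d / 2 * Rabs t)))).
  2:{ replace (- (d / 2) * Rabs t) with (- d * Rabs t + d / 2 * Rabs t) by field.
      rewrite exp_plus. ring. }
  apply Rmult_le_compat; try easy; try apply Cmod_ge_0.
  eapply Rle_trans; [exact Hp|].
  assert (P : 0 <= (1 + Rabs t) ^ n) by (apply pow_le; generalize (Rabs_pos t); lra).
  apply Rle_trans with (Rabs A * (1 + Rabs t) ^ n).
  - apply Rmult_le_compat_r; [easy | apply Rle_abs].
  - apply Rmult_le_compat_l; [apply Rabs_pos | easy].
Qed.

Lemma poly_bounded_const (a : C) : poly_bounded (fun _ => a).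
Proof.
  split; [apply contC_const|]. exists (Cmod a), O. intros t. cbn. lra.
Qed.

Lemma decaying_scal (k : C) (f : R -> C) : decaying f -> decaying (fun t => k * f t)%C.
Proof.
  intros D. apply decaying_ext with (fun t => f t * k)%C; [intros; ring|].
  apply decaying_mult; [easy | apply poly_bounded_const].
Qed.

Lemma poly_bounded_ext (f g : R -> C) : (forall t, f t = g t) -> poly_bounded f -> poly_bounded g.
Proof.
  intros H [Cf [A [n Hf]]]. split.
  - intros t. apply ccont_ext with (2 := Cf t). easy.
  - exists A, n. intros t. now rewrite <- H.
Qed.

Lemma poly_bounded_mult (f g : R -> C) : poly_bounded f -> poly_bounded g -> poly_bounded (fun t => f t * g t)%C.
Proof.
  intros [Cf [A [n Hf]]] [Cg [B [m Hg]]]. split; [now apply contC_mult|].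
  exists (A * B), (n + m)%nat. intros t. rewrite Cmod_mult, pow_add.
  replace (A * B * ((1 + Rabs t) ^ n * (1 + Rabs t) ^ m))
    with ((A * (1 + Rabs t) ^ n) * (B * (1 + Rabs t) ^ m)) by ring.
  apply Rmult_le_compat; try easy; apply Cmod_ge_0.
Qed.

Lemma poly_bounded_plus (f g : R -> C) : poly_bounded f -> poly_bounded g -> poly_bounded (fun t => f t + g t)%C.
Proof.
  intros [Cf [A [n Hf]]] [Cg [B [m Hg]]]. split; [now apply contC_plus|].
  exists (Rabs A + Rabs B), (n + m)%nat. intros t.
  eapply Rle_trans; [apply Cmod_triangle|]. rewrite Rmult_plus_distr_r.
  assert (P := Rabs_pos t).
  assert (X : forall (D : R) (k l : nat), D * (1 + Rabs t) ^ k <= Rabs D * (1 + Rabs t) ^ (k + l)).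
  { intros D k l.
    assert (0 <= (1 + Rabs t) ^ k) by (apply pow_le; lra).
    assert (1 <= (1 + Rabs t) ^ l) by (apply pow_R1_Rle; lra).
    rewrite pow_add. generalize (Rle_abs D) (Rabs_pos D). intros.
    apply Rle_trans with (Rabs D * (1 + Rabs t) ^ k); [now apply Rmult_le_compat_r|].
    apply Rmult_le_compat_l; [easy|]. nra. }
  apply Rplus_le_compat.
  - eapply Rle_trans; [apply Hf | apply X].
  - eapply Rle_trans; [apply Hg |]. rewrite Nat.add_comm. apply X.
Qed.

(** * The kernel 1 / sin (pi s) *)

Lemma Ci_mult (z : C) : (Ci * z)%C = (- Im z, Re z).
Proof. apply C_ext; cbn; unfold Re, Im; ring. Qed.

Lemma Csin_pair (x y : R) : Csin (x, y) = (sin x * cosh y, cos x * sinh y).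
Proof.
  unfold Csin. rewrite Ci_mult. cbn [Re Im fst snd].
  unfold Cexp, Copp; cbn [Re Im fst snd]. unfold cosh, sinh.
  rewrite Ropp_involutive, cos_neg, sin_neg.
  apply C_ext; cbn; field.
Qed.

Lemma cosh_sqr (y : R) : cosh y * cosh y = 1 + sinh y * sinh y.
Proof.
  unfold cosh, sinh. assert (E : exp y * exp (- y) = 1) by
    (rewrite <- exp_plus, Rplus_opp_r; apply exp_0). nra.
Qed.

Lemma Csin_sqr (x y : R) :
  Cmod (Csin (x, y)) * Cmod (Csin (x, y)) = sin x * sin x + sinh y * sinh y.
Proof.
  rewrite Cmod_sqr, Csin_pair. unfold Re, Im; cbn [fst snd].
  assert (H := cosh_sqr y). assert (Q := sin2_cos2 x). unfold Rsqr in Q.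
  replace (sin x * cosh y * (sin x * cosh y) + cos x * sinh y * (cos x * sinh y))
    with (sin x * sin x * (cosh y * cosh y) + cos x * cos x * (sinh y * sinh y)) by ring.
  rewrite H. replace (cos x * cos x) with (1 - sin x * sin x) by lra. ring.
Qed.

(** Uniform in the abscissa, hence usable in a strip that contains zeros of the sine. *)
Lemma sinh_le_Cmod_Csin (x y : R) : Rabs (sinh y) <= Cmod (Csin (x, y)).
Proof.
  assert (H := Csin_sqr x y). assert (P := Cmod_ge_0 (Csin (x, y))).
  apply Rabs_le. nra.
Qed.

Lemma cosh_lower (y : R) : exp (Rabs y) <= 2 * cosh y.
Proof.
  unfold cosh. generalize (exp_pos y) (exp_pos (- y)).
  unfold Rabs. destruct (Rcase_abs y); lra.
Qed.

Lemma sinh_lower (y : R) : 1 <= Rabs y -> exp (Rabs y) <= 4 * Rabs (sinh y).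
Proof.
  intros Hy.
  assert (X : forall y, 1 <= y -> exp y <= 4 * sinh y).
  { clear. intros y Hy. unfold sinh. rewrite exp_Ropp.
    assert (2 <= exp y).
    { generalize (exp_ineq1 y ltac:(lra)). lra. }
    assert (/ exp y <= / 2) by (apply Rinv_le_contravar; lra). lra. }
  unfold Rabs at 1. destruct (Rcase_abs y) as [L|G].
  - rewrite Rabs_left in Hy by easy.
    replace (sinh y) with (- sinh (- y)) by (unfold sinh; rewrite Ropp_involutive; field).
    rewrite Rabs_Ropp. eapply Rle_trans; [apply X; lra|].
    generalize (Rle_abs (sinh (- y))). lra.
  - rewrite Rabs_pos_eq in Hy by lra. eapply Rle_trans; [apply X; lra|].
    generalize (Rle_abs (sinh y)). lra.
Qed.

Lemma PI_mult_pair (x t : R) : (RtoC PI * (x, t))%C = (PI * x, PI * t).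
Proof. apply C_ext; cbn; ring. Qed.

(** The real part [sin (PI c) cosh (PI t)] is already large enough; the bound degenerates as [c]
    approaches 0 or 1. *)
Lemma Csin_PI_lower (c t : R) : 0 < c < 1 ->
  sin (PI * c) / 2 * exp (PI * Rabs t) <= Cmod (Csin (PI * (c, t))).
Proof.
  intros Hc. rewrite PI_mult_pair.
  assert (P := PI_RGT_0). assert (S := sin_gt_0 (PI * c) ltac:(nra) ltac:(nra)).
  assert (H := cosh_lower (PI * t)). rewrite Rabs_mult, (Rabs_pos_eq PI) in H by lra.
  apply Rle_trans with (Rabs (Re (Csin (PI * c, PI * t)))); [|apply re_le_Cmod].
  rewrite Csin_pair. cbn [Re fst]. eapply Rle_trans; [|apply Rle_abs]. nra.
Qed.

Lemma Csin_PI_neq_0 (c t : R) : -1 < c < 1 -> (c, t) <> RtoC 0 ->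
  Csin (PI * (c, t)) <> RtoC 0.
Proof.
  intros Hc Hn H. rewrite PI_mult_pair in H.
  assert (E := Csin_sqr (PI * c) (PI * t)). rewrite H, Cmod_0 in E.
  assert (P := PI_RGT_0).
  assert (S1 : sin (PI * c) = 0) by nra. assert (S2 : sinh (PI * t) = 0) by nra.
  apply Hn. apply C_ext; cbn.
  - destruct (Rtotal_order c 0) as [L|[E0|G]]; [|easy|].
    + assert (sin (- (PI * c)) > 0) by (apply sin_gt_0; nra). rewrite sin_neg in H0. lra.
    + assert (sin (PI * c) > 0) by (apply sin_gt_0; nra). lra.
  - unfold sinh in S2. assert (E1 : exp (PI * t) = exp (- (PI * t))) by lra.
    apply exp_inv in E1. nra.
Qed.

Lemma exp_Cmod_line (w : C) (c t : R) :
  Cmod (Cexp (- w * (c, t))) = exp (- Re w * c + Im w * t).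
Proof. rewrite Cmod_Cexp. f_equal. cbn. unfold Re, Im. ring. Qed.

(** With [x = Cexp w] this is [x^(-s) / sin (PI s)] at [s = c + i t]. Taking the logarithm [w] as
    parameter avoids any choice of branch. *)
Definition kern (c : R) (w : C) (t : R) : C :=
  (Cexp (- w * (c, t)) / Csin (PI * (c, t)))%C.

Lemma ccont_line (c t : R) : ccont (fun y : R => (c, y) : C) t.
Proof. apply ccont_pair; [apply continuous_const | apply continuous_id]. Qed.

Lemma contC_kern (c : R) (w : C) : 0 < c < 1 -> contC (kern c w).
Proof.
  intros Hc t. apply ccont_div.
  - apply ccont_Cexp, ccont_mult; [apply ccont_const | apply ccont_line].
  - apply ccont_Csin, ccont_mult; [apply ccont_const | apply ccont_line].
  - apply Csin_PI_neq_0; [lra|]. intros H. apply (f_equal fst) in H. cbn in H. lra.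
Qed.

Lemma Rmult_le_Rabs (a b : R) : a * b <= Rabs a * Rabs b.
Proof. rewrite <- Rabs_mult. apply Rle_abs. Qed.

(** Here [|arg z| < PI] is used: the power grows at most like [exp (|Im w| |t|)], against the decay
    [exp (- PI |t|)] of 1 / sin. *)
Lemma decaying_kern (c : R) (w : C) : 0 < c < 1 -> - PI < Im w < PI -> decaying (kern c w).
Proof.
  intros Hc Hw. split; [now apply contC_kern|].
  assert (P := PI_RGT_0). assert (S := sin_gt_0 (PI * c) ltac:(nra) ltac:(nra)).
  assert (Ha : Rabs (Im w) < PI) by (apply Rabs_def1; lra).
  exists (2 / sin (PI * c) * exp (- Re w * c)), (PI - Rabs (Im w)).
  split; [|split; [lra|]].
  { apply Rmult_le_pos; [apply Rdiv_le_0_compat; lra | left; apply exp_pos]. }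
  intros t. unfold kern. assert (L := Csin_PI_lower c t Hc).
  assert (L0 : 0 < sin (PI * c) / 2 * exp (PI * Rabs t)).
  { apply Rmult_lt_0_compat; [lra | apply exp_pos]. }
  rewrite Cmod_div by (apply Cmod_gt_0; lra).
  rewrite exp_Cmod_line, exp_plus.
  apply Rle_trans with (exp (- Re w * c) * exp (Rabs (Im w) * Rabs t) *
    / (sin (PI * c) / 2 * exp (PI * Rabs t))).
  - apply Rmult_le_compat.
    + apply Rmult_le_pos; left; apply exp_pos.
    + left. apply Rinv_0_lt_compat. lra.
    + apply Rmult_le_compat_l; [left; apply exp_pos|]. apply exp_le, Rmult_le_Rabs.
    + now apply Rinv_le_contravar.
  - right. replace (- (PI - Rabs (Im w)) * Rabs t) with (Rabs (Im w) * Rabs t + - (PI * Rabs t)) by ring.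
    rewrite exp_plus, exp_Ropp. field. generalize (exp_pos (PI * Rabs t)). lra.
Qed.

Lemma atan_lim_p_infty : forall eps, 0 < eps -> exists A, 0 < A /\
  forall x, A <= x -> PI / 2 - atan x < eps.
Proof.
  intros eps He. set (e := Rmin (eps / 2) (PI / 4)).
  assert (P := PI_RGT_0).
  assert (He0 : 0 < e) by (apply Rmin_pos; lra).
  assert (He1 := Rmin_l (eps / 2) (PI / 4)). assert (He2 := Rmin_r (eps / 2) (PI / 4)).
  fold e in He1, He2.
  exists (tan (PI / 2 - e)). split; [apply tan_gt_0; lra|].
  intros x Hx. apply Rle_lt_trans with (PI / 2 - atan (tan (PI / 2 - e))).
  - destruct Hx as [Hx|Hx]; [generalize (atan_increasing _ _ Hx); lra | rewrite Hx; lra].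
  - rewrite atan_tan by lra. lra.
Qed.

Lemma kern_0_pair (c t : R) : 0 < c < 1 ->
  kern c 0 t =
  (sin (PI * c) * cosh (PI * t) / (sin (PI * c) * sin (PI * c) + sinh (PI * t) * sinh (PI * t)),
   - (cos (PI * c) * sinh (PI * t)) / (sin (PI * c) * sin (PI * c) + sinh (PI * t) * sinh (PI * t))).
Proof.
  intros Hc. unfold kern. rewrite PI_mult_pair.
  rewrite <- Csin_sqr, Cmod_sqr, Csin_pair.
  replace (- 0 * (c, t))%C with (RtoC 0) by ring. rewrite Cexp_0.
  unfold Cdiv, Cinv; cbn. apply C_ext; cbn; unfold Rdiv; rewrite !Rmult_1_r; ring.
Qed.

Lemma RInt_odd (g : R -> R) (n : R) : (forall t, continuous g t) ->
  (forall t, g (- t) = - g t) -> RInt g (- n) n = 0.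
Proof.
  intros Hc Ho.
  assert (E : RInt (fun y => scal (-1) (g (-1 * y + 0))) (- n) n = RInt g (-1 * - n + 0) (-1 * n + 0)).
  { apply (RInt_comp_lin (V := R_CompleteNormedModule)). now apply ex_RInt_contR. }
  replace (-1 * - n + 0) with n in E by ring. replace (-1 * n + 0) with (- n) in E by ring.
  rewrite (RInt_ext _ g) in E.
  - assert (S := opp_RInt_swap g n (- n) ltac:(now apply ex_RInt_contR)).
    change (- RInt g n (- n) = RInt g (- n) n) in S. lra.
  - intros x _. change (-1 * g (-1 * x + 0) = g x).
    replace (-1 * x + 0) with (- x) by ring. rewrite Ho. ring.
Qed.

(** The real part has the primitive [atan (sinh (PI t) / sin (PI c)) / PI], of total variation 1,
    and the imaginary part is odd. This value at [w = 0] normalizes the general one. *)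
Lemma line_int_kern_0 (c : R) : 0 < c < 1 -> line_int (kern c 0) = 1%C.
Proof.
  intros Hc. apply Clim_seq_unique.
  assert (P := PI_RGT_0). assert (S := sin_gt_0 (PI * c) ltac:(nra) ltac:(nra)).
  set (s := sin (PI * c)) in *.
  assert (E : forall n, Cint (kern c 0) (- INR n) (INR n) =
     RtoC (2 / PI * atan (sinh (PI * INR n) / s))).
  { intros n. apply C_ext.
    - change (RInt (fun t => fst (kern c 0 t)) (- INR n) (INR n) = 2 / PI * atan (sinh (PI * INR n) / s)).
      assert (I : is_RInt (fun t => fst (kern c 0 t)) (- INR n) (INR n)
        (minus (/ PI * atan (sinh (PI * INR n) / s)) (/ PI * atan (sinh (PI * - INR n) / s)))).
      { apply (is_RInt_derive (V := R_CompleteNormedModule) (fun t => / PI * atan (sinh (PI * t) / s))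
          (fun t => fst (kern c 0 t))).
        - intros t _. rewrite kern_0_pair by easy. fold s. cbn [fst].
          unfold sinh, cosh. auto_derive; [lra|].
          set (a := exp (PI * t)). set (b := exp (- (PI * t))).
          assert (0 <= (a + - b) * (a + - b)) by apply Rle_0_sqr.
          field. repeat split; try lra; try nra.
        - intros t _. apply (contC_kern c 0 Hc t). }
      apply (is_RInt_unique (V := R_CompleteNormedModule)) in I. rewrite I.
      change (/ PI * atan (sinh (PI * INR n) / s) - / PI * atan (sinh (PI * - INR n) / s) =
        2 / PI * atan (sinh (PI * INR n) / s)).
      replace (sinh (PI * - INR n) / s) with (- (sinh (PI * INR n) / s)).
      + rewrite atan_opp. field. lra.
      + replace (PI * - INR n) with (- (PI * INR n)) by ring.
        unfold sinh. rewrite Ropp_involutive. field. lra.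
    - change (RInt (fun t => snd (kern c 0 t)) (- INR n) (INR n) = 0).
      apply RInt_odd.
      + intros t. apply (contC_kern c 0 Hc t).
      + intros t. rewrite !kern_0_pair by easy. cbn [snd].
        replace (PI * - t) with (- (PI * t)) by ring.
        replace (sinh (- (PI * t))) with (- sinh (PI * t)) by
          (unfold sinh; rewrite Ropp_involutive; field).
        fold s. assert (0 < s * s + sinh (PI * t) * sinh (PI * t)) by nra.
        field. lra. }
  intros eps He.
  destruct (atan_lim_p_infty eps He) as [A [HA H]].
  destruct (nfloor_ex (A * s)) as [N HN]; [nra|].
  exists (Datatypes.S N). intros n Hn. rewrite E.
  apply le_INR in Hn. rewrite S_INR in Hn.
  assert (P2 : 3 < PI) by (generalize PI2_3_2; unfold PI; lra).
  (* With [q = PI n], [sinh q > q / 2] and [PI > 3] make [sinh q] exceed [n], hence [A s]. *)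
  assert (Hs : A <= sinh (PI * INR n) / s).
  { apply Rmult_le_reg_r with s; [easy|]. unfold Rdiv. rewrite Rmult_assoc, Rinv_l, Rmult_1_r by lra.
    assert (Hn0 := pos_INR N). assert (Hq : 0 < PI * INR n) by nra.
    assert (X := exp_ineq1 (PI * INR n) ltac:(lra)).
    assert (Y : exp (- (PI * INR n)) <= 1).
    { rewrite <- exp_0. apply exp_le. nra. }
    unfold sinh. nra. }
  specialize (H _ Hs). rewrite <- RtoC_minus, Cmod_R.
  assert (B := atan_bound (sinh (PI * INR n) / s)).
  replace (2 / PI * atan (sinh (PI * INR n) / s) - 1)
    with (- (2 / PI * (PI / 2 - atan (sinh (PI * INR n) / s)))) by (field; lra).
  rewrite Rabs_Ropp, Rabs_mult, (Rabs_pos_eq (PI / 2 - _)) by lra.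
  rewrite Rabs_pos_eq by (apply Rdiv_le_0_compat; lra).
  assert (2 / PI < 1) by (apply Rmult_lt_reg_r with PI; [lra|]; unfold Rdiv; rewrite Rmult_assoc, Rinv_l; lra).
  assert (0 < 2 / PI) by (apply Rdiv_lt_0_compat; lra). nra.
Qed.

(** * Shifting the line of integration *)

Lemma continuous_line (c t : R) : continuous (fun y : R => (c, y) : C_UniformSpace) t.
Proof.
  intros P [eps H]. exists eps. intros y Hy. apply H. split; [apply ball_center | exact Hy].
Qed.

Lemma ccont_on_line (f : C -> C) (c t : R) :
  ccont f ((c, t) : C_UniformSpace) -> ccont (fun y : R => f (c, y)) t.
Proof.
  intros [H1 H2]; split.
  - apply (continuous_comp (fun y : R => (c, y) : C_UniformSpace) (fun z => fst (f z)));
      [apply continuous_line | exact H1].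
  - apply (continuous_comp (fun y : R => (c, y) : C_UniformSpace) (fun z => snd (f z)));
      [apply continuous_line | exact H2].
Qed.

Lemma ccont_2d (f : C -> C) (x t : R) : ccont f ((x, t) : C_UniformSpace) ->
  continuity_2d_pt (fun u v => fst (f (u, v))) x t /\
  continuity_2d_pt (fun u v => snd (f (u, v))) x t.
Proof.
  intros [H1 H2]; split; apply continuity_2d_pt_filterlim.
  - apply filterlim_ext with (2 := H1). now intros [u v].
  - apply filterlim_ext with (2 := H2). now intros [u v].
Qed.

Lemma RInt_param_derive (u U : R -> R -> R) (x T a b : R) : a < x < b -> 0 < T ->
  (forall y t, a < y < b -> is_derive (fun z => u z t) y (U y t)) ->
  (forall t, continuity_2d_pt U x t) ->
  (forall y t, a < y < b -> continuous (u y) t) ->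
  is_derive (fun y => RInt (u y) (- T) T) x (RInt (U x) (- T) T).
Proof.
  intros Hx HT Hd Hc Hu.
  assert (Hloc : locally x (fun y => a < y < b)).
  { apply (open_and (fun y => a < y) (fun y => y < b));
      [apply open_gt | apply open_lt | exact Hx]. }
  replace (RInt (U x) (- T) T) with
    (RInt (fun t => Derive (fun z => u z t) x) (- T) T).
  2:{ apply RInt_ext. intros t _. now apply is_derive_unique, Hd. }
  apply is_derive_RInt_param.
  - generalize Hloc. apply filter_imp. intros y Hy t _. eexists. now apply Hd.
  - intros t _. apply continuity_2d_pt_ext_loc with (2 := Hc t).
    destruct Hloc as [e He]. exists e. intros y v Hy _. symmetry.
    apply is_derive_unique, Hd, He. exact Hy.
  - generalize Hloc. apply filter_imp. intros y Hy. apply ex_RInt_contR.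
    intros t. now apply Hu.
Qed.

(** Covers the abscissae at which the derivative in [x] is not at hand: the ends of the strip and
    the line through a removable singularity. *)
Lemma RInt_param_continuous (u : R -> R -> R) (x T a b : R) : a < x < b -> 0 < T ->
  (forall y t, a < y < b -> continuity_2d_pt u y t) ->
  (forall y t, a < y < b -> continuous (u y) t) ->
  continuity_pt (fun y => RInt (u y) (- T) T) x.
Proof.
  intros Hx HT Hc Hu eps He.
  set (r := Rmin (x - a) (b - x) / 2).
  assert (Hr : 0 < r).
  { unfold r. assert (0 < Rmin (x - a) (b - x)) by (apply Rmin_pos; lra). lra. }
  assert (Hr1 := Rmin_l (x - a) (b - x)). assert (Hr2 := Rmin_r (x - a) (b - x)).
  assert (He2 : 0 < eps / (4 * T)) by (apply Rdiv_lt_0_compat; lra).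
  destruct (uniform_continuity_2d u (x - r) (x + r) (- T) T) with (eps := mkposreal _ He2)
    as [d Hd].
  { intros y t Hy _. apply Hc. unfold r in *. lra. }
  exists (Rmin d r). split; [apply Rmin_pos; [apply cond_pos | easy]|].
  intros y [_ Hy]. change (Rabs (y - x) < Rmin d r) in Hy.
  assert (Hy1 : Rabs (y - x) < d) by (apply Rlt_le_trans with (1 := Hy), Rmin_l).
  assert (Hy2 : Rabs (y - x) < r) by (apply Rlt_le_trans with (1 := Hy), Rmin_r).
  apply Rabs_def2 in Hy2.
  assert (Hyab : a < y < b) by (unfold r in *; lra).
  change (Rabs (RInt (u y) (- T) T - RInt (u x) (- T) T) < eps).
  assert (E : RInt (u y) (- T) T - RInt (u x) (- T) T = RInt (fun t => u y t - u x t) (- T) T).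
  { symmetry. apply (RInt_minus (V := R_CompleteNormedModule) (u y) (u x));
      apply ex_RInt_contR; intros t; now apply Hu. }
  rewrite E.
  apply Rle_lt_trans with ((T - - T) * (eps / (4 * T))).
  - apply abs_RInt_le_const; [lra| |].
    + apply (ex_RInt_minus (V := R_NormedModule) (u y) (u x));
        apply ex_RInt_contR; intros t; now apply Hu.
    + intros t Ht. left. apply (Hd x t y t); try lra.
      rewrite Rminus_diag, Rabs_R0. apply cond_pos.
  - replace ((T - - T) * (eps / (4 * T))) with (eps / 2) by (field; lra). lra.
Qed.

(** The line of integration moves from [a] to [b]. The function [f'] is the complex derivative,
    given by its effect in the horizontal and vertical directions; on the line of abscissa [e] only
    continuity of [f] is asked, which leaves room for a removable singularity. The margin [eta]
    gives joint continuity around the two end lines. *)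
Section Strip.
Variables (f f' : C -> C) (a b e eta M d : R).
Hypothesis (Heta : 0 < eta) (Hae : a < e) (Heb : e < b) (Hd : 0 < d) (HM : 0 <= M).
Hypothesis Hf : forall x t, a - eta < x < b + eta -> ccont f ((x, t) : C_UniformSpace).
Hypothesis Hf' : forall x t, a < x < b -> x <> e -> ccont f' ((x, t) : C_UniformSpace).
Hypothesis Hh : forall x t, a < x < b -> x <> e ->
  derive_RC (fun y => f (y, t)) x (f' (x, t)).
Hypothesis Hv : forall x t, a < x < b -> x <> e ->
  derive_RC (fun y => f (x, y)) t (Ci * f' (x, t))%C.
Hypothesis Hdecay : forall x t, a <= x <= b -> 1 <= Rabs t ->
  Cmod (f (x, t)) <= M * exp (- d * Rabs t).

(** The vertical derivative of [f] is [i f'], so the integral of [f'] reduces to the values of [f]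
    at the two ends, which decay. *)
Lemma strip_side_integral (T x : R) : 1 <= T -> a < x < b -> x <> e ->
  Cmod (Cint (fun t => f' (x, t)) (- T) T) <= 2 * M * exp (- d * T).
Proof.
  intros HT Hx Hn.
  assert (Cf : contC (fun t => f' (x, t))) by (intros t; now apply ccont_on_line, Hf').
  assert (E : Cint (fun t => (Ci * f' (x, t)))%C (- T) T = (f (x, T) - f (x, (- T)%R))%C).
  { apply (Cint_unique (fun t => (Ci * f' (x, t)))%C (fun t => f (x, t))); [lra| |].
    - apply contC_mult; [apply contC_const | easy].
    - intros t _. now apply Hv. }
  rewrite Cint_scal in E by (easy || lra).
  rewrite <- (Rmult_1_l (Cmod _)), <- Cmod_Ci, <- Cmod_mult, E.
  assert (A : Rabs T = T) by (apply Rabs_pos_eq; lra).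
  assert (H1 := Hdecay x T ltac:(lra) ltac:(lra)).
  assert (H2 := Hdecay x (- T) ltac:(lra) ltac:(rewrite Rabs_Ropp; lra)).
  rewrite Rabs_Ropp in H2. rewrite A in H1, H2.
  unfold Cminus. eapply Rle_trans; [apply Cmod_triangle|]. rewrite Cmod_opp. lra.
Qed.

(** As the abscissa varies, the integral of [f] over [[- T, T]] changes at the rate given by the
    integral of [f']. The mean value theorem is applied to each component, whence [4 = 2 + 2]. *)
Lemma strip_half (T p q : R) : 1 <= T -> a <= p -> p < q -> q <= b -> (q <= e \/ e <= p) ->
  Cmod (Cint (fun t => f (q, t)) (- T) T - Cint (fun t => f (p, t)) (- T) T)
    <= 4 * M * exp (- d * T) * (q - p).
Proof.
  intros HT Hp Hpq Hq Hside.
  assert (Hne : forall x, p < x < q -> x <> e) by (intros; lra).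
  assert (B : forall x, p < x < q -> Cmod (Cint (fun t => f' (x, t)) (- T) T) <= 2 * M * exp (- d * T)).
  { intros x Hx. apply strip_side_integral; [easy | lra | now apply Hne]. }
  assert (X : forall (pr : C -> R) (u := fun x t => pr (f (x, t))) (U := fun x t => pr (f' (x, t))),
    (forall x t, a - eta < x < b + eta -> continuity_2d_pt u x t) ->
    (forall x t, a < x < b -> x <> e -> continuity_2d_pt U x t) ->
    (forall x t, a - eta < x < b + eta -> continuous (u x) t) ->
    (forall x t, a < x < b -> x <> e -> is_derive (fun z => u z t) x (U x t)) ->
    (forall x, p < x < q -> Rabs (RInt (U x) (- T) T) <= 2 * M * exp (- d * T)) ->
    Rabs (RInt (u q) (- T) T - RInt (u p) (- T) T) <= 2 * M * exp (- d * T) * (q - p)).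
  { intros pr u U H1 H2 H3 H4 H5.
    (* Endpoint values of the derivative are irrelevant for the mean value theorem. *)
    set (D := fun x => if Rlt_dec p x then if Rlt_dec x q then RInt (U x) (- T) T else 0 else 0).
    destruct (MVT_gen (fun x => RInt (u x) (- T) T) p q D) as [x [Hx E]].
    - intros x Hx. rewrite Rmin_left, Rmax_right in Hx by lra.
      unfold D. destruct (Rlt_dec p x); [|lra]. destruct (Rlt_dec x q); [|lra].
      apply (RInt_param_derive u U x T p q Hx); [lra| | |].
      + intros y t Hy. apply H4; [lra | now apply Hne].
      + intros t. apply H2; [lra | now apply Hne].
      + intros y t Hy. apply H3. lra.
    - intros x Hx. rewrite Rmin_left, Rmax_right in Hx by lra.
      apply (RInt_param_continuous u x T (a - eta) (b + eta)); try easy; lra.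
    - rewrite E, Rabs_mult, (Rabs_pos_eq (q - p)) by lra.
      apply Rmult_le_compat_r; [lra|].
      assert (Z : Rabs 0 <= 2 * M * exp (- d * T)).
      { rewrite Rabs_R0. apply Rmult_le_pos; [lra | left; apply exp_pos]. }
      unfold D. destruct (Rlt_dec p x); [|easy]. destruct (Rlt_dec x q); [|easy].
      now apply H5. }
  eapply Rle_trans; [apply Cmod_le_Rabs|].
  replace (4 * M * exp (- d * T) * (q - p)) with
    (2 * M * exp (- d * T) * (q - p) + 2 * M * exp (- d * T) * (q - p)) by ring.
  apply Rplus_le_compat.
  - apply (X fst).
    + intros x t Hx. apply (ccont_2d f x t), Hf, Hx.
    + intros x t Hx Hn. now apply (ccont_2d f' x t), Hf'.
    + intros x t Hx. apply (ccont_on_line f x t), Hf, Hx.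
    + intros x t Hx Hn. now apply Hh.
    + intros x Hx. apply Rle_trans with (2 := B x Hx).
      apply (fst_le_Cmod (Cint (fun t => f' (x, t)) (- T) T)).
  - apply (X snd).
    + intros x t Hx. apply (ccont_2d f x t), Hf, Hx.
    + intros x t Hx Hn. now apply (ccont_2d f' x t), Hf'.
    + intros x t Hx. apply (ccont_on_line f x t), Hf, Hx.
    + intros x t Hx Hn. now apply Hh.
    + intros x Hx. apply Rle_trans with (2 := B x Hx).
      apply (snd_le_Cmod (Cint (fun t => f' (x, t)) (- T) T)).
Qed.

Lemma strip_shift (la lb : C) :
  is_line_int (fun t => f (a, t)) la -> is_line_int (fun t => f (b, t)) lb -> la = lb.
Proof.
  intros Ha Hb. assert (Z : Cmod (lb - la) <= 0).
  2:{ assert (E : (lb - la)%C = 0%C) by (apply Cmod_eq_0; generalize (Cmod_ge_0 (lb - la)); lra).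
      replace lb with ((lb - la) + la)%C by ring. rewrite E. ring. }
  apply le_epsilon. intros eps He. rewrite Rplus_0_l.
  destruct (Ha (eps / 3)) as [A1 [HA1 H1]]; [lra|].
  destruct (Hb (eps / 3)) as [A2 [HA2 H2]]; [lra|].
  destruct (exp_decay_small (4 * M * (b - a)) d (eps / 3) Hd) as [A3 [HA3 H3]].
  { apply Rmult_le_pos; lra. } { lra. }
  set (T := Rmax 1 (Rmax A1 (Rmax A2 A3))).
  assert (T0 := Rmax_l 1 (Rmax A1 (Rmax A2 A3))). assert (T1 := Rmax_r 1 (Rmax A1 (Rmax A2 A3))).
  assert (T2 := Rmax_l A1 (Rmax A2 A3)). assert (T3 := Rmax_r A1 (Rmax A2 A3)).
  assert (T4 := Rmax_l A2 A3). assert (T5 := Rmax_r A2 A3). fold T in T0, T1.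
  specialize (H1 (- T) T ltac:(lra) ltac:(lra)).
  specialize (H2 (- T) T ltac:(lra) ltac:(lra)).
  specialize (H3 T ltac:(lra)).
  (* The shift is cut at [e], which becomes an end point of each half, where no derivative is
     required. *)
  assert (K1 := strip_half T a e T0 ltac:(lra) ltac:(lra) ltac:(lra) ltac:(lra)).
  assert (K2 := strip_half T e b T0 ltac:(lra) ltac:(lra) ltac:(lra) ltac:(lra)).
  set (Ia := Cint (fun t => f (a, t)) (- T) T) in *.
  set (Ib := Cint (fun t => f (b, t)) (- T) T) in *.
  set (Ie := Cint (fun t => f (e, t)) (- T) T) in *.
  replace (lb - la)%C with (- (Ib - lb) + ((Ib - Ie) + (Ie - Ia)) + (Ia - la))%C by ring.
  eapply Rle_trans; [apply Cmod_triangle|].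
  assert (Q1 := Cmod_triangle (- (Ib - lb)) ((Ib - Ie) + (Ie - Ia))).
  assert (Q2 := Cmod_triangle (Ib - Ie) (Ie - Ia)). rewrite Cmod_opp in Q1. nra.
Qed.

End Strip.

(** * Removing the pole of the kernel at 0 *)

Definition Ccos (z : C) : C := ((Cexp (Ci * z) + Cexp (- (Ci * z))) / 2)%C.

Lemma Ci_neq_0 : Ci <> RtoC 0.
Proof. intros H. apply (f_equal snd) in H. cbn in H. lra. Qed.

Lemma derive_RC_Csin (F : R -> C) (x : R) (l : C) :
  derive_RC F x l -> derive_RC (fun y => Csin (F y)) x (l * Ccos (F x))%C.
Proof.
  intros H. eapply derive_RC_eq.
  - apply (derive_RC_ext (fun y => (/ (2 * Ci) * (Cexp (Ci * F y) - Cexp (- (Ci * F y))))%C)).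
    { intros; unfold Csin, Cdiv; ring. }
    apply derive_RC_scal, derive_RC_minus; apply derive_RC_Cexp; [|apply derive_RC_opp]; apply derive_RC_scal, H.
  - cbv beta. unfold Ccos. field. apply Ci_neq_0.
Qed.

Lemma Csin_near_0 (z : C) : Cmod (Csin z - z) <= Cmod z ^ 2 * exp (Cmod z).
Proof.
  assert (H1 := Cexp_quadratic (Ci * z)). assert (H2 := Cexp_quadratic (- (Ci * z))).
  assert (E : (Csin z - z)%C = (((Cexp (Ci * z) - 1 - Ci * z) -
    (Cexp (- (Ci * z)) - 1 - - (Ci * z))) / (2 * Ci))%C).
  { unfold Csin. field. apply Ci_neq_0. }
  rewrite Cmod_opp in H2.
  assert (Hm : Cmod (Ci * z) = Cmod z) by (rewrite Cmod_mult, Cmod_Ci; ring).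
  assert (R1 := re_le_Cmod (Ci * z)). assert (R2 := re_le_Cmod (- (Ci * z))).
  rewrite Cmod_opp in R2. rewrite Hm in H1, H2, R1, R2.
  apply exp_le in R1. apply exp_le in R2. assert (P := pow2_ge_0 (Cmod z)).
  rewrite E, Cmod_div, Cmod_mult, Cmod_Ci, Cmod_R, Rabs_pos_eq, Rmult_1_r; try lra.
  - apply Rmult_le_reg_r with 2; [lra|]. unfold Rdiv. rewrite Rmult_assoc, Rinv_l, Rmult_1_r by lra.
    unfold Cminus at 1. eapply Rle_trans; [apply Cmod_triangle|]. rewrite Cmod_opp. nra.
  - apply Cmod_gt_0. rewrite Cmod_mult, Cmod_Ci, Cmod_R, Rabs_pos_eq; lra.
Qed.

(* [(e^(-w s) - 1) / sin (pi s)] with its removable singularity at [0] filled in. *)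
Definition exp_over_sin (w s : C) : C :=
  if Req_dec_T (Cmod s) 0 then (- w / PI)%C else ((Cexp (- w * s) - 1) / Csin (PI * s))%C.

Definition exp_over_sin' (w s : C) : C :=
  ((- w * Cexp (- w * s) * Csin (PI * s) - (Cexp (- w * s) - 1) * (PI * Ccos (PI * s)))
   / (Csin (PI * s) * Csin (PI * s)))%C.

Lemma exp_over_sin_neq (w s : C) : s <> RtoC 0 ->
  exp_over_sin w s = ((Cexp (- w * s) - 1) / Csin (PI * s))%C.
Proof.
  intros H. unfold exp_over_sin. destruct (Req_dec_T (Cmod s) 0) as [E|E]; [|easy].
  now apply Cmod_eq_0 in E.
Qed.

(** The difference with [- w / PI] has a numerator built from the second-order remainders of the
    exponential and of the sine, hence [O(|s|^2)], over a denominator of order [|s|]. *)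
Lemma ccont_exp_over_sin_0 (w : C) : ccont (exp_over_sin w) (RtoC 0 : C_UniformSpace).
Proof.
  apply ccont_eps. intros eps He.
  assert (P2 : 3 < PI) by (generalize PI2_3_2; unfold PI; lra). assert (P4 := PI_4).
  set (K := (PI * Cmod w ^ 2 * exp (Cmod w) + Cmod w * (16 * exp 4))).
  assert (HK : 0 <= K).
  { unfold K. assert (W := Cmod_ge_0 w). assert (E1 := exp_pos (Cmod w)). assert (E2 := exp_pos 4).
    apply Rplus_le_le_0_compat; [|apply Rmult_le_pos; lra].
    apply Rmult_le_pos; [|lra]. apply Rmult_le_pos; [lra | apply pow2_ge_0]. }
  (* For [|s| <= 1], [PI |s| <= 4], whence [exp 4]. The first bound keeps the remainder
     [16 exp 4 |s|^2] of the sine below [2 |s|], so that [|sin (PI s)| >= |s|]; the second makes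
     [K |s|] smaller than [eps]. *)
  set (r := Rmin (/ (8 * exp 4)) (eps / (K + 1))).
  assert (E4 : 1 < exp 4) by (generalize (exp_ineq1 4 ltac:(lra)); lra).
  assert (Hr : 0 < r).
  { apply Rmin_pos; [apply Rinv_0_lt_compat; lra | apply Rdiv_lt_0_compat; lra]. }
  assert (Hr1 : r <= / (8 * exp 4)) by apply Rmin_l.
  assert (Hr2 : r <= eps / (K + 1)) by apply Rmin_r.
  assert (Hr3 : r <= 1).
  { apply Rle_trans with (1 := Hr1). rewrite <- Rinv_1. apply Rinv_le_contravar; lra. }
  assert (Hball : locally (RtoC 0 : C_UniformSpace) (fun s => Cmod s < r)).
  { assert (Hr' : 0 < r / 2) by lra. exists (mkposreal _ Hr'). intros s [B1 B2].
    change (Rabs (fst s - 0) < r / 2) in B1. change (Rabs (snd s - 0) < r / 2) in B2.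
    rewrite Rminus_0_r in B1, B2. eapply Rle_lt_trans; [apply Cmod_le_Rabs|]. lra. }
  generalize Hball. apply filter_imp. intros s Hs.
  assert (E0 : exp_over_sin w (RtoC 0) = (- w / PI)%C).
  { unfold exp_over_sin. destruct (Req_dec_T (Cmod 0) 0) as [|N]; [easy|]. now rewrite Cmod_0 in N. }
  rewrite E0.
  destruct (Req_dec_T (Cmod s) 0) as [Z|N].
  { apply Cmod_eq_0 in Z. subst s. rewrite E0.
    replace (- w / PI - - w / PI)%C with (RtoC 0) by ring. now rewrite Cmod_0. }
  assert (Hsn : s <> RtoC 0) by (intros ->; now rewrite Cmod_0 in N).
  assert (Sp : 0 < Cmod s) by now apply Cmod_gt_0.
  rewrite exp_over_sin_neq by easy.
  assert (Q1 := Cexp_quadratic (- w * s)). assert (Q2 := Csin_near_0 (PI * s)).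
  assert (Mp : Cmod (PI * s) = PI * Cmod s) by (rewrite Cmod_mult, Cmod_R, Rabs_pos_eq; lra).
  rewrite Mp in Q2.
  assert (X1 : exp (PI * Cmod s) <= exp 4) by (apply exp_le; nra).
  assert (Q3 : Cmod (Csin (PI * s) - PI * s) <= 16 * exp 4 * Cmod s ^ 2).
  { apply Rle_trans with (1 := Q2). rewrite Rpow_mult_distr.
    assert (PI ^ 2 <= 16) by nra. assert (0 <= Cmod s ^ 2) by (apply pow2_ge_0).
    assert (0 <= PI ^ 2 * Cmod s ^ 2) by (apply Rmult_le_pos; [apply pow2_ge_0 | easy]).
    assert (Ep := exp_pos (PI * Cmod s)).
    apply Rle_trans with (PI ^ 2 * Cmod s ^ 2 * exp 4); [now apply Rmult_le_compat_l|].
    replace (16 * exp 4 * Cmod s ^ 2) with (16 * Cmod s ^ 2 * exp 4) by ring.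
    apply Rmult_le_compat_r; [lra|]. now apply Rmult_le_compat_r. }
  assert (Q4 : Cmod s <= Cmod (Csin (PI * s))).
  { replace (Csin (PI * s)) with (PI * s + (Csin (PI * s) - PI * s))%C by ring.
    assert (T := Cmod_triangle_inv (PI * s) (Csin (PI * s) - PI * s)). rewrite Mp in T.
    assert (16 * exp 4 * Cmod s ^ 2 <= 2 * Cmod s).
    { assert (8 * exp 4 * Cmod s <= 1).
      { apply Rle_trans with (8 * exp 4 * / (8 * exp 4)); [nra|]. rewrite Rinv_r; lra. }
      cbn. nra. }
    nra. }
  assert (Q5 : Cmod (Cexp (- w * s) - 1 - - w * s) <= Cmod w ^ 2 * exp (Cmod w) * Cmod s ^ 2).
  { apply Rle_trans with (1 := Q1).
    assert (Mw : Cmod (- w * s) = Cmod w * Cmod s) by (now rewrite Cmod_mult, Cmod_opp).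
    assert (R1 := re_le_Cmod (- w * s)). rewrite Mw in *. rewrite Rpow_mult_distr.
    assert (W := Cmod_ge_0 w).
    assert (exp (Rabs (Re (- w * s))) <= exp (Cmod w)) by (apply exp_le; nra).
    replace (Cmod w ^ 2 * exp (Cmod w) * Cmod s ^ 2) with (Cmod w ^ 2 * Cmod s ^ 2 * exp (Cmod w)) by ring.
    apply Rmult_le_compat_l; [|easy]. apply Rmult_le_pos; apply pow2_ge_0. }
  assert (Sn : Csin (PI * s) <> RtoC 0) by (apply Cmod_gt_0; lra).
  assert (Pn : RtoC PI <> RtoC 0) by (intros H; apply RtoC_inj in H; lra).
  replace ((Cexp (- w * s) - 1) / Csin (PI * s) - - w / PI)%C with
    ((PI * (Cexp (- w * s) - 1 - - w * s) + w * (Csin (PI * s) - PI * s)) / (PI * Csin (PI * s)))%C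
    by (field; now split).
  assert (Dn : (RtoC PI * Csin (PI * s))%C <> RtoC 0) by now apply Cmult_neq_0.
  rewrite Cmod_div by easy. rewrite (Cmod_mult PI), Cmod_R, (Rabs_pos_eq PI) by lra.
  assert (Num : Cmod (PI * (Cexp (- w * s) - 1 - - w * s) + w * (Csin (PI * s) - PI * s)) <= K * Cmod s ^ 2).
  { eapply Rle_trans; [apply Cmod_triangle|]. rewrite !Cmod_mult, Cmod_R, (Rabs_pos_eq PI) by lra.
    unfold K. rewrite Rmult_plus_distr_r. apply Rplus_le_compat.
    - apply Rle_trans with (PI * (Cmod w ^ 2 * exp (Cmod w) * Cmod s ^ 2)); [|right; ring].
      apply Rmult_le_compat_l; lra.
    - apply Rle_trans with (Cmod w * (16 * exp 4 * Cmod s ^ 2)); [|right; ring].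
      apply Rmult_le_compat_l; [apply Cmod_ge_0 | easy]. }
  apply Rle_lt_trans with (K * Cmod s).
  - apply Rmult_le_reg_r with (PI * Cmod (Csin (PI * s))); [nra|].
    unfold Rdiv. rewrite Rmult_assoc, Rinv_l, Rmult_1_r by nra.
    apply Rle_trans with (1 := Num). cbn. rewrite Rmult_1_r, <- Rmult_assoc.
    assert (Cmod s <= PI * Cmod (Csin (PI * s))) by nra.
    apply Rmult_le_compat_l; [nra | easy].
  - assert (eps / (K + 1) * (K + 1) = eps) by (field; lra). nra.
Qed.


Lemma ccont_idC (s : C) : ccont (fun z : C_UniformSpace => z : C) (s : C_UniformSpace).
Proof.
  split.
  - apply continuous_fst.
  - apply continuous_snd.
Qed.

Lemma ccont_ext_loc {U : UniformSpace} (f g : U -> C) (x : U) :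
  locally x (fun u => f u = g u) -> ccont f x -> ccont g x.
Proof.
  intros H Hf. assert (Hx := locally_singleton _ _ H). apply ccont_eps. intros eps He.
  generalize (filter_and _ _ H (ccont_locally f x eps Hf He)).
  apply filter_imp. intros y [E L]. now rewrite <- E, <- Hx.
Qed.

Lemma derive_RC_ext_loc (F G : R -> C) (x : R) (l : C) :
  locally x (fun y => F y = G y) -> derive_RC F x l -> derive_RC G x l.
Proof.
  intros H [H1 H2]; split.
  - apply is_derive_ext_loc with (2 := H1). generalize H. apply filter_imp. now intros y ->.
  - apply is_derive_ext_loc with (2 := H2). generalize H. apply filter_imp. now intros y ->.
Qed.

Lemma locally_neq_0 (s : C) : s <> RtoC 0 ->
  locally (s : C_UniformSpace) (fun z : C => z <> RtoC 0).
Proof.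
  intros Hs. apply Cmod_gt_0 in Hs.
  generalize (ccont_locally _ _ _ (ccont_idC s) Hs). apply filter_imp.
  intros z Hz ->. replace (0 - s)%C with (- s)%C in Hz by ring. rewrite Cmod_opp in Hz. lra.
Qed.

Lemma pair_neq_0 (x t : R) : x <> 0 -> (x, t) <> RtoC 0.
Proof. intros H E. apply H. now apply (f_equal fst) in E. Qed.

Lemma ccont_exp_over_sin (w : C) (x t : R) : -1 < x < 1 ->
  ccont (exp_over_sin w) ((x, t) : C_UniformSpace).
Proof.
  intros Hx. destruct (Req_dec_T (Cmod (x, t)) 0) as [E|N].
  - apply Cmod_eq_0 in E. rewrite E. apply ccont_exp_over_sin_0.
  - assert (Hs : (x, t) <> RtoC 0) by (intros E; rewrite E, Cmod_0 in N; easy).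
    apply (ccont_ext_loc (fun s : C_UniformSpace => ((Cexp (- w * s) - 1) / Csin (PI * s))%C)).
    + generalize (locally_neq_0 _ Hs). apply filter_imp. intros s H.
      now rewrite exp_over_sin_neq.
    + apply (ccont_div (fun s : C_UniformSpace => (Cexp (- w * s) - 1)%C)).
      * apply ccont_minus; [|apply ccont_const].
        apply ccont_Cexp, ccont_mult; [apply ccont_const | apply ccont_idC].
      * apply ccont_Csin, ccont_mult; [apply ccont_const | apply ccont_idC].
      * now apply Csin_PI_neq_0.
Qed.

Lemma ccont_exp_over_sin' (w : C) (x t : R) : -1 < x < 1 -> x <> 0 ->
  ccont (exp_over_sin' w) ((x, t) : C_UniformSpace).
Proof.
  intros Hx Hn.
  assert (S := Csin_PI_neq_0 x t Hx (pair_neq_0 x t Hn)).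
  assert (Cl : forall a : C, ccont (fun s : C_UniformSpace => (a * s)%C) ((x, t) : C_UniformSpace)).
  { intros a. apply ccont_mult; [apply ccont_const | apply ccont_idC]. }
  assert (Ce : ccont (fun s : C_UniformSpace => Cexp (- w * s)) ((x, t) : C_UniformSpace))
    by (apply ccont_Cexp, Cl).
  assert (Cs : ccont (fun s : C_UniformSpace => Csin (PI * s)) ((x, t) : C_UniformSpace))
    by (apply ccont_Csin, Cl).
  unfold exp_over_sin'. apply ccont_div.
  - apply ccont_minus; apply ccont_mult.
    + apply ccont_mult; [apply ccont_const | exact Ce].
    + exact Cs.
    + apply ccont_minus; [exact Ce | apply ccont_const].
    + apply ccont_mult; [apply ccont_const|]. unfold Ccos, Cdiv.
      apply ccont_mult; [|apply ccont_const].
      apply ccont_plus; apply ccont_Cexp; [|apply ccont_opp];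
        (apply ccont_mult; [apply ccont_const | apply Cl]).
  - apply ccont_mult; exact Cs.
  - now apply Cmult_neq_0.
Qed.

Lemma derive_RC_exp_over_sin (w dir : C) (p : R -> C) (y : R) :
  derive_RC p y dir -> -1 < fst (p y) < 1 -> p y <> RtoC 0 ->
  locally y (fun u => p u <> RtoC 0) ->
  derive_RC (fun u => exp_over_sin w (p u)) y (dir * exp_over_sin' w (p y))%C.
Proof.
  intros Hp Hx Hn Hl.
  assert (S : Csin (PI * p y) <> RtoC 0).
  { rewrite (surjective_pairing (p y)) in *. now apply Csin_PI_neq_0. }
  apply (derive_RC_ext_loc (fun u => ((Cexp (- w * p u) - 1) * / Csin (PI * p u))%C)).
  { generalize Hl. apply filter_imp. intros u Hu. now rewrite exp_over_sin_neq. }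
  eapply derive_RC_eq.
  - apply derive_RC_mult.
    + apply derive_RC_minus; [|apply derive_RC_const]. apply derive_RC_Cexp, derive_RC_scal, Hp.
    + apply derive_RC_inv; [|exact S]. apply derive_RC_Csin, derive_RC_scal, Hp.
  - cbv beta. unfold exp_over_sin'. field. exact S.
Qed.

(** The bound by [sinh] makes this uniform across the abscissa 0. The constant is 2, for the two
    terms of the numerator, times the 4 of [sinh_lower]. *)
Lemma exp_over_sin_decay (w : C) (x t : R) : -1 < x < 1 -> 1 <= Rabs t ->
  Cmod (exp_over_sin w (x, t)) <=
  8 * exp (Rabs (Re w)) * exp (- (PI - Rabs (Im w)) * Rabs t).
Proof.
  intros Hx Ht.
  assert (P2 : 3 < PI) by (generalize PI2_3_2; unfold PI; lra).
  assert (Hn : (x, t) <> RtoC 0).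
  { intros E. apply (f_equal snd) in E. cbn in E. subst t. rewrite Rabs_R0 in Ht. lra. }
  rewrite exp_over_sin_neq by easy.
  assert (S1 := sinh_le_Cmod_Csin (PI * x) (PI * t)). rewrite <- PI_mult_pair in S1.
  assert (A : Rabs (PI * t) = PI * Rabs t) by (rewrite Rabs_mult, (Rabs_pos_eq PI); lra).
  assert (S2 := sinh_lower (PI * t) ltac:(rewrite A; nra)). rewrite A in S2.
  assert (S3 : exp (PI * Rabs t) / 4 <= Cmod (Csin (PI * (x, t)))) by lra.
  assert (Ep := exp_pos (PI * Rabs t)).
  rewrite Cmod_div by (apply Cmod_gt_0; lra).
  assert (N : Cmod (Cexp (- w * (x, t)) - 1) <= 2 * exp (Rabs (Re w)) * exp (Rabs (Im w) * Rabs t)).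
  { unfold Cminus. eapply Rle_trans; [apply Cmod_triangle|].
    rewrite Cmod_opp, Cmod_1, exp_Cmod_line, exp_plus.
    assert (B1 : exp (- Re w * x) <= exp (Rabs (Re w))).
    { apply exp_le. eapply Rle_trans; [apply Rmult_le_Rabs|]. rewrite Rabs_Ropp.
      assert (Rabs x <= 1) by (apply Rabs_le; lra). generalize (Rabs_pos (Re w)). nra. }
    assert (B2 : exp (Im w * t) <= exp (Rabs (Im w) * Rabs t)) by (apply exp_le, Rmult_le_Rabs).
    assert (B3 : 1 <= exp (Rabs (Re w))) by (rewrite <- exp_0; apply exp_le, Rabs_pos).
    assert (B4 : 1 <= exp (Rabs (Im w) * Rabs t)).
    { rewrite <- exp_0. apply exp_le. apply Rmult_le_pos; apply Rabs_pos. }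
    assert (B5 := exp_pos (- Re w * x)). assert (B6 := exp_pos (Im w * t)).
    assert (exp (- Re w * x) * exp (Im w * t) <= exp (Rabs (Re w)) * exp (Rabs (Im w) * Rabs t))
      by (apply Rmult_le_compat; lra).
    nra. }
  apply Rle_trans with (2 * exp (Rabs (Re w)) * exp (Rabs (Im w) * Rabs t) * / (exp (PI * Rabs t) / 4)).
  - apply Rmult_le_compat; [apply Cmod_ge_0 | left; apply Rinv_0_lt_compat; lra | exact N |].
    apply Rinv_le_contravar; lra.
  - right. replace (- (PI - Rabs (Im w)) * Rabs t) with (Rabs (Im w) * Rabs t + - (PI * Rabs t)) by ring.
    rewrite exp_plus, exp_Ropp. field. lra.
Qed.

Lemma one_plus_Cexp_neq_0 (w : C) : - PI < Im w < PI -> (1 + Cexp w)%C <> RtoC 0.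
Proof.
  intros Hw H. assert (O := offcut_Cexp w Hw).
  assert (E : Cexp w = RtoC (-1)).
  { replace (Cexp w) with ((1 + Cexp w) - 1)%C by ring. rewrite H. apply C_ext; cbn; ring. }
  rewrite E in O. unfold offcut in O. cbn in O. lra.
Qed.

(* Shifting the line from [c] to [c - 1] multiplies the integrand by [- e^w]. *)
Lemma line_int_kern (c : R) (w : C) : 0 < c < 1 -> - PI < Im w < PI ->
  line_int (kern c w) = (2 / (1 + Cexp w))%C.
Proof.
  intros Hc Hw. assert (P := PI_RGT_0).
  assert (D1 := decaying_kern c w Hc Hw). assert (D0 := decaying_kern c 0 Hc ltac:(cbn; lra)).
  assert (E0 := line_int_kern_0 c Hc).
  (* Subtracting the kernel at [w = 0], whose integral is 1, cancels the pole at 0. *)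
  assert (Lb : is_line_int (fun t => exp_over_sin w (c, t)) (line_int (kern c w) + -1 * 1)%C).
  { apply (is_line_int_ext (fun t => kern c w t + (-1) * kern c 0 t)%C).
    - intros t. rewrite exp_over_sin_neq by (apply pair_neq_0; lra).
      unfold kern. replace (- 0 * (c, t))%C with (RtoC 0) by ring. rewrite Cexp_0.
      unfold Cdiv. ring.
    - apply is_line_int_plus; [apply D1 | apply contC_mult; [apply contC_const | apply D0] | now apply line_int_correct |].
      apply is_line_int_scal; [apply D0|]. rewrite <- E0. now apply line_int_correct. }
  (* On the line [c - 1] the sine changes sign and the exponential gains the factor [Cexp w]; the
     subtracted kernel thus contributes [+ 1]. *)
  assert (La : is_line_int (fun t => exp_over_sin w (c - 1, t)) (- Cexp w * line_int (kern c w) + 1 * 1)%C).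
  { apply (is_line_int_ext (fun t => - Cexp w * kern c w t + 1 * kern c 0 t)%C).
    - intros t. rewrite exp_over_sin_neq by (apply pair_neq_0; lra).
      unfold kern. replace (- 0 * (c, t))%C with (RtoC 0) by ring. rewrite Cexp_0.
      assert (X : Csin (PI * ((c - 1)%R, t)) = (- Csin (PI * (c, t)))%C).
      { rewrite !PI_mult_pair, !Csin_pair.
        replace (PI * (c - 1)) with (PI * c - PI) by ring.
        rewrite sin_minus, cos_minus, sin_PI, cos_PI. apply C_ext; cbn; ring. }
      assert (Y : Cexp (- w * ((c - 1)%R, t)) = (Cexp w * Cexp (- w * (c, t)))%C).
      { rewrite <- Cexp_plus. f_equal. apply C_ext; cbn; ring. }
      rewrite X, Y. field. apply Csin_PI_neq_0; [lra | apply pair_neq_0; lra].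
    - apply is_line_int_plus; try (apply contC_mult; [apply contC_const|]); try apply D1; try apply D0.
      + apply is_line_int_scal; [apply D1 | now apply line_int_correct].
      + apply is_line_int_scal; [apply D0|]. rewrite <- E0. now apply line_int_correct. }
  assert (Ha : Rabs (Im w) < PI) by (apply Rabs_def1; lra).
  set (eta := Rmin c (1 - c) / 2).
  assert (Heta : 0 < eta < c /\ eta < 1 - c).
  { unfold eta. assert (0 < Rmin c (1 - c)) by (apply Rmin_pos; lra).
    generalize (Rmin_l c (1 - c)) (Rmin_r c (1 - c)). lra. }
  assert (E := strip_shift (exp_over_sin w) (exp_over_sin' w) (c - 1) c 0 eta
    (8 * exp (Rabs (Re w))) (PI - Rabs (Im w))
    ltac:(lra) ltac:(lra) ltac:(lra) ltac:(lra)
    ltac:(generalize (exp_pos (Rabs (Re w))); lra)).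
  specialize (E ltac:(intros x t Hx; apply ccont_exp_over_sin; lra)).
  specialize (E ltac:(intros x t Hx Hn; apply ccont_exp_over_sin'; lra)).
  assert (H1 : forall x t, c - 1 < x < c -> x <> 0 ->
     derive_RC (fun y => exp_over_sin w (y, t)) x (exp_over_sin' w (x, t))).
  { intros x t Hx Hn. eapply derive_RC_eq.
    - apply (derive_RC_exp_over_sin w 1%C (fun y => (y, t))); [| |now apply pair_neq_0|].
      + split; cbn; now auto_derive.
      + cbn. lra.
      + exists (mkposreal _ (Rabs_pos_lt x Hn)). intros y Hy.
        change (Rabs (y - x) < Rabs x) in Hy. apply pair_neq_0. intros ->.
        replace (0 - x) with (- x) in Hy by ring. rewrite Rabs_Ropp in Hy. lra.
    - ring. }
  assert (H2 : forall x t, c - 1 < x < c -> x <> 0 ->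
     derive_RC (fun y => exp_over_sin w (x, y)) t (Ci * exp_over_sin' w (x, t))%C).
  { intros x t Hx Hn.
    apply (derive_RC_exp_over_sin w Ci (fun y => (x, y))); [| |now apply pair_neq_0|].
    - split; cbn; now auto_derive.
    - cbn. lra.
    - apply filter_forall. intros y. now apply pair_neq_0. }
  specialize (E H1 H2).
  specialize (E ltac:(intros x t Hx Ht; apply exp_over_sin_decay; lra)).
  specialize (E _ _ La Lb).
  assert (N := one_plus_Cexp_neq_0 w Hw).
  (* With [J] the integral sought, the equality of the two lines reads [J - 1 = 1 - e^w J]. *)
  replace (line_int (kern c w)) with ((line_int (kern c w) + -1 * 1 + 1 + Cexp w * line_int (kern c w)) / (1 + Cexp w))%C.
  - rewrite <- E. field. exact N.
  - field. exact N.
Qed.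

(** * Dividing the integrand by a linear factor *)

(** A single constant serves every integrand dominated by a multiple of [g], so a factor tending to
    0 in front of a fixed weight passes through the integral. *)
Lemma line_int_dominated (g : R -> C) : decaying g -> exists K, 0 <= K /\
  forall f k, contC f -> 0 <= k -> (forall t, Cmod (f t) <= k * Cmod (g t)) ->
  Cmod (line_int f) <= k * K.
Proof.
  intros [Cg [M [d [HM [Hd Hg]]]]].
  exists (2 * M / d). split; [apply Rdiv_le_0_compat; lra|].
  intros f k Cf Hk H.
  replace (k * (2 * M / d)) with (2 * (k * M) / d) by (field; lra).
  apply line_int_bound; try easy; [nra|]. intros t.
  eapply Rle_trans; [apply H|]. rewrite Rmult_assoc. now apply Rmult_le_compat_l.
Qed.

Lemma derive_RC_of_quadratic (F : R -> C) (y : R) (l : C) (K r : R) : 0 < r ->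
  (forall h, Rabs h < r -> Cmod (F (y + h) - F y - h * l) <= K * h ^ 2) ->
  derive_RC F y l.
Proof.
  intros Hr H.
  assert (X : forall (f : R -> R) (m : R),
    (forall h, Rabs h < r -> Rabs (f (y + h) - f y - h * m) <= K * h ^ 2) -> is_derive f y m).
  { intros f m Hf. apply is_derive_Reals. intros eps He.
    assert (He2 : 0 < eps / (Rabs K + 1)).
    { apply Rdiv_lt_0_compat; [easy|]. generalize (Rabs_pos K). lra. }
    assert (Hm : 0 < Rmin r (eps / (Rabs K + 1))) by now apply Rmin_pos.
    exists (mkposreal _ Hm). intros h Hh Hh2. cbn in Hh2.
    assert (H1 : Rabs h < r) by (apply Rlt_le_trans with (1 := Hh2), Rmin_l).
    assert (H2 : Rabs h < eps / (Rabs K + 1)) by (apply Rlt_le_trans with (1 := Hh2), Rmin_r).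
    specialize (Hf h H1).
    replace ((f (y + h) - f y) / h - m) with ((f (y + h) - f y - h * m) / h) by (field; easy).
    unfold Rdiv. rewrite Rabs_mult, Rabs_inv.
    assert (Hp := Rabs_pos_lt h Hh).
    apply Rle_lt_trans with (K * h ^ 2 * / Rabs h).
    { apply Rmult_le_compat_r; [left; now apply Rinv_0_lt_compat | easy]. }
    rewrite <- (pow2_abs h). replace (K * Rabs h ^ 2 * / Rabs h) with (K * Rabs h) by (field; lra).
    assert (KP := Rabs_pos K).
    apply Rle_lt_trans with (Rabs K * Rabs h).
    { apply Rmult_le_compat_r; [lra | apply Rle_abs]. }
    assert (eps / (Rabs K + 1) * (Rabs K + 1) = eps) by (field; lra). nra. }
  split; apply X; intros h Hh; (eapply Rle_trans; [|apply (H h Hh)]).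
  - apply Rle_trans with (Rabs (fst (F (y + h)%R - F y - h * l)%C)).
    + right. f_equal. cbn. ring.
    + apply fst_le_Cmod.
  - apply Rle_trans with (Rabs (snd (F (y + h)%R - F y - h * l)%C)).
    + right. f_equal. cbn. ring.
    + apply snd_le_Cmod.
Qed.

Lemma poly_bounded_line (a : R) : poly_bounded (fun t => (a, t)).
Proof.
  split; [intros t; apply ccont_line|]. exists (1 + Rabs a), 1%nat. intros t.
  eapply Rle_trans; [apply Cmod_le_Rabs|]. cbn.
  generalize (Rabs_pos a) (Rabs_pos t). nra.
Qed.

Lemma Cmod_line_lower (a t : R) : 0 < a -> a <= Cmod (a, t).
Proof.
  intros Ha. apply Rle_trans with (2 := re_le_Cmod (a, t)). cbn. apply Rle_abs.
Qed.

Lemma line_neq_0 (a t : R) : 0 < a -> (a, t) <> RtoC 0.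
Proof. intros Ha. apply pair_neq_0. lra. Qed.

Lemma poly_bounded_inv_line (a : R) : 0 < a -> poly_bounded (fun t => / (a, t))%C.
Proof.
  intros Ha. split.
  - intros t. apply ccont_inv; [apply ccont_line | now apply line_neq_0].
  - exists (/ a), O. intros t. rewrite Cmod_inv by now apply line_neq_0.
    cbn. rewrite Rmult_1_r. apply Rinv_le_contravar; [easy | now apply Cmod_line_lower].
Qed.

Lemma Cmod_Cexp_line (y a t : R) : Cmod (Cexp (y * (a, t))) = exp (y * a).
Proof. rewrite Cmod_Cexp. f_equal. cbn. ring. Qed.

Lemma poly_bounded_exp_line (y a : R) : poly_bounded (fun t => Cexp (y * (a, t))).
Proof.
  split.
  - intros t. apply ccont_Cexp, ccont_mult; [apply ccont_const | apply ccont_line].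
  - exists (exp (y * a)), O. intros t. rewrite Cmod_Cexp_line. cbn. lra.
Qed.

(** The variable [y] is [log u]: the integrand is multiplied by [u^s] with [s = a + i t], and in
    [line_int_exp_div] also divided by [s]. For [a = c + n] the divisor is the point of the original
    line shifted by [n]. *)
Definition line_int_exp (g : R -> C) (a y : R) : C := line_int (fun t => g t * Cexp (y * (a, t)))%C.
Definition line_int_exp_div (g : R -> C) (a y : R) : C :=
  line_int (fun t => g t * (Cexp (y * (a, t)) * / (a, t)))%C.

Lemma decaying_line_int_exp (g : R -> C) (a y : R) : decaying g -> decaying (fun t => g t * Cexp (y * (a, t)))%C.
Proof. intros H. apply decaying_mult; [easy | apply poly_bounded_exp_line]. Qed.

Lemma decaying_line_int_exp_div (g : R -> C) (a y : R) : 0 < a -> decaying g ->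
  decaying (fun t => g t * (Cexp (y * (a, t)) * / (a, t)))%C.
Proof.
  intros Ha H. apply decaying_mult; [easy|]. apply poly_bounded_mult; [apply poly_bounded_exp_line | now apply poly_bounded_inv_line].
Qed.

(** Differentiation in [y] cancels the divisor. The error under the integral carries the factor
    [e^(h s) - 1 - h s], of size [h^2 |s|^2] up to a constant independent of [t], and [|g| |s|] is
    still integrable. *)
Lemma derive_RC_line_int_exp_div (g : R -> C) (a y : R) : 0 < a -> decaying g ->
  derive_RC (line_int_exp_div g a) y (line_int_exp g a y).
Proof.
  intros Ha Dg.
  assert (Dga : decaying (fun t => g t * (a, t))%C) by (apply decaying_mult; [easy | apply poly_bounded_line]).
  destruct (line_int_dominated _ Dga) as [K [HK H]].
  apply derive_RC_of_quadratic with (K := exp (y * a + a) * K) (r := 1); [lra|].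
  intros h Hh.
  set (f := fun t => (g t * (Cexp (y * (a, t)) * / (a, t)) * (Cexp (h * (a, t)) - 1 - h * (a, t)))%C).
  assert (E : (line_int_exp_div g a (y + h) - line_int_exp_div g a y - h * line_int_exp g a y)%C = line_int f).
  { assert (D1 := decaying_line_int_exp_div g a (y + h) Ha Dg). assert (D2 := decaying_line_int_exp_div g a y Ha Dg).
    assert (D3 := decaying_line_int_exp g a y Dg).
    unfold line_int_exp_div, line_int_exp.
    replace (line_int (fun t => g t * (Cexp ((y + h)%R * (a, t)) * / (a, t)))%C -
      line_int (fun t => g t * (Cexp (y * (a, t)) * / (a, t)))%C -
      h * line_int (fun t => g t * Cexp (y * (a, t)))%C)%C with
      (line_int (fun t => g t * (Cexp ((y + h)%R * (a, t)) * / (a, t)))%C +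
      (RtoC (-1) * line_int (fun t => g t * (Cexp (y * (a, t)) * / (a, t)))%C +
      (- h) * line_int (fun t => g t * Cexp (y * (a, t)))%C))%C by ring.
    rewrite <- (line_int_scal (RtoC (-1))), <- (line_int_scal (- h)%C), <- line_int_plus, <- line_int_plus; try easy.
    - apply line_int_ext. intros t. unfold f.
      rewrite RtoC_plus, Cmult_plus_distr_r, Cexp_plus. field. now apply line_neq_0.
    - now apply decaying_plus; apply decaying_scal.
    - now apply decaying_scal.
    - now apply decaying_scal. }
  rewrite E. replace (exp (y * a + a) * K * h ^ 2) with (h ^ 2 * exp (y * a + a) * K) by ring.
  apply H.
  - unfold f. apply contC_mult; [apply (decaying_line_int_exp_div g a y Ha Dg)|]. intros t.
    assert (L : forall k : C, ccont (fun y : R => (k * (a, y))%C) t)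
      by (intros k; apply ccont_mult; [apply ccont_const | apply ccont_line]).
    apply ccont_minus; [apply ccont_minus; [apply ccont_Cexp | apply ccont_const]|]; apply L.
  - apply Rmult_le_pos; [apply pow2_ge_0 | left; apply exp_pos].
  - intros t. unfold f.
    assert (Q := Cexp_quadratic (h * (a, t))).
    assert (Lp : 0 < Cmod (a, t)) by (generalize (Cmod_line_lower a t Ha); lra).
    rewrite !Cmod_mult, Cmod_Cexp_line, Cmod_inv by now apply line_neq_0.
    rewrite Cmod_mult, Cmod_R, Rpow_mult_distr, pow2_abs in Q.
    assert (Q2 : exp (Rabs (Re (h * (a, t)))) <= exp a).
    { apply exp_le. replace (Re (h * (a, t))%C) with (h * a) by (cbn; ring).
      rewrite Rabs_mult, (Rabs_pos_eq a) by lra. nra. }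
    rewrite exp_plus.
    replace (h ^ 2 * (exp (y * a) * exp a) * (Cmod (g t) * Cmod (a, t))) with
      (Cmod (g t) * (exp (y * a) * / Cmod (a, t)) * (h ^ 2 * Cmod (a, t) ^ 2 * exp a)) by (field; lra).
    apply Rmult_le_compat_l.
    { apply Rmult_le_pos; [apply Cmod_ge_0|]. apply Rmult_le_pos; [left; apply exp_pos|].
      left; now apply Rinv_0_lt_compat. }
    apply Rle_trans with (1 := Q). apply Rmult_le_compat_l; [|easy].
    apply Rmult_le_pos; apply pow2_ge_0.
Qed.

(** The limit at minus infinity, that is at [u = 0], which fixes the constants of integration in
    [y]. *)
Definition vanishes (F : R -> C) : Prop :=
  forall eps, 0 < eps -> exists A, forall y, y <= - A -> Cmod (F y) < eps.

Lemma vanishes_plus (F G : R -> C) : vanishes F -> vanishes G -> vanishes (fun y => F y + G y)%C.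
Proof.
  intros HF HG eps He. destruct (HF (eps / 2)) as [A HA]; [lra|].
  destruct (HG (eps / 2)) as [B HB]; [lra|]. exists (Rmax A B). intros y Hy.
  assert (M1 := Rmax_l A B). assert (M2 := Rmax_r A B).
  eapply Rle_lt_trans; [apply Cmod_triangle|].
  specialize (HA y ltac:(lra)). specialize (HB y ltac:(lra)). lra.
Qed.

Lemma vanishes_scal (k : C) (F : R -> C) : vanishes F -> vanishes (fun y => k * F y)%C.
Proof.
  intros HF eps He. assert (P := Cmod_ge_0 k).
  destruct (HF (eps / (Cmod k + 1))) as [A HA]; [apply Rdiv_lt_0_compat; lra|].
  exists A. intros y Hy. specialize (HA y Hy). rewrite Cmod_mult.
  assert (E : eps = eps / (Cmod k + 1) * (Cmod k + 1)) by (field; lra).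
  assert (Q := Cmod_ge_0 (F y)). nra.
Qed.

Lemma vanishes_exp (F : R -> C) (K a : R) : 0 < a -> 0 <= K ->
  (forall y, Cmod (F y) <= K * exp (a * y)) -> vanishes F.
Proof.
  intros Ha HK H eps He. destruct (exp_decay_small K a eps Ha HK He) as [A [_ HA]].
  exists A. intros y Hy. eapply Rle_lt_trans; [apply H|].
  specialize (HA (- y) ltac:(lra)). now replace (- a * - y) with (a * y) in HA by ring.
Qed.

Lemma vanishes_ext (F G : R -> C) : (forall y, F y = G y) -> vanishes F -> vanishes G.
Proof.
  intros E H eps He. destruct (H eps He) as [A HA]. exists A. intros y Hy. rewrite <- E. now apply HA.
Qed.

Lemma line_int_exp_div_vanishes (g : R -> C) (a : R) : 0 < a -> decaying g -> vanishes (line_int_exp_div g a).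
Proof.
  intros Ha Dg. destruct (line_int_dominated g Dg) as [K [HK H]].
  apply vanishes_exp with (K := / a * K) (a := a); [easy| |].
  { apply Rmult_le_pos; [left; now apply Rinv_0_lt_compat | easy]. }
  intros y. replace (/ a * K * exp (a * y)) with (exp (y * a) * / a * K) by (rewrite (Rmult_comm y); ring).
  apply H.
  - apply (decaying_line_int_exp_div g a y Ha Dg).
  - apply Rmult_le_pos; [left; apply exp_pos | left; now apply Rinv_0_lt_compat].
  - intros t. rewrite !Cmod_mult, Cmod_Cexp_line, Cmod_inv by now apply line_neq_0.
    rewrite Rmult_comm. apply Rmult_le_compat_r; [apply Cmod_ge_0|].
    apply Rmult_le_compat_l; [left; apply exp_pos|].
    apply Rinv_le_contravar; [easy | now apply Cmod_line_lower].
Qed.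

(** The factor [e^(y s)] is absorbed by replacing [w] with [w - y], which has the same imaginary
    part; only [e^(n y)] is left in front. *)
Lemma line_int_exp_kern (c : R) (w : C) (n : nat) (y : R) : 0 < c < 1 -> - PI < Im w < PI ->
  line_int_exp (kern c w) (c + INR n) y =
  (2 * exp (INR (S n) * y) / (exp y + Cexp w))%C.
Proof.
  intros Hc Hw.
  assert (Hw' : - PI < Im (w - y)%C < PI) by (cbn; unfold Im in Hw; lra).
  unfold line_int_exp. rewrite (line_int_ext _ (fun t => exp (INR n * y) * kern c (w - y) t)%C).
  - rewrite line_int_scal by now apply decaying_kern. rewrite line_int_kern by easy.
    rewrite Cexp_minus, Cexp_RtoC.
    replace (INR (S n) * y) with (INR n * y + y) by (rewrite S_INR; ring).
    rewrite exp_plus, RtoC_mult.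
    assert (N1 := one_plus_Cexp_neq_0 _ Hw'). rewrite Cexp_minus, Cexp_RtoC in N1.
    assert (N2 : RtoC (exp y) <> RtoC 0) by (intros H; apply RtoC_inj in H; generalize (exp_pos y); lra).
    assert (N3 : (exp y + Cexp w)%C <> RtoC 0).
    { replace (exp y + Cexp w)%C with ((1 + Cexp w / exp y) * exp y)%C by (field; exact N2).
      now apply Cmult_neq_0. }
    field. now repeat split.
  - intros t. unfold kern. rewrite <- Cexp_RtoC.
    replace (- (w - y) * (c, t))%C with (- w * (c, t) + y * (c, t))%C by ring.
    replace (y * ((c + INR n)%R, t))%C with (y * (c, t) + RtoC (INR n * y)%R)%C
      by (apply C_ext; cbn; ring).
    rewrite !Cexp_plus. unfold Cdiv. ring.
Qed.

(** * The kernel with the digamma function *)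

Lemma offcut_exp_plus (z : C) (y : R) : offcut z -> offcut (exp y + z)%C.
Proof.
  intros H Hi. cbn in *. unfold offcut, Im, Re in *. cbn in *.
  specialize (H ltac:(lra)). generalize (exp_pos y). lra.
Qed.

(** Adding a positive real does not bring [z] closer to 0 when [Re z >= 0]; otherwise the imaginary
    part alone bounds the modulus from below. *)
Lemma offcut_lower (z : C) : offcut z ->
  exists m, 0 < m /\ forall y, m <= Cmod (exp y + z).
Proof.
  intros H. assert (Zp : 0 < Cmod z) by (apply Cmod_gt_0, offcut_neq_0, H).
  destruct (Rle_dec 0 (Re z)) as [L|L].
  - exists (Cmod z). split; [easy|]. intros y.
    assert (E1 := Cmod_sqr (exp y + z)). assert (E2 := Cmod_sqr z).
    assert (Ep := exp_pos y). assert (Q := Cmod_ge_0 (exp y + z)).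
    cbn in E1. unfold Re, Im in *. cbn in E1. nra.
  - assert (Hi : Im z <> 0) by (intros E; specialize (H E); lra).
    exists (Rabs (Im z)). split; [now apply Rabs_pos_lt|]. intros y.
    replace (Im z) with (Im (exp y + z)) by (cbn; unfold Im; ring).
    apply Rle_trans with (2 := Rmax_Cmod _). apply Rmax_r.
Qed.

Lemma derive_RC_exp (a x : R) : derive_RC (fun y => RtoC (exp (a * y))) x (RtoC (a * exp (a * x))).
Proof. apply derive_RC_RtoC. auto_derive; [easy|]. ring. Qed.

Lemma derive_RC_exp1 (x : R) : derive_RC (fun y => RtoC (exp y)) x (RtoC (exp x)).
Proof. apply derive_RC_RtoC. auto_derive; [easy|]. ring. Qed.

Lemma derive_RC_Clog_exp (z : C) (y : R) : offcut z ->
  derive_RC (fun y => Clog (exp y + z)) y (exp y / (exp y + z))%C.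
Proof.
  intros H. eapply derive_RC_eq.
  - apply derive_RC_Clog; [|now apply offcut_exp_plus].
    apply derive_RC_plus; [apply derive_RC_exp1 | apply derive_RC_const].
  - cbv beta. f_equal. ring.
Qed.

Lemma Clog_exp_vanishes (z : C) : offcut z ->
  vanishes (fun y => (Clog (exp y + z) - Clog z)%C).
Proof.
  intros H eps He.
  assert (Hc : ccont (fun u : R => Clog (u + z)) 0).
  { apply (derive_RC_ccont _ _ (1 / (0 + z))%C). eapply derive_RC_eq.
    - apply derive_RC_Clog; [apply derive_RC_plus; [apply derive_RC_id | apply derive_RC_const]|].
      now replace (RtoC 0 + z)%C with z by ring.
    - cbv beta. f_equal. ring. }
  destruct (ccont_locally _ _ _ Hc He) as [d Hd].
  destruct (exp_decay_small 1 1 d Rlt_0_1 Rle_0_1 (cond_pos d)) as [A [_ HA]].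
  exists A. intros y Hy. specialize (HA (- y) ltac:(lra)).
  replace (- (1) * - y) with y in HA by ring. rewrite Rmult_1_l in HA.
  specialize (Hd (exp y)). replace (RtoC 0 + z)%C with z in Hd by ring. apply Hd.
  change (Rabs (exp y - 0) < d). rewrite Rminus_0_r, Rabs_pos_eq; [easy | left; apply exp_pos].
Qed.

Lemma exp_vanishes (a : R) : 0 < a -> vanishes (fun y => RtoC (exp (a * y))).
Proof.
  intros Ha. apply vanishes_exp with (K := 1) (a := a); [easy | lra |].
  intros y. rewrite Cmod_R, Rabs_pos_eq by (left; apply exp_pos). lra.
Qed.

Fixpoint phi_sum (n : nat) (s : C) : C :=
  match n with
  | O => 0%C
  | S k => (phi_sum k s + (/ INR (S k) - / (s + INR k)))%C
  end.

Lemma INR_S_C (n : nat) : RtoC (INR (S n)) <> RtoC 0.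
Proof. intros H. apply RtoC_inj in H. now apply (not_0_INR (S n)). Qed.

Lemma poly_bounded_phi_sum (c : R) (n : nat) : 0 < c -> poly_bounded (fun t => phi_sum n (c, t)).
Proof.
  intros Hc. induction n as [|n IH]; [exact (poly_bounded_const 0%C)|].
  apply poly_bounded_ext with (fun t => phi_sum n (c, t) + (/ INR (S n) + (-1) * / ((c + INR n)%R, t)))%C.
  - intros t. cbn [phi_sum]. f_equal.
    replace ((c, t) + INR n)%C with ((c + INR n)%R, t) by (apply C_ext; cbn; ring). ring.
  - apply poly_bounded_plus; [exact IH|]. apply poly_bounded_plus; [apply poly_bounded_const|].
    apply poly_bounded_mult; [apply poly_bounded_const | apply poly_bounded_inv_line].
    generalize (pos_INR n). lra.
Qed.

(** At [y = 0] this is minus the transform of [phi_sum n]. The constants [1 / (k + 1)] get the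
    weight [e^((k+1) y)] so that the derivatives of the summands, [2 e^((k+1) y) (1 - e^y) / ((e^y +
    e^w) (1 + e^w))], telescope in [k]. *)
Fixpoint Bsum (c : R) (w : C) (n : nat) (y : R) : C :=
  match n with
  | O => 0%C
  | S k => (Bsum c w k y + (line_int_exp_div (kern c w) (c + INR k) y -
             2 / (INR (S k) * (1 + Cexp w)) * exp (INR (S k) * y)))%C
  end.

Section PhiKernel.
Variables (c : R) (w : C).
Hypothesis (Hc : 0 < c < 1) (Hw : - PI < Im w < PI).

Lemma line_int_phi_sum (n : nat) :
  line_int (fun t => kern c w t * phi_sum n (c, t))%C = (- Bsum c w n 0)%C.
Proof.
  assert (Dk := decaying_kern c w Hc Hw).
  induction n as [|n IH].
  - cbn. rewrite (line_int_ext _ (fun t => 0 * kern c w t)%C) by (intros; ring).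
    rewrite line_int_scal by easy. ring.
  - assert (Hn : 0 < c + INR n) by (generalize (pos_INR n); lra).
    assert (D1 := decaying_line_int_exp_div (kern c w) (c + INR n) 0 Hn Dk).
    rewrite (line_int_ext _ (fun t => kern c w t * phi_sum n (c, t) +
      (/ INR (S n) * kern c w t + (-1) *
        (kern c w t * (Cexp (0 * ((c + INR n)%R, t)) * / ((c + INR n)%R, t)))))%C).
    + rewrite line_int_plus, line_int_plus, line_int_scal, line_int_scal, IH; try easy.
      * change (line_int (fun t => (kern c w t * (Cexp (0 * ((c + INR n)%R, t)) * / ((c + INR n)%R, t)))%C))
          with (line_int_exp_div (kern c w) (c + INR n) 0).
        rewrite line_int_kern by easy. cbn [Bsum]. rewrite Rmult_0_r, exp_0. field.
        split; [now apply one_plus_Cexp_neq_0 | apply INR_S_C].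
      * now apply decaying_scal.
      * now apply (decaying_scal (RtoC (-1))).
      * apply decaying_mult; [easy | apply poly_bounded_phi_sum; lra].
      * apply decaying_plus; [now apply decaying_scal | now apply (decaying_scal (RtoC (-1)))].
    + intros t. cbn [phi_sum].
      replace ((c, t) + INR n)%C with ((c + INR n)%R, t) by (apply C_ext; cbn; ring).
      replace (0 * ((c + INR n)%R, t))%C with (RtoC 0) by ring. rewrite Cexp_0. ring.
Qed.

(** [Bsum] minus the logarithm that is its limit for [y <= 0]; the telescoped derivative leaves only
    the last term, of order [e^((n+1) y)]. *)
Definition phi_remainder (n : nat) (y : R) : C :=
  (Bsum c w n y + (- 2 / (1 + Cexp w)) * (Clog (exp y + Cexp w) - Clog (Cexp w)))%C.

Lemma exp_plus_Cexp_neq_0 (y : R) : (exp y + Cexp w)%C <> RtoC 0.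
Proof. now apply offcut_neq_0, offcut_exp_plus, offcut_Cexp. Qed.

Lemma derive_RC_phi_remainder (n : nat) (y : R) :
  derive_RC (phi_remainder n) y (- 2 * exp (INR (S n) * y) / ((exp y + Cexp w) * (1 + Cexp w)))%C.
Proof.
  assert (N1 := one_plus_Cexp_neq_0 w Hw). assert (N2 := exp_plus_Cexp_neq_0 y).
  induction n as [|n IH].
  - unfold phi_remainder. eapply derive_RC_eq.
    + apply derive_RC_plus; [apply derive_RC_const|]. apply derive_RC_scal, derive_RC_minus; [|apply derive_RC_const].
      now apply derive_RC_Clog_exp, offcut_Cexp.
    + cbn [INR]. rewrite Rmult_1_l. field. now split.
  - assert (Hn : 0 < c + INR n) by (generalize (pos_INR n); lra).
    apply (derive_RC_ext (fun y => phi_remainder n y + (line_int_exp_div (kern c w) (c + INR n) y -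
             2 / (INR (S n) * (1 + Cexp w)) * exp (INR (S n) * y)))%C).
    { intros u. unfold phi_remainder. cbn [Bsum]. ring. }
    eapply derive_RC_eq.
    + apply derive_RC_plus; [exact IH|]. apply derive_RC_minus.
      * apply derive_RC_line_int_exp_div; [easy | now apply decaying_kern].
      * apply derive_RC_scal, derive_RC_exp.
    + rewrite line_int_exp_kern by easy.
      replace (INR (S (S n)) * y) with (INR (S n) * y + y) by (rewrite (S_INR (S n)); ring).
      rewrite exp_plus, !RtoC_mult. field. repeat split; try easy. apply INR_S_C.
Qed.

Lemma phi_remainder_vanishes (n : nat) : vanishes (phi_remainder n).
Proof.
  assert (B : vanishes (Bsum c w n)).
  { induction n as [|n IH].
    - intros eps He. exists 0. intros y _. cbn. now rewrite Cmod_0.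
    - assert (Hn : 0 < c + INR n) by (generalize (pos_INR n); lra).
      apply vanishes_ext with (fun y => Bsum c w n y + (line_int_exp_div (kern c w) (c + INR n) y +
             (- (2 / (INR (S n) * (1 + Cexp w)))) * exp (INR (S n) * y)))%C.
      { intros y. cbn [Bsum]. ring. }
      apply vanishes_plus; [exact IH|]. apply vanishes_plus.
      + apply line_int_exp_div_vanishes; [easy | now apply decaying_kern].
      + apply vanishes_scal, exp_vanishes. apply lt_0_INR. lia. }
  apply vanishes_plus; [exact B|]. apply vanishes_scal, Clog_exp_vanishes. now apply offcut_Cexp.
Qed.

(** The remainder vanishes at minus infinity and its derivative is at most [K e^((n+1) y)], because
    [|e^y + e^w|] stays away from 0; integrating up to 0 gives [K / (n + 1)]. *)
Lemma phi_remainder_bound : exists K, 0 <= K /\ forall n, Cmod (phi_remainder n 0) <= K / INR (S n).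
Proof.
  destruct (offcut_lower (Cexp w) (offcut_Cexp w Hw)) as [m [Hm Hl]].
  assert (N1 := one_plus_Cexp_neq_0 w Hw). assert (P1 : 0 < Cmod (1 + Cexp w)) by now apply Cmod_gt_0.
  exists (2 / (m * Cmod (1 + Cexp w))). split.
  { apply Rdiv_le_0_compat; [lra | now apply Rmult_lt_0_compat]. }
  intros n. set (K := 2 / (m * Cmod (1 + Cexp w))).
  assert (HK : 0 < K) by (apply Rdiv_lt_0_compat; [lra | now apply Rmult_lt_0_compat]).
  assert (Sp := lt_0_INR (S n) (Nat.lt_0_succ n)).
  apply le_epsilon. intros eps He.
  destruct (phi_remainder_vanishes n eps He) as [A HA].
  (* The integration starts at [- Y], where the remainder is already below [eps]. *)
  set (Y := Rmax A 0). specialize (HA (- Y) ltac:(generalize (Rmax_l A 0); unfold Y; lra)).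
  assert (HY : 0 <= Y) by apply Rmax_r.
  replace (phi_remainder n 0) with ((phi_remainder n 0 - phi_remainder n (- Y)) + phi_remainder n (- Y))%C by ring.
  eapply Rle_trans; [apply Cmod_triangle|]. apply Rplus_le_compat; [|lra].
  set (G := fun y => K / INR (S n) * exp (INR (S n) * y)).
  apply Rle_trans with (G 0 - G (- Y)).
  - apply (derive_RC_increment_le (phi_remainder n) (fun y => - 2 * exp (INR (S n) * y) / ((exp y + Cexp w) * (1 + Cexp w)))%C
      G (fun y => K * exp (INR (S n) * y))); [lra| | |].
    + intros y _. apply derive_RC_phi_remainder.
    + intros y _. apply is_derive_exp_growth. lra.
    + intros y _. assert (N2 := exp_plus_Cexp_neq_0 y). specialize (Hl y).
      rewrite Cmod_div by now apply Cmult_neq_0.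
      rewrite !Cmod_mult, !Cmod_R, (Rabs_pos_eq (exp _)) by (left; apply exp_pos).
      replace (Rabs (- 2)) with 2 by (rewrite Rabs_left; lra).
      unfold K. set (a := Cmod (exp y + Cexp w)) in *. set (b := Cmod (1 + Cexp w)) in *.
      set (E := exp (INR (S n) * y)). assert (HE : 0 < E) by apply exp_pos.
      replace (2 * E / (a * b)) with (2 / (a * b) * E) by (field; lra).
      apply Rmult_le_compat_r; [lra|]. apply Rmult_le_compat_l; [lra|].
      apply Rinv_le_contravar; [now apply Rmult_lt_0_compat|]. apply Rmult_le_compat_r; lra.
  - unfold G. rewrite Rmult_0_r, exp_0.
    assert (0 <= K / INR (S n) * exp (INR (S n) * - Y)).
    { apply Rmult_le_pos; [apply Rdiv_le_0_compat; lra | left; apply exp_pos]. }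
    lra.
Qed.

End PhiKernel.

Lemma Clim_unique_bound (a b : C) (K : R) (u : nat -> R) :
  is_lim_seq u 0 -> (forall n, Cmod (a - b) <= K * u n) -> a = b.
Proof.
  intros Hu H.
  assert (L : is_lim_seq (fun n => K * u n) (Finite (K * 0))) by (apply is_lim_seq_scal_l with (lu := Finite 0); exact Hu).
  rewrite Rmult_0_r in L.
  assert (B : Cmod (a - b) <= 0).
  { apply (is_lim_seq_le (fun _ => Cmod (a - b)) (fun n => K * u n) (Cmod (a - b)) 0 H); [apply is_lim_seq_const | exact L]. }
  assert (E : (a - b)%C = 0%C) by (apply Cmod_eq_0; generalize (Cmod_ge_0 (a - b)); lra).
  replace a with ((a - b) + b)%C by ring. rewrite E. ring.
Qed.

Lemma is_lim_seq_inv_S : is_lim_seq (fun n => / INR (S n)) 0.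
Proof.
  apply (is_lim_seq_incr_1 (fun n => / INR n)).
  apply (is_lim_seq_inv _ p_infty); [apply is_lim_seq_INR | easy].
Qed.

(** The error is locally uniform in [t], which transfers continuity from the approximations; the
    growth is read off from the approximation of index 0. Continuity and growth of phi and zeta on
    the line are obtained in this way. *)
Lemma poly_bounded_of_approx (p : R -> C) (q : nat -> R -> C) (b : R -> C) (e : nat -> R) :
  poly_bounded b -> (forall n, poly_bounded (q n)) -> is_lim_seq e 0 ->
  (forall n t, Cmod (p t - q n t) <= e n * Cmod (b t)) -> poly_bounded p.
Proof.
  intros [Cb [A [k Hb]]] Hq He H.
  assert (Cp : contC p).
  { intros t. apply ccont_eps. intros eps Hep.
    set (B := Cmod (b t) + 1). assert (HB : 0 < B) by (unfold B; generalize (Cmod_ge_0 (b t)); lra).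
    assert (He3 : 0 < eps / (3 * B)) by (apply Rdiv_lt_0_compat; lra).
    destruct (proj2 (is_lim_seq_spec _ _) He (mkposreal _ He3)) as [N HN].
    specialize (HN N (le_n N)). cbn in HN. rewrite Rminus_0_r in HN.
    apply Rabs_def2 in HN.
    assert (Hq1 := ccont_locally (q N) t (eps / 3) (proj1 (Hq N) t) ltac:(lra)).
    assert (Hb1 := ccont_locally b t 1 (Cb t) Rlt_0_1).
    generalize (filter_and _ _ Hq1 Hb1). apply filter_imp. intros u [U1 U2].
    assert (E : eps / (3 * B) * B = eps / 3) by (field; lra).
    assert (Bu : Cmod (b u) <= B).
    { replace (b u) with (b t + (b u - b t))%C by ring.
      eapply Rle_trans; [apply Cmod_triangle|]. unfold B. lra. }
    assert (H1 := H N u). assert (H2 := H N t). assert (P1 := Cmod_ge_0 (b u)).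
    assert (P2 := Cmod_ge_0 (b t)).
    assert (H1' : Cmod (p u - q N u) <= eps / 3) by (rewrite <- E; nra).
    assert (H2' : Cmod (p t - q N t) <= eps / 3).
    { rewrite <- E. assert (Cmod (b t) <= B) by (unfold B; lra). nra. }
    replace (p u - p t)%C with ((p u - q N u) + (q N u - q N t) + - (p t - q N t))%C by ring.
    eapply Rle_lt_trans; [apply Cmod_triangle|]. rewrite Cmod_opp.
    assert (T := Cmod_triangle (p u - q N u) (q N u - q N t)). lra. }
  split; [easy|].
  destruct (Hq O) as [_ [D [j HD]]].
  exists (Rabs D + Rabs (e O) * Rabs A), (j + k)%nat. intros t.
  replace (p t) with (q O t + (p t - q O t))%C by ring.
  eapply Rle_trans; [apply Cmod_triangle|].
  specialize (H O t). specialize (HD t). specialize (Hb t).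
  assert (Pt := Rabs_pos t).
  assert (X1 : 1 <= (1 + Rabs t) ^ j) by (apply pow_R1_Rle; lra).
  assert (X2 : 1 <= (1 + Rabs t) ^ k) by (apply pow_R1_Rle; lra).
  rewrite pow_add, Rmult_plus_distr_r.
  assert (Y1 := Rle_abs D). assert (Y2 := Rle_abs (e O)). assert (Y3 := Rle_abs A).
  assert (Z1 := Rabs_pos D). assert (Z2 := Rabs_pos (e O)). assert (Z3 := Rabs_pos A).
  set (J := (1 + Rabs t) ^ j) in *. set (L := (1 + Rabs t) ^ k) in *.
  apply Rplus_le_compat.
  - apply Rle_trans with (1 := HD). apply Rle_trans with (Rabs D * J).
    + apply Rmult_le_compat_r; lra.
    + apply Rmult_le_compat_l; [easy|]. nra.
  - apply Rle_trans with (1 := H). apply Rle_trans with (Rabs (e O) * (Rabs A * L)).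
    + apply Rle_trans with (Rabs (e O) * Cmod (b t)).
      * apply Rmult_le_compat_r; [apply Cmod_ge_0 | easy].
      * apply Rmult_le_compat_l; [easy|]. apply Rle_trans with (1 := Hb). apply Rmult_le_compat_r; lra.
    + rewrite Rmult_assoc. apply Rmult_le_compat_l; [easy|]. apply Rmult_le_compat_l; [easy|]. nra.
Qed.


(** All that the kernel computations retain of [gamma + psi]: its series, with a rate.
    [phi_approx_digamma] supplies the instance. *)
Definition phi_approx (phi : C -> C) : Prop :=
  forall s n, 0 < Re s -> Cmod (phi s - phi_sum (S n) s) <= / INR (S n) * Cmod (s - 1).

Lemma poly_bounded_line_minus (c : R) (a : C) : poly_bounded (fun t => (c, t) - a)%C.
Proof. apply poly_bounded_plus; [apply poly_bounded_line | apply (poly_bounded_const (- a)%C)]. Qed.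

Lemma poly_bounded_phi (phi : C -> C) (c : R) : 0 < c -> phi_approx phi -> poly_bounded (fun t => phi (c, t)).
Proof.
  intros Hc H.
  apply (poly_bounded_of_approx _ (fun n t => phi_sum (S n) (c, t)) (fun t => (c, t) - 1)%C
    (fun n => / INR (S n))).
  - apply poly_bounded_line_minus.
  - intros n. now apply poly_bounded_phi_sum.
  - apply is_lim_seq_inv_S.
  - intros n t. apply H. exact Hc.
Qed.

Lemma decaying_opp (f : R -> C) : decaying f -> decaying (fun t => - f t)%C.
Proof.
  intros D. apply decaying_ext with (fun t => f t * (-1))%C; [intros; ring|].
  apply decaying_mult; [easy | apply poly_bounded_const].
Qed.

Lemma line_int_minus (f g : R -> C) : decaying f -> decaying g ->
  line_int (fun t => f t - g t)%C = (line_int f - line_int g)%C.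
Proof.
  intros Df Dg. unfold Cminus at 1. rewrite line_int_plus; [|easy|now apply decaying_opp].
  rewrite (line_int_ext (fun t => - g t)%C (fun t => (-1) * g t)%C) by (intros; ring).
  rewrite line_int_scal by easy. ring.
Qed.

Lemma line_int_phi (phi : C -> C) (c : R) (w : C) : phi_approx phi -> 0 < c < 1 -> - PI < Im w < PI ->
  line_int (fun t => kern c w t * phi (c, t))%C =
  (2 * (w - Clog (1 + Cexp w)) / (1 + Cexp w))%C.
Proof.
  intros Hphi Hc Hw. assert (Dk := decaying_kern c w Hc Hw).
  assert (Pp := poly_bounded_phi phi c ltac:(lra) Hphi).
  assert (Dl : decaying (fun t => kern c w t * ((c, t) - 1))%C) by (apply decaying_mult; [easy | apply poly_bounded_line_minus]).
  destruct (line_int_dominated _ Dl) as [K [HK HL]].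
  destruct (phi_remainder_bound c w Hc Hw) as [K2 [HK2 HR]].
  assert (N1 := one_plus_Cexp_neq_0 w Hw).
  apply (Clim_unique_bound _ _ (K + K2) (fun n => / INR (S n)) is_lim_seq_inv_S).
  intros n.
  assert (Hs := line_int_phi_sum c w Hc Hw (S n)). assert (HRn := HR (S n)).
  set (V := (2 * (w - Clog (1 + Cexp w)) / (1 + Cexp w))%C).
  assert (E : (- Bsum c w (S n) 0)%C = (V - phi_remainder c w (S n) 0)%C).
  { unfold phi_remainder, V. rewrite exp_0, Clog_Cexp by easy. field. exact N1. }
  assert (Ps := poly_bounded_phi_sum c (S n) ltac:(lra)).
  replace (line_int (fun t => kern c w t * phi (c, t))%C - V)%C with
    ((line_int (fun t => kern c w t * phi (c, t))%C - line_int (fun t => kern c w t * phi_sum (S n) (c, t))%C)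
      + - phi_remainder c w (S n) 0)%C by (rewrite Hs, E; ring).
  eapply Rle_trans; [apply Cmod_triangle|]. rewrite Cmod_opp, Rmult_plus_distr_r.
  apply Rplus_le_compat.
  - rewrite <- line_int_minus by (apply decaying_mult; easy).
    rewrite (Rmult_comm K). apply HL.
    + intros t. apply ccont_minus.
      * apply (proj1 (decaying_mult _ _ Dk Pp)).
      * apply (proj1 (decaying_mult _ _ Dk Ps)).
    + left. apply Rinv_0_lt_compat, lt_0_INR. lia.
    + intros t. replace (kern c w t * phi (c, t) - kern c w t * phi_sum (S n) (c, t))%C
        with (kern c w t * (phi (c, t) - phi_sum (S n) (c, t)))%C by ring.
      rewrite !Cmod_mult. specialize (Hphi (c, t) n ltac:(cbn; lra)).
      assert (P := Cmod_ge_0 (kern c w t)). nra.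
  - apply Rle_trans with (1 := HRn). apply Rmult_le_compat_l; [easy|].
    apply Rinv_le_contravar; [apply lt_0_INR; lia | apply le_INR; lia].
Qed.

(** Dividing [z] by a positive real keeps it off the cut, as does adding 1, so the imaginary part of
    the left side is a principal argument. *)
Lemma Clog_exp_scale (z : C) (y : R) : offcut z ->
  (y + Clog (1 + z / exp y))%C = Clog (exp y + z).
Proof.
  intros Hz. assert (Ep := exp_pos y).
  assert (En : RtoC (exp y) <> RtoC 0) by (intros H; apply RtoC_inj in H; lra).
  assert (Hs : (exp y + z)%C = (exp y * (1 + z / exp y))%C) by (field; exact En).
  assert (Ho : offcut (1 + z / exp y)).
  { assert (E : (1 + z / exp y)%C = (1 + Re z / exp y, Im z / exp y)).
    { replace (z / exp y)%C with (RtoC (/ exp y) * z)%C by (rewrite RtoC_inv; [unfold Cdiv; ring | lra]).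
      apply C_ext; cbn; unfold Re, Im; field; lra. }
    rewrite E. intros Hi. cbn in Hi |- *.
    assert (Hi2 : Im z = 0).
    { replace (Im z) with (Im z / exp y * exp y) by (field; lra). rewrite Hi. ring. }
    specialize (Hz Hi2). assert (0 < Re z / exp y) by (apply Rdiv_lt_0_compat; lra). lra. }
  rewrite <- (Clog_Cexp (y + Clog (1 + z / exp y))).
  - rewrite Cexp_plus, Cexp_RtoC, Cexp_Clog by now apply offcut_neq_0. now rewrite Hs.
  - assert (A := Carg_offcut_bound _ Ho).
    replace (Im (y + Clog (1 + z / exp y))%C) with (Carg (1 + z / exp y)); [easy|].
    unfold Im, Clog, Cplus; cbn [fst snd RtoC]. ring.
Qed.

(* [kern c w0] carries the factor [z^(-s) / sin (pi s)], where [z = e^w0]. *)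
Section FullKernel.
Variables (phi : C -> C) (c : R) (w0 : C).
Hypothesis (Hphi : phi_approx phi) (Hc : 0 < c < 1) (Hw : - PI < Im w0 < PI).

Definition full_kern (t : R) : C := (kern c w0 t * (phi (c, t) - w0))%C.

Lemma decaying_full_kern : decaying full_kern.
Proof.
  apply decaying_mult; [now apply decaying_kern|].
  apply poly_bounded_plus; [apply poly_bounded_phi; [lra | easy] | apply (poly_bounded_const (- w0)%C)].
Qed.

(** At [w = w0 - y] the transform of phi brings [w0 - y - log (1 + z/u)]. The term [- w0] of the
    kernel cancels [w0], and [y + log (1 + z/u)] is [log (u + z)]. *)
Lemma line_int_exp_full_kern (y : R) :
  line_int_exp full_kern c y = (- 2 * exp y * Clog (exp y + Cexp w0) / (exp y + Cexp w0))%C.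
Proof.
  assert (Hw' : - PI < Im (w0 - y)%C < PI) by (cbn; unfold Im in Hw; lra).
  assert (Dk := decaying_kern c _ Hc Hw').
  assert (Pp := poly_bounded_phi phi c ltac:(lra) Hphi).
  unfold line_int_exp.
  rewrite (line_int_ext _ (fun t => kern c (w0 - y) t * phi (c, t) + (- w0) * kern c (w0 - y) t)%C).
  - assert (D1 := decaying_mult _ _ Dk Pp). assert (D2 := decaying_scal (- w0)%C _ Dk).
    rewrite line_int_plus, line_int_scal, line_int_kern, (line_int_phi phi) by easy.
    assert (L := Clog_exp_scale (Cexp w0) y (offcut_Cexp w0 Hw)).
    assert (N1 := one_plus_Cexp_neq_0 _ Hw').
    assert (N2 := exp_plus_Cexp_neq_0 w0 Hw y).
    rewrite Cexp_minus, Cexp_RtoC in N1 |- *. rewrite <- L.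
    assert (En : RtoC (exp y) <> RtoC 0) by (intros H; apply RtoC_inj in H; generalize (exp_pos y); lra).
    field. now repeat split.
  - intros t. unfold full_kern, kern.
    replace (- (w0 - y) * (c, t))%C with (- w0 * (c, t) + y * (c, t))%C by ring.
    rewrite Cexp_plus. unfold Cdiv. ring.
Qed.

(** Both sides have the derivative just computed, which is that of minus the square of the
    logarithm, and both tend to 0 at minus infinity, where [log (e^y + z)] tends to [w0]. *)
Lemma line_int_exp_div_full_kern (y : R) :
  line_int_exp_div full_kern c y = (w0 * w0 - Clog (exp y + Cexp w0) * Clog (exp y + Cexp w0))%C.
Proof.
  assert (Oz := offcut_Cexp w0 Hw).
  set (D := fun y => (line_int_exp_div full_kern c y +
    (Clog (exp y + Cexp w0) * Clog (exp y + Cexp w0) - w0 * w0))%C).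
  assert (DD : forall x, derive_RC D x 0%C).
  { intros x. unfold D. eapply derive_RC_eq.
    - apply derive_RC_plus; [apply derive_RC_line_int_exp_div; [lra | apply decaying_full_kern]|].
      apply derive_RC_minus; [|apply derive_RC_const].
      apply derive_RC_mult; now apply derive_RC_Clog_exp.
    - cbv beta. rewrite line_int_exp_full_kern. field. now apply exp_plus_Cexp_neq_0. }
  assert (VD : vanishes D).
  { apply vanishes_plus; [apply line_int_exp_div_vanishes; [lra | apply decaying_full_kern]|].
    assert (V := Clog_exp_vanishes _ Oz). rewrite Clog_Cexp in V by easy.
    intros eps He. set (m := Cmod w0).
    assert (Hm : 0 <= m) by apply Cmod_ge_0.
    (* The bounds match the factorization [L^2 - w0^2 = (L - w0) ((L - w0) + 2 w0)], whose second
       factor is at most [1 + 2 m]. *)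
    destruct (V (Rmin 1 (eps / (2 * m + 2)))) as [A HA].
    { apply Rmin_pos; [lra | apply Rdiv_lt_0_compat; lra]. }
    exists A. intros u Hu. specialize (HA u Hu).
    assert (H1 := Rmin_l 1 (eps / (2 * m + 2))). assert (H2 := Rmin_r 1 (eps / (2 * m + 2))).
    set (L := Clog (exp u + Cexp w0)) in *.
    replace (L * L - w0 * w0)%C with ((L - w0) * ((L - w0) + 2 * w0))%C by ring.
    rewrite Cmod_mult. assert (T := Cmod_triangle (L - w0) (2 * w0)).
    rewrite Cmod_mult, Cmod_R, Rabs_pos_eq in T by lra. fold m in T.
    assert (P := Cmod_ge_0 (L - w0)). assert (P2 := Cmod_ge_0 (L - w0 + 2 * w0)).
    apply Rle_lt_trans with (Cmod (L - w0) * (1 + 2 * m)); [apply Rmult_le_compat_l; lra|].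
    apply Rlt_le_trans with (eps / (2 * m + 2) * (2 * m + 2)); [|right; field; lra].
    assert (0 < eps / (2 * m + 2)) by (apply Rdiv_lt_0_compat; lra). nra. }
  assert (Z : D y = 0%C).
  { apply Cmod_eq_0. apply Rle_antisym; [|apply Cmod_ge_0].
    apply le_epsilon. intros eps He. rewrite Rplus_0_l.
    destruct (VD eps He) as [A HA]. set (u := Rmin y (- A)).
    rewrite (derive_RC_zero_const D u y); [left; apply HA, Rmin_r | apply Rmin_l | easy]. }
  unfold D in Z.
  set (B := line_int_exp_div full_kern c y) in *. set (L := Clog (exp y + Cexp w0)) in *.
  replace B with ((B + (L * L - w0 * w0)) - (L * L - w0 * w0))%C by ring. rewrite Z. ring.
Qed.

Fixpoint dirichlet_sum (n : nat) (s : C) : C :=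
  match n with
  | O => 0%C
  | S k => (dirichlet_sum k s + Cexp (ln (INR (S k)) * (s - 1)))%C
  end.

(* Euler-Maclaurin approximation of [zeta (1 - s)]. *)
Definition zeta_approx (n : nat) (s : C) : C :=
  (dirichlet_sum n s - Cexp (ln (INR n) * s) * / s)%C.

Fixpoint log_sum (z : C) (n : nat) : C :=
  match n with
  | O => 0%C
  | S k => (log_sum z k + Clog (INR (S k) + z) / (INR (S k) + z))%C
  end.

Lemma exp_ln_line (x : R) (t : R) : 0 < x ->
  Cexp (ln x * ((c, t) - 1)) = (/ x * Cexp (ln x * (c, t)))%C.
Proof.
  intros Hx.
  replace (ln x * ((c, t) - 1))%C with (- (ln x) + ln x * (c, t))%C by ring.
  rewrite Cexp_plus, Cexp_opp, Cexp_RtoC, exp_ln by easy. reflexivity.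
Qed.

Lemma poly_bounded_dirichlet_sum (n : nat) : poly_bounded (fun t => dirichlet_sum n (c, t)).
Proof.
  induction n as [|n IH]; [exact (poly_bounded_const 0%C)|].
  cbn [dirichlet_sum]. apply poly_bounded_plus; [exact IH|].
  eapply poly_bounded_ext; [intros t; symmetry; apply exp_ln_line, lt_0_INR; lia|].
  apply poly_bounded_mult; [apply poly_bounded_const | apply poly_bounded_exp_line].
Qed.

Lemma poly_bounded_zeta_approx (n : nat) : poly_bounded (fun t => zeta_approx n (c, t)).
Proof.
  unfold zeta_approx.
  apply poly_bounded_ext with (fun t => dirichlet_sum n (c, t) + (-1) * (Cexp (ln (INR n) * (c, t)) * / (c, t)))%C.
  { intros; ring. }
  apply poly_bounded_plus; [apply poly_bounded_dirichlet_sum|].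
  apply poly_bounded_mult; [apply poly_bounded_const|]. apply poly_bounded_mult; [apply poly_bounded_exp_line | apply poly_bounded_inv_line; lra].
Qed.

Lemma line_int_dirichlet_sum (n : nat) :
  line_int (fun t => full_kern t * dirichlet_sum n (c, t))%C = (- 2 * log_sum (Cexp w0) n)%C.
Proof.
  assert (Dg := decaying_full_kern). induction n as [|n IH].
  - cbn. rewrite (line_int_ext _ (fun t => 0 * full_kern t)%C) by (intros; ring). rewrite line_int_scal by easy. ring.
  - assert (Hx : 0 < INR (S n)) by (apply lt_0_INR; lia).
    rewrite (line_int_ext _ (fun t => full_kern t * dirichlet_sum n (c, t) +
       / INR (S n) * (full_kern t * Cexp (ln (INR (S n)) * (c, t))))%C).
    + rewrite line_int_plus, line_int_scal, IH.
      * change (line_int (fun t => (full_kern t * Cexp (ln (INR (S n)) * (c, t)))%C)) with (line_int_exp full_kern c (ln (INR (S n)))).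
        rewrite line_int_exp_full_kern.
        assert (N := exp_plus_Cexp_neq_0 w0 Hw (ln (INR (S n)))).
        cbn [log_sum]. rewrite exp_ln in N |- * by easy.
        field. split; [exact N | apply INR_S_C].
      * now apply decaying_line_int_exp.
      * apply decaying_mult; [easy | apply poly_bounded_dirichlet_sum].
      * apply decaying_ext with (fun t => (full_kern t * Cexp (ln (INR (S n)) * (c, t))) * / INR (S n))%C;
          [intros; ring|]. apply decaying_mult; [now apply decaying_line_int_exp | apply poly_bounded_const].
    + intros t. cbn [dirichlet_sum]. rewrite exp_ln_line by easy. ring.
Qed.

Lemma line_int_zeta_approx (n : nat) :
  line_int (fun t => full_kern t * zeta_approx (S n) (c, t))%C =
  (- 2 * log_sum (Cexp w0) (S n) + Clog (INR (S n) + Cexp w0) * Clog (INR (S n) + Cexp w0)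
   - w0 * w0)%C.
Proof.
  assert (Dg := decaying_full_kern).
  assert (Hx : 0 < INR (S n)) by (apply lt_0_INR; lia).
  rewrite (line_int_ext _ (fun t => full_kern t * dirichlet_sum (S n) (c, t) -
     full_kern t * (Cexp (ln (INR (S n)) * (c, t)) * / (c, t)))%C).
  - rewrite line_int_minus, line_int_dirichlet_sum.
    + change (line_int (fun t => (full_kern t * (Cexp (ln (INR (S n)) * (c, t)) * / (c, t)))%C))
        with (line_int_exp_div full_kern c (ln (INR (S n)))).
      rewrite line_int_exp_div_full_kern, exp_ln by easy. ring.
    + apply decaying_mult; [easy | apply poly_bounded_dirichlet_sum].
    + apply decaying_line_int_exp_div; [lra | easy].
  - intros t. unfold zeta_approx. ring.
Qed.

(** Stands for [s -> zeta (1 - s)]. The error has the rate [(n + 1)^(c-1)], uniformly in [t] up to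
    the weight [|s - 1|], which the kernel absorbs. *)
Variable Z : C -> C.
Hypothesis HZ : exists A, forall n t,
  Cmod (Z (c, t) - zeta_approx (S n) (c, t)) <= A * exp (- (1 - c) * ln (INR (S n))) * Cmod ((c, t) - 1).

Lemma decaying_full_kern_Z : decaying (fun t => full_kern t * Z (c, t))%C.
Proof.
  destruct HZ as [A HA]. apply decaying_mult; [apply decaying_full_kern|].
  apply (poly_bounded_of_approx _ (fun n t => zeta_approx (S n) (c, t)) (fun t => (c, t) - 1)%C
     (fun n => A * exp (- (1 - c) * ln (INR (S n))))).
  - apply poly_bounded_line_minus.
  - intros n. apply poly_bounded_zeta_approx.
  - rewrite <- (Rmult_0_r A). apply is_lim_seq_scal_l with (lu := Finite 0).
    apply (is_lim_seq_ext (fun n => 1 * exp (- (1 - c) * ln (INR (S n))))); [intros; ring|].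
    apply is_lim_seq_power_decay; lra.
  - exact HA.
Qed.

(** The error of the approximation is dominated on the line and disappears in the limit. It is kept
    for every [w0]: besides [w0 = log z], the value [w0 = 0] yields the Stieltjes constant. *)
Lemma line_int_zeta_lim :
  Clim (fun n => - 2 * log_sum (Cexp w0) (S n) + Clog (INR (S n) + Cexp w0) * Clog (INR (S n) + Cexp w0)
   - w0 * w0)%C (line_int (fun t => full_kern t * Z (c, t))%C).
Proof.
  assert (Dg := decaying_full_kern).
  assert (Dl : decaying (fun t => full_kern t * ((c, t) - 1))%C) by (apply decaying_mult; [easy | apply poly_bounded_line_minus]).
  destruct (line_int_dominated _ Dl) as [K [HK HL]]. destruct HZ as [A HA].
  apply Clim_squeeze with (v := fun n => Rabs A * K * exp (- (1 - c) * ln (INR (S n)))) (N0 := O).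
  { apply is_lim_seq_power_decay; [lra|]. apply Rmult_le_pos; [apply Rabs_pos | easy]. }
  intros n _. rewrite <- line_int_zeta_approx, Cmod_minus_sym, <- line_int_minus.
  - replace (Rabs A * K * exp (- (1 - c) * ln (INR (S n)))) with
      (Rabs A * exp (- (1 - c) * ln (INR (S n))) * K) by ring.
    apply HL.
    + intros t. apply ccont_minus; [apply (proj1 decaying_full_kern_Z)|].
      apply (proj1 (decaying_mult _ _ Dg (poly_bounded_zeta_approx (S n)))).
    + apply Rmult_le_pos; [apply Rabs_pos | left; apply exp_pos].
    + intros t. replace (full_kern t * Z (c, t) - full_kern t * zeta_approx (S n) (c, t))%C
        with (full_kern t * (Z (c, t) - zeta_approx (S n) (c, t)))%C by ring.
      rewrite !Cmod_mult. specialize (HA n t).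
      rewrite <- Rmult_assoc, (Rmult_comm _ (Cmod (full_kern t))), Rmult_assoc.
      apply Rmult_le_compat_l; [apply Cmod_ge_0|]. apply Rle_trans with (1 := HA).
      apply Rmult_le_compat_r; [apply Cmod_ge_0|].
      apply Rmult_le_compat_r; [left; apply exp_pos | apply Rle_abs].
  - apply decaying_full_kern_Z.
  - apply decaying_mult; [easy | apply poly_bounded_zeta_approx].
Qed.

End FullKernel.

(** * The digamma function *)

Lemma C_derive_of_quadratic (f : C -> C) (s l : C) (K r : R) : 0 < r ->
  (forall h, Cmod h < r -> Cmod (f (s + h)%C - f s - h * l) <= K * Cmod h ^ 2) ->
  C_derive f s = l.
Proof.
  intros Hr H. apply is_C_derive_unique. split.
  - apply (is_linear_scal_l (K := C_AbsRing) (V := C_NormedModule)).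
  - intros x Hx.
    assert (Ex : s = x) by (apply (is_filter_lim_locally_unique (K := C_AbsRing) (V := AbsRing_NormedModule C_AbsRing)); exact Hx).
    subst x. intros eps.
    assert (He : 0 < Rmin r (eps / (Rabs K + 1))).
    { apply Rmin_pos; [easy|]. apply Rdiv_lt_0_compat; [apply cond_pos|].
      generalize (Rabs_pos K); lra. }
    exists (mkposreal _ He). intros y Hy.
    change (Cmod (y - s) < Rmin r (eps / (Rabs K + 1))) in Hy.
    change (Cmod (f y - f s - (y - s) * l) <= eps * Cmod (y - s)).
    assert (H1 : Cmod (y - s) < r) by (apply Rlt_le_trans with (1 := Hy), Rmin_l).
    assert (H2 : Cmod (y - s) < eps / (Rabs K + 1)) by (apply Rlt_le_trans with (1 := Hy), Rmin_r).
    specialize (H (y - s)%C H1).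
    assert (Ey : @eq C (s + (y - s))%C y) by (apply C_ext; cbn; ring). rewrite Ey in H.
    apply Rle_trans with (1 := H).
    assert (P := Cmod_ge_0 (y - s)). assert (KP := Rabs_pos K). assert (KL := Rle_abs K).
    assert (eps / (Rabs K + 1) * (Rabs K + 1) = eps) by (field; lra).
    cbn. rewrite Rmult_1_r, <- Rmult_assoc. apply Rmult_le_compat_r; [easy|]. nra.
Qed.

Lemma Clim_unique (u : nat -> C) (a b : C) : Clim u a -> Clim u b -> a = b.
Proof. intros Ha Hb. now rewrite <- (Clim_seq_unique u a), <- (Clim_seq_unique u b). Qed.

Lemma Clim_plus (u v : nat -> C) (a b : C) : Clim u a -> Clim v b ->
  Clim (fun n => u n + v n)%C (a + b)%C.
Proof.
  intros Ha Hb eps He. destruct (Ha (eps / 2)) as [N HN]; [lra|].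
  destruct (Hb (eps / 2)) as [M HM]; [lra|]. exists (Nat.max N M). intros n Hn.
  specialize (HN n ltac:(lia)). specialize (HM n ltac:(lia)).
  replace (u n + v n - (a + b))%C with ((u n - a) + (v n - b))%C by ring.
  eapply Rle_lt_trans; [apply Cmod_triangle|]. lra.
Qed.

Lemma Clim_const (a : C) : Clim (fun _ => a) a.
Proof.
  intros eps He. exists O. intros n _. replace (a - a)%C with (RtoC 0) by ring. now rewrite Cmod_0.
Qed.

Lemma Clim_mult (u v : nat -> C) (a b : C) : Clim u a -> Clim v b ->
  Clim (fun n => u n * v n)%C (a * b)%C.
Proof.
  intros Ha Hb eps He.
  assert (Pa := Cmod_ge_0 a). assert (Pb := Cmod_ge_0 b).
  set (D := Cmod a + Cmod b + 1). assert (HD : 0 < D) by (unfold D; lra).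
  set (e := Rmin 1 (eps / (2 * D))).
  assert (Hq : 0 < eps / (2 * D)) by (apply Rdiv_lt_0_compat; lra).
  assert (He1 : 0 < e) by (apply Rmin_pos; lra).
  assert (E1 : e <= 1) by apply Rmin_l. assert (E2 : e <= eps / (2 * D)) by apply Rmin_r.
  destruct (Ha e He1) as [N HN]. destruct (Hb e He1) as [M HM].
  exists (Nat.max N M). intros n Hn. specialize (HN n ltac:(lia)). specialize (HM n ltac:(lia)).
  replace (u n * v n - a * b)%C with ((u n - a) * (v n - b) + ((u n - a) * b + a * (v n - b)))%C by ring.
  eapply Rle_lt_trans; [apply Cmod_triangle|].
  assert (T := Cmod_triangle ((u n - a) * b) (a * (v n - b))).
  rewrite !Cmod_mult in T. rewrite Cmod_mult.
  assert (Q1 := Cmod_ge_0 (u n - a)). assert (Q2 := Cmod_ge_0 (v n - b)).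
  assert (eps / (2 * D) * D = eps / 2) by (field; lra).
  assert (Cmod (u n - a) * Cmod (v n - b) <= e * 1) by (apply Rmult_le_compat; lra).
  assert (Cmod (u n - a) * Cmod b <= e * Cmod b) by (apply Rmult_le_compat_r; lra).
  assert (Cmod a * Cmod (v n - b) <= Cmod a * e) by (apply Rmult_le_compat_l; lra).
  assert (e * D <= eps / 2) by (rewrite <- H; apply Rmult_le_compat_r; lra).
  unfold D in *. nra.
Qed.

Lemma Clim_ext_loc (u v : nat -> C) (a : C) (N : nat) :
  (forall n, (N <= n)%nat -> u n = v n) -> Clim u a -> Clim v a.
Proof.
  intros H Ha eps He. destruct (Ha eps He) as [M HM]. exists (Nat.max N M). intros n Hn.
  rewrite <- H by lia. apply HM. lia.
Qed.

Lemma Clim_Cexp (u : nat -> C) (a : C) : Clim u a -> Clim (fun n => Cexp (u n)) (Cexp a).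
Proof.
  intros Ha eps He.
  assert (Hc : ccont (fun z : C_UniformSpace => Cexp z) (a : C_UniformSpace)) by apply ccont_Cexp, ccont_idC.
  destruct (ccont_locally _ _ _ Hc He) as [d Hd].
  destruct (Ha d (cond_pos d)) as [N HN]. exists N. intros n Hn. specialize (HN n Hn).
  apply Hd. split.
  - change (Rabs (fst (u n - a)%C) < d). apply Rle_lt_trans with (2 := HN), fst_le_Cmod.
  - change (Rabs (snd (u n - a)%C) < d). apply Rle_lt_trans with (2 := HN), snd_le_Cmod.
Qed.

Lemma Clim_Cmod_le (u : nat -> C) (a : C) (B : R) (N : nat) : Clim u a ->
  (forall n, (N <= n)%nat -> Cmod (u n) <= B) -> Cmod a <= B.
Proof.
  intros Ha H. apply le_epsilon. intros eps He. destruct (Ha eps He) as [M HM].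
  specialize (HM (Nat.max N M) ltac:(lia)). specialize (H (Nat.max N M) ltac:(lia)).
  set (n := Nat.max N M) in *. replace a with (u n + - (u n - a))%C by ring.
  eapply Rle_trans; [apply Cmod_triangle|]. rewrite Cmod_opp. lra.
Qed.

Lemma Clim_RtoC (u : nat -> R) (a : R) : is_lim_seq u a -> Clim (fun n => RtoC (u n)) (RtoC a).
Proof.
  intros H eps He. destruct (proj2 (is_lim_seq_spec _ _) H (mkposreal eps He)) as [N HN].
  exists N. intros n Hn. rewrite <- RtoC_minus, Cmod_R. now apply HN.
Qed.

Lemma ln_le_sub_1 (x : R) : 0 < x -> ln x <= x - 1.
Proof.
  intros Hx. destruct (Req_dec (ln x) 0) as [E|N].
  - rewrite E. rewrite <- (exp_ln x) by easy. rewrite E, exp_0. lra.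
  - assert (H := exp_ineq1 (ln x) N). rewrite exp_ln in H by easy. lra.
Qed.

Lemma ln_succ_bounds (n : nat) :
  / INR (S (S n)) <= ln (INR (S (S n))) - ln (INR (S n)) <= / INR (S n).
Proof.
  assert (H1 : 0 < INR (S n)) by (apply lt_0_INR; lia).
  assert (H2 : INR (S (S n)) = INR (S n) + 1) by apply S_INR.
  set (x := INR (S n)) in *. rewrite H2. split.
  - assert (H := ln_le_sub_1 (x / (x + 1)) ltac:(apply Rdiv_lt_0_compat; lra)).
    unfold Rdiv in H at 1. rewrite ln_mult, ln_Rinv in H by (try apply Rinv_0_lt_compat; lra).
    replace (x / (x + 1) - 1) with (- / (x + 1)) in H by (field; lra). lra.
  - assert (H := ln_le_sub_1 ((x + 1) / x) ltac:(apply Rdiv_lt_0_compat; lra)).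
    unfold Rdiv in H at 1. rewrite ln_mult, ln_Rinv in H by (try apply Rinv_0_lt_compat; lra).
    replace ((x + 1) / x - 1) with (/ x) in H by (field; lra). lra.
Qed.

(** * Euler's constant and the series of the digamma function *)

Definition harm (n : nat) : R := sum_n_m (fun j => / INR j) 1 n.

Lemma harm_0 : harm 0 = 0.
Proof. unfold harm. now rewrite sum_n_m_zero by lia. Qed.

Lemma harm_S (n : nat) : harm (S n) = harm n + / INR (S n).
Proof. unfold harm. now rewrite sum_n_Sm by lia. Qed.

(** Monotonicity and positivity come from [ln_succ_bounds], which starts at 1; the value at index 0,
    where the logarithm is a default, is therefore skipped. *)
Lemma is_lim_euler_gamma : is_lim_seq (fun n => harm n - ln (INR n)) euler_gamma.
Proof.
  assert (E : ex_finite_lim_seq (fun n => harm n - ln (INR n))).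
  { cut (ex_finite_lim_seq (fun n => harm (S n) - ln (INR (S n)))).
    { intros [l Hl]. exists l. now apply is_lim_seq_incr_1. }
    apply ex_finite_lim_seq_decr with (M := 0).
    - intros n. rewrite (harm_S (S n)). generalize (ln_succ_bounds n). lra.
    - intros n.
      assert (X : forall n, ln (INR (S n)) <= harm n).
      { clear. intros n. induction n as [|n IH].
        - change (ln 1 <= harm 0). rewrite ln_1, harm_0. lra.
        - rewrite harm_S. generalize (ln_succ_bounds n). lra. }
      specialize (X n). rewrite harm_S.
      assert (0 < / INR (S n)) by (apply Rinv_0_lt_compat, lt_0_INR; lia). lra. }
  destruct E as [l Hl].
  assert (El : euler_gamma = l) by (unfold euler_gamma; fold harm; exact (f_equal real (is_lim_seq_unique _ _ Hl))).
  now rewrite El.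
Qed.

Lemma Cmod_shift_lower (s : C) (n : nat) : 0 < Re s -> Re s + INR n <= Cmod (s + INR n).
Proof.
  intros Hs. apply Rle_trans with (2 := re_le_Cmod _).
  replace (Re (s + INR n)%C) with (Re s + INR n) by reflexivity. apply Rle_abs.
Qed.

Lemma shift_neq_0 (s : C) (n : nat) : 0 < Re s -> (s + INR n)%C <> RtoC 0.
Proof.
  intros Hs. apply Cmod_gt_0. generalize (Cmod_shift_lower s n Hs) (pos_INR n). lra.
Qed.

(** The n-th term equals [(s - 1) / ((n + 1) (s + n))], and [|s + n| >= n] bounds it by
    [|s - 1| (1/n - 1/(n+1))]. *)
Lemma phi_sum_cv (s : C) : 0 < Re s -> exists l, Clim (fun n => phi_sum n s) l /\
  forall n, Cmod (l - phi_sum (S n) s) <= / INR (S n) * Cmod (s - 1).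
Proof.
  intros Hs.
  destruct (Clim_of_telescoping (fun n => phi_sum n s) (fun n => Cmod (s - 1) * / INR n) 1) as [l [H1 H2]].
  - rewrite <- (Rmult_0_r (Cmod (s - 1))). apply is_lim_seq_scal_l with (lu := Finite 0).
    apply (is_lim_seq_inv _ p_infty); [apply is_lim_seq_INR | easy].
  - intros n Hn. cbn [phi_sum].
    assert (N1 := shift_neq_0 s n Hs). assert (N2 := INR_S_C n).
    assert (L := Cmod_shift_lower s n Hs).
    assert (Hn0 : 0 < INR n) by (apply lt_0_INR; lia).
    assert (Hn1 : INR (S n) = INR n + 1) by apply S_INR.
    replace (phi_sum n s + (/ INR (S n) - / (s + INR n)) - phi_sum n s)%C
      with ((s - 1) / (INR (S n) * (s + INR n)))%C.
    2:{ rewrite Hn1, RtoC_plus in N2 |- *. field. split; easy. }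
    rewrite Cmod_div by now apply Cmult_neq_0.
    rewrite Cmod_mult, Cmod_R, (Rabs_pos_eq (INR (S n))) by lra.
    replace (Cmod (s - 1) * / INR n - Cmod (s - 1) * / INR (S n)) with
      (Cmod (s - 1) / (INR (S n) * INR n)) by (rewrite Hn1; field; lra).
    apply Rmult_le_compat_l; [apply Cmod_ge_0|]. apply Rinv_le_contravar.
    + apply Rmult_lt_0_compat; lra.
    + apply Rmult_le_compat_l; lra.
  - exists l. split; [easy|]. intros n. rewrite Cmod_minus_sym, Rmult_comm. apply H2. lia.
Qed.

(** A logarithm of the quotient of the rising factorials at [s + h] and [s], with one principal
    logarithm per factor; only its exponential and its expansion in [h] matter. *)
Fixpoint lgsum (s h : C) (n : nat) : C :=
  match n with
  | O => Clog (1 + h / s)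
  | S m => (lgsum s h m + Clog (1 + h / (s + INR (S m))))%C
  end.

Lemma Crising_shift (s h : C) (n : nat) : 0 < Re s -> 0 < Re (s + h)%C ->
  Crising (s + h) n = (Crising s n * Cexp (lgsum s h n))%C.
Proof.
  intros Hs Hh.
  assert (T : forall n, (1 + h / (s + INR n))%C <> RtoC 0).
  { intros m H. assert (N := shift_neq_0 s m Hs). apply (shift_neq_0 _ m Hh).
    replace (s + h + INR m)%C with ((1 + h / (s + INR m)) * (s + INR m))%C by (field; easy).
    rewrite H. ring. }
  induction n as [|n IH].
  - cbn [Crising lgsum]. assert (N := shift_neq_0 s 0 Hs). assert (T0 := T O).
    replace (s + INR 0)%C with s in N, T0 by (cbn; ring).
    rewrite Cexp_Clog by easy. field. easy.
  - change (Crising (s + h) (S n)) with (Crising (s + h) n * (s + h + INR (S n)))%C.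
    change (Crising s (S n)) with (Crising s n * (s + INR (S n)))%C.
    change (lgsum s h (S n)) with (lgsum s h n + Clog (1 + h / (s + INR (S n))))%C.
    rewrite IH, Cexp_plus, (Cexp_Clog (1 + h / (s + INR (S n)))) by apply T.
    field. now apply shift_neq_0.
Qed.

Lemma Crising_neq_0 (s : C) (n : nat) : 0 < Re s -> Crising s n <> RtoC 0.
Proof.
  intros Hs. induction n as [|n IH].
  - cbn. intros ->. cbn in Hs. lra.
  - change (Crising s (S n)) with (Crising s n * (s + INR (S n)))%C.
    apply Cmult_neq_0; [easy | now apply shift_neq_0].
Qed.

Definition euler_term (s : C) (n : nat) : C :=
  (INR (fact n) * Cpower (INR n) s / Crising s n)%C.

Lemma Clog_RtoC (x : R) : 0 < x -> Clog (RtoC x) = RtoC (ln x).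
Proof.
  intros Hx. rewrite <- (exp_ln x Hx) at 1. rewrite <- Cexp_RtoC. apply Clog_Cexp.
  cbn. generalize PI_RGT_0. lra.
Qed.

Lemma euler_term_shift (s h : C) (n : nat) : 0 < Re s -> 0 < Re (s + h)%C ->
  euler_term (s + h) (S n) =
  (euler_term s (S n) * Cexp (h * ln (INR (S n)) - lgsum s h (S n)))%C.
Proof.
  intros Hs Hh. unfold euler_term, Cpower.
  rewrite Crising_shift, Clog_RtoC by (easy || apply lt_0_INR; lia).
  rewrite Cmult_plus_distr_r, Cexp_plus, Cexp_minus. field.
  split; [apply Cexp_neq_0 | now apply Crising_neq_0].
Qed.

(** The logarithmic derivative of [Crising s n], which is also the coefficient of [h] in [lgsum]. *)
Fixpoint inv_sum (s : C) (n : nat) : C :=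
  match n with
  | O => (/ s)%C
  | S m => (inv_sum s m + / (s + INR (S m)))%C
  end.

Lemma inv_sum_phi (s : C) (n : nat) : inv_sum s n = (harm (S n) - phi_sum (S n) s)%C.
Proof.
  induction n as [|n IH].
  - change (/ s = harm 1 - (0 + (/ INR 1 - / (s + INR 0))))%C.
    rewrite (harm_S 0), harm_0. change (INR 1) with 1. change (INR 0) with 0.
    rewrite Rplus_0_l, Rinv_1.
    replace (s + 0)%C with s by ring.
    assert (E : (/ RtoC 1)%C = RtoC 1) by (rewrite <- RtoC_inv, Rinv_1; [easy | lra]).
    rewrite E. ring.
  - change (inv_sum s (S n)) with (inv_sum s n + / (s + INR (S n)))%C.
    change (phi_sum (S (S n)) s) with (phi_sum (S n) s + (/ INR (S (S n)) - / (s + INR (S n))))%C.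
    rewrite IH, (harm_S (S n)), RtoC_plus, RtoC_inv; [ring|].
    apply not_0_INR. lia.
Qed.

(** The sequence is the logarithmic derivative of Euler's n-th term. By [inv_sum_phi] it is a
    partial sum of phi minus a harmonic sum compensated by the logarithm, up to one further harmonic
    term that tends to 0. *)
Lemma log_deriv_cv (s l : C) : Clim (fun n => phi_sum n s) l ->
  Clim (fun n => ln (INR (S n)) - inv_sum s (S n))%C (l - euler_gamma)%C.
Proof.
  intros Hl.
  assert (G := is_lim_euler_gamma).
  assert (G2 : is_lim_seq (fun n => - (harm (S n) - ln (INR (S n))) - / INR (S (S n))) (- euler_gamma - 0)).
  { apply is_lim_seq_minus'.
    - apply is_lim_seq_opp with (l := Finite euler_gamma). now apply is_lim_seq_incr_1 in G.
    - apply (is_lim_seq_incr_1 (fun n => / INR (S n))), is_lim_seq_inv_S. }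
  apply Clim_RtoC in G2.
  assert (Hl2 : Clim (fun n => phi_sum (S (S n)) s) l).
  { intros eps He. destruct (Hl eps He) as [N HN]. exists N. intros n Hn. apply HN. lia. }
  assert (H := Clim_plus _ _ _ _ Hl2 G2).
  replace (l - euler_gamma)%C with (l + RtoC (- euler_gamma - 0))%C
    by (rewrite RtoC_minus, RtoC_opp; ring).
  apply Clim_ext_loc with (2 := H) (N := O). intros n _.
  rewrite inv_sum_phi, (harm_S (S n)), !RtoC_minus, RtoC_opp, RtoC_minus, RtoC_plus. ring.
Qed.

Lemma inv_sqr_sum_bound (sg : R) (n : nat) : 0 < sg ->
  sum_n (fun j => / (sg + INR j) ^ 2) n <= / sg ^ 2 + / sg - / (sg + INR n).
Proof.
  intros Hs. induction n as [|n IH].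
  - rewrite sum_O. cbn [INR]. rewrite Rplus_0_r. lra.
  - rewrite sum_Sn. change plus with Rplus. rewrite S_INR.
    assert (P := pos_INR n).
    assert (/ (sg + (INR n + 1)) ^ 2 <= / (sg + INR n) - / (sg + (INR n + 1))).
    { replace (/ (sg + INR n) - / (sg + (INR n + 1))) with (/ ((sg + INR n) * (sg + (INR n + 1)))) by (field; lra).
      apply Rinv_le_contravar; nra. }
    lra.
Qed.

(** For [|h| <= Re s / 2] every [h / (s + j)] lies in the disc of [Clog_taylor_1]. With
    [inv_sqr_sum_bound] the estimate is uniform in [n]. *)
Lemma lgsum_quadratic (s h : C) (n : nat) : 0 < Re s -> Cmod h <= Re s / 2 ->
  Cmod (lgsum s h n - h * inv_sum s n) <= Cmod h ^ 2 * sum_n (fun j => / (Re s + INR j) ^ 2) n.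
Proof.
  intros Hs Hh.
  assert (T : forall j, Cmod (Clog (1 + h / (s + INR j)) - h / (s + INR j)) <= Cmod h ^ 2 * / (Re s + INR j) ^ 2).
  { intros j. assert (N := shift_neq_0 s j Hs). assert (L := Cmod_shift_lower s j Hs).
    assert (P := pos_INR j).
    assert (M : Cmod (h / (s + INR j)) <= Cmod h * / (Re s + INR j)).
    { rewrite Cmod_div by easy. apply Rmult_le_compat_l; [apply Cmod_ge_0|].
      apply Rinv_le_contravar; lra. }
    assert (B : Cmod h * / (Re s + INR j) <= / 2).
    { apply Rmult_le_reg_r with (Re s + INR j); [lra|]. rewrite Rmult_assoc, Rinv_l; lra. }
    eapply Rle_trans; [apply Clog_taylor_1; lra|].
    rewrite <- pow_inv, <- Rpow_mult_distr. apply pow_incr. split; [apply Cmod_ge_0 | exact M]. }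
  induction n as [|n IH].
  - cbn [lgsum inv_sum]. rewrite sum_O. specialize (T O). replace (s + INR 0)%C with s in T by (cbn; ring).
    exact T.
  - rewrite sum_Sn. change plus with Rplus. cbn [lgsum inv_sum].
    specialize (T (S n)).
    replace (lgsum s h n + Clog (1 + h / (s + INR (S n))) - h * (inv_sum s n + / (s + INR (S n))))%C
      with ((lgsum s h n - h * inv_sum s n) + (Clog (1 + h / (s + INR (S n))) - h / (s + INR (S n))))%C
      by (unfold Cdiv; ring).
    eapply Rle_trans; [apply Cmod_triangle|]. rewrite Rmult_plus_distr_l. lra.
Qed.

(** Only the base point 1 is considered, but with [h] arbitrary: from [n + 1 > 2 |h|] on, the terms
    are at most [|h|^2 / (n + 2)^2], less than the decrease of [|h|^2 / (n + 1)]. *)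
Lemma lgsum_cv (h : C) : exists l, Clim (fun n => lgsum 1 h n - h * inv_sum 1 n)%C l.
Proof.
  destruct (nfloor_ex (2 * Cmod h)) as [N HN]; [generalize (Cmod_ge_0 h); lra|].
  destruct (Clim_of_telescoping (fun n => lgsum 1 h n - h * inv_sum 1 n)%C
    (fun n => Cmod h ^ 2 * / INR (S n)) N) as [l [Hl _]]; [| |now exists l].
  - rewrite <- (Rmult_0_r (Cmod h ^ 2)). apply is_lim_seq_scal_l with (lu := Finite 0), is_lim_seq_inv_S.
  - intros n Hn. cbn [lgsum inv_sum].
    replace (lgsum 1 h n + Clog (1 + h / (1 + INR (S n))) - h * (inv_sum 1 n + / (1 + INR (S n))) -
      (lgsum 1 h n - h * inv_sum 1 n))%C
      with (Clog (1 + h / (1 + INR (S n))) - h / (1 + INR (S n)))%C by (unfold Cdiv; ring).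
    replace (1 + INR (S n))%C with (RtoC (INR (S (S n)))) by (rewrite (S_INR (S n)), RtoC_plus; ring).
    assert (S1 := S_INR n). assert (S2 := S_INR (S n)). assert (P := pos_INR n).
    apply le_INR in Hn.
    assert (M : Cmod (h / INR (S (S n))) = Cmod h * / INR (S (S n))).
    { rewrite Cmod_div, Cmod_R, Rabs_pos_eq by (lra || apply INR_S_C). reflexivity. }
    eapply Rle_trans.
    + apply Clog_taylor_1. rewrite M. apply Rmult_le_reg_r with (INR (S (S n))); [lra|].
      rewrite Rmult_assoc, Rinv_l; lra.
    + rewrite M, Rpow_mult_distr, <- Rmult_minus_distr_l. apply Rmult_le_compat_l; [apply pow2_ge_0|].
      replace (/ INR (S n) - / INR (S (S n))) with (/ (INR (S n) * INR (S (S n)))) by (rewrite S2; field; lra).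
      rewrite pow_inv. apply Rinv_le_contravar; nra.
Qed.

Lemma euler_term_1 (n : nat) : euler_term 1 (S n) = (INR (S n) * / INR (S (S n)))%C.
Proof.
  unfold euler_term, Cpower. assert (Hp : 0 < INR (S n)) by (apply lt_0_INR; lia).
  rewrite Clog_RtoC, Cmult_1_l, Cexp_RtoC, exp_ln by easy.
  assert (E : forall m, Crising 1 m = RtoC (INR (fact (S m)))).
  { induction m as [|m IH]; [reflexivity|].
    change (Crising 1 (S m)) with (Crising 1 m * (1 + INR (S m)))%C.
    rewrite IH, (fact_simpl (S m)), mult_INR, (S_INR (S m)), RtoC_mult, RtoC_plus. ring. }
  rewrite E, (fact_simpl (S n)), mult_INR, RtoC_mult. field.
  split; [apply INR_S_C | apply INR_fact_C].
Qed.

(** With [s = 1 + h], Euler's term at [s] is the one at 1, namely [(n + 1) / (n + 2)], times an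
    exponential whose exponent converges; hence the limit exists and is not 0. *)
Lemma euler_term_cv (s : C) : 0 < Re s ->
  exists g, Clim (fun n => euler_term s (S n)) g /\ g <> RtoC 0.
Proof.
  intros Hs.
  set (h := (s - 1)%C).
  destruct (lgsum_cv h) as [l Hl].
  destruct (phi_sum_cv 1%C ltac:(cbn; lra)) as [p [Hp _]].
  assert (L := log_deriv_cv 1%C p Hp).
  exists (1 * Cexp (h * (p - euler_gamma) + (-1) * l))%C. split.
  2:{ apply Cmult_neq_0; [|apply Cexp_neq_0]. intros H; apply RtoC_inj in H; lra. }
  apply Clim_ext_loc with (u := fun n => (RtoC (1 - / INR (S (S n))) *
    Cexp (h * (ln (INR (S n)) - inv_sum 1 (S n)) + (-1) * (lgsum 1 h (S n) - h * inv_sum 1 (S n))))%C) (N := O).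
  - intros n _. replace s with (1 + h)%C by (unfold h; ring).
    rewrite euler_term_shift by (cbn; unfold h; cbn; unfold Re in Hs; lra).
    rewrite euler_term_1. f_equal.
    + rewrite <- RtoC_inv, <- RtoC_mult by (apply not_0_INR; lia). f_equal.
      rewrite (S_INR (S n)). field. generalize (pos_INR (S n)). lra.
    + f_equal. ring.
  - apply Clim_mult.
    + assert (X : is_lim_seq (fun n => 1 - / INR (S (S n))) (1 - 0)).
      { apply (is_lim_seq_minus' (fun _ => 1) (fun n => / INR (S (S n))) 1 0);
          [apply is_lim_seq_const|].
        apply (is_lim_seq_incr_1 (fun n => / INR (S n))), is_lim_seq_inv_S. }
      rewrite Rminus_0_r in X. now apply Clim_RtoC.
    + apply Clim_Cexp, Clim_plus; apply Clim_mult; try apply Clim_const; try easy.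
      intros eps He. destruct (Hl eps He) as [N HN]. exists N. intros n Hn. apply HN. lia.
Qed.

Lemma CGamma_unique (s g : C) : Clim (fun n => euler_term s (S n)) g -> CGamma s = g.
Proof.
  intros H. apply Clim_seq_unique. intros eps He. destruct (H eps He) as [N HN].
  exists (S N). intros [|n] Hn; [lia|]. apply HN. lia.
Qed.

Lemma Clim_bounded (u : nat -> C) (a : C) : Clim u a -> exists B N, 0 <= B /\
  forall n, (N <= n)%nat -> Cmod (u n) <= B.
Proof.
  intros H. destruct (H 1 Rlt_0_1) as [N HN]. exists (Cmod a + 1), N.
  split; [generalize (Cmod_ge_0 a); lra|]. intros n Hn. specialize (HN n Hn).
  replace (u n) with (a + (u n - a))%C by ring. eapply Rle_trans; [apply Cmod_triangle|]. lra.
Qed.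

(* [euler_term (s + h) n / euler_term s n = exp (h L_n + O(h^2))] uniformly in [n],
   a second-order estimate that survives the pointwise limit. *)
Lemma digamma_eq (s l : C) : 0 < Re s -> Clim (fun n => phi_sum n s) l ->
  digamma s = (l - euler_gamma)%C.
Proof.
  intros Hs Hl. set (L := (l - euler_gamma)%C).
  assert (HL := log_deriv_cv s l Hl). fold L in HL.
  destruct (euler_term_cv s Hs) as [g [Hg Hg0]].
  assert (Eg := CGamma_unique s g Hg).
  destruct (Clim_bounded _ _ HL) as [B0 [N0 [HB0 HN0]]].
  set (sg := Re s) in *.
  set (Sm := / sg ^ 2 + / sg).
  assert (HSm : 0 < Sm).
  { unfold Sm. assert (0 < / sg) by now apply Rinv_0_lt_compat.
    assert (0 < / sg ^ 2) by (apply Rinv_0_lt_compat; nra). lra. }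
  (* [B] bounds the logarithm of the quotient of Euler's terms divided by [h], on the disc
     [|h| < sg / 2] and for large [n]; [Q] adds the quadratic errors of the exponential and of
     [lgsum]. *)
  set (B := B0 + sg / 2 * Sm). assert (HB : 0 <= B) by (unfold B; nra).
  set (Q := B ^ 2 * exp (sg / 2 * B) + Sm).
  assert (Key : forall h, Cmod h < sg / 2 -> Cmod (CGamma (s + h) - CGamma s - h * (g * L)) <= Q * Cmod g * Cmod h ^ 2).
  { intros h Hh.
    assert (Hsh : 0 < Re (s + h)%C).
    { assert (R1 := re_le_Cmod h). apply Rabs_le_between in R1.
      replace (Re (s + h)%C) with (sg + Re h) by reflexivity. lra. }
    destruct (euler_term_cv _ Hsh) as [g2 [Hg2 _]].
    rewrite (CGamma_unique _ _ Hg2), Eg.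
    set (Dl := fun n => (h * ln (INR (S n)) - lgsum s h (S n))%C).
    set (Ln := fun n => (ln (INR (S n)) - inv_sum s (S n))%C).
    assert (P := Cmod_ge_0 h).
    assert (X : forall n, (N0 <= n)%nat -> Cmod (Cexp (Dl n) - 1 - h * Ln n) <= Q * Cmod h ^ 2).
    { intros n Hn. specialize (HN0 n Hn). cbv beta in HN0. fold (Ln n) in HN0.
      assert (A1 : Cmod (Dl n - h * Ln n) <= Cmod h ^ 2 * Sm).
      { replace (Dl n - h * Ln n)%C with (- (lgsum s h (S n) - h * inv_sum s (S n)))%C
          by (unfold Dl, Ln; ring).
        rewrite Cmod_opp. eapply Rle_trans; [apply lgsum_quadratic; [easy | fold sg; lra]|].
        apply Rmult_le_compat_l; [apply pow2_ge_0|]. fold sg.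
        eapply Rle_trans; [now apply inv_sqr_sum_bound|].
        assert (0 < / (sg + INR (S n))).
        { apply Rinv_0_lt_compat. generalize (pos_INR (S n)). lra. }
        unfold Sm. lra. }
      assert (A2 : Cmod (Dl n) <= Cmod h * B).
      { replace (Dl n) with (h * Ln n + (Dl n - h * Ln n))%C by ring.
        eapply Rle_trans; [apply Cmod_triangle|]. rewrite Cmod_mult. unfold B.
        assert (Cmod h * Cmod (Ln n) <= Cmod h * B0) by (apply Rmult_le_compat_l; lra).
        assert (Cmod h ^ 2 * Sm <= Cmod h * (sg / 2 * Sm)).
        { cbn. rewrite Rmult_1_r, Rmult_assoc. apply Rmult_le_compat_l; [easy|].
          apply Rmult_le_compat_r; lra. }
        lra. }
      replace (Cexp (Dl n) - 1 - h * Ln n)%C with ((Cexp (Dl n) - 1 - Dl n) + (Dl n - h * Ln n))%C by ring.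
      eapply Rle_trans; [apply Cmod_triangle|]. unfold Q. rewrite Rmult_plus_distr_r.
      apply Rplus_le_compat; [|lra].
      eapply Rle_trans; [apply Cexp_quadratic|].
      assert (A3 := re_le_Cmod (Dl n)).
      replace (B ^ 2 * exp (sg / 2 * B) * Cmod h ^ 2) with ((Cmod h * B) ^ 2 * exp (sg / 2 * B)) by ring.
      apply Rmult_le_compat.
      - apply pow2_ge_0.
      - left; apply exp_pos.
      - apply pow_incr. split; [apply Cmod_ge_0 | easy].
      - apply exp_le. nra. }
    assert (LL : Clim (fun n => euler_term s (S n) * (Cexp (Dl n) - 1 - h * Ln n))%C (g2 - g - h * (g * L))%C).
    { replace (g2 - g - h * (g * L))%C with ((g2 + (-1) * g) + (- h) * (g * L))%C by ring.
      apply Clim_ext_loc with (u := fun n => ((euler_term (s + h) (S n) + (-1) * euler_term s (S n)) +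
        (- h) * (euler_term s (S n) * Ln n))%C) (N := O).
      - intros n _. rewrite euler_term_shift by easy. fold (Dl n). ring.
      - apply Clim_plus; [apply Clim_plus; [easy|]|]; apply Clim_mult; try apply Clim_const; try easy.
        now apply Clim_mult. }
    apply le_epsilon. intros eps He.
    set (e := eps / (Q * Cmod h ^ 2 + 1)).
    assert (HQ : 0 <= Q * Cmod h ^ 2).
    { apply Rmult_le_pos; [|apply pow2_ge_0]. unfold Q.
      assert (0 <= B ^ 2 * exp (sg / 2 * B)) by (apply Rmult_le_pos; [apply pow2_ge_0 | left; apply exp_pos]). lra. }
    assert (He1 : 0 < e) by (apply Rdiv_lt_0_compat; lra).
    destruct (Hg e He1) as [N1 HN1].
    apply (Clim_Cmod_le _ _ _ (Nat.max N0 N1) LL). intros n Hn. rewrite Cmod_mult.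
    specialize (X n ltac:(lia)). specialize (HN1 n ltac:(lia)).
    assert (G1 : Cmod (euler_term s (S n)) <= Cmod g + e).
    { replace (euler_term s (S n)) with (g + (euler_term s (S n) - g))%C by ring.
      eapply Rle_trans; [apply Cmod_triangle|]. lra. }
    apply Rle_trans with ((Cmod g + e) * (Q * Cmod h ^ 2)).
    + apply Rmult_le_compat; try apply Cmod_ge_0; easy.
    + assert (e * (Q * Cmod h ^ 2 + 1) = eps) by (unfold e; field; lra). nra. }
  unfold digamma. rewrite (C_derive_of_quadratic CGamma s (g * L)%C (Q * Cmod g) (sg / 2) ltac:(lra) Key), Eg.
  field. easy.
Qed.

Lemma phi_approx_digamma : phi_approx (fun s => euler_gamma + digamma s)%C.
Proof.
  intros s n Hs. destruct (phi_sum_cv s Hs) as [l [Hl H]].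
  rewrite (digamma_eq s l Hs Hl). replace (euler_gamma + (l - euler_gamma))%C with l by ring. apply H.
Qed.

(** * The zeta function in the critical strip *)

Fixpoint psum (a : nat -> C) (h : C) (n : nat) : C :=
  match n with
  | O => 0%C
  | S k => (psum a h k + a k * h ^ k)%C
  end.

Definition power_series_at (f : C -> C) (z0 : C) : Prop :=
  exists (a : nat -> C) (r : R), 0 < r /\
    forall h : C, Cmod h < r -> Clim (psum a h) (f (z0 + h)%C).

Lemma Clim_incr_1 (u : nat -> C) (l : C) : Clim (fun n => u (S n)) l <-> Clim u l.
Proof.
  split; intros H eps He; destruct (H eps He) as [N HN].
  - exists (S N). intros [|n] Hn; [lia|]. apply HN. lia.
  - exists N. intros n Hn. apply HN. lia.
Qed.

Lemma psum_S (a : nat -> C) (h : C) (n : nat) :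
  psum a h (S n) = (a O + h * psum (fun k => a (S k)) h n)%C.
Proof.
  induction n as [|n IH]; [cbn; ring|].
  change (psum a h (S (S n))) with (psum a h (S n) + a (S n) * h ^ S n)%C.
  rewrite IH. cbn. ring.
Qed.

(** Convergence at one point [h1] bounds the terms there by [B]; at [q h1] the terms of positive
    degree then add up to at most [2 B q]. The sum being 0, letting [q] tend to 0 leaves
    [a 0 = 0]. *)
Lemma power_series_vanishing_coef (a : nat -> C) (e : C) (x0 : R) : 0 < x0 -> e <> RtoC 0 ->
  (forall x : R, 0 < x < x0 -> Clim (psum a (x * e)) 0%C) -> a O = 0%C.
Proof.
  intros Hx0 He H. set (h1 := (RtoC (x0 / 2) * e)%C).
  assert (H1 := H (x0 / 2) ltac:(lra)). fold h1 in H1.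
  assert (Hh1 : 0 < Cmod h1).
  { unfold h1. rewrite Cmod_mult, Cmod_R, Rabs_pos_eq by lra.
    apply Rmult_lt_0_compat; [lra | now apply Cmod_gt_0]. }
  assert (HB : exists B, 0 <= B /\ forall k, Cmod (a k) * Cmod h1 ^ k <= B).
  (* Beyond [N] a term is the difference of two partial sums of modulus less than 1, whence the
     [+ 2]; the earlier terms are finitely many. *)
  { destruct (H1 1 Rlt_0_1) as [N HN].
    assert (X : forall m, exists B, 0 <= B /\ forall k, (k < m)%nat -> Cmod (a k) * Cmod h1 ^ k <= B).
    { induction m as [|m [B [HB0 HB]]]; [exists 0; split; [lra | lia]|].
      exists (Rmax B (Cmod (a m) * Cmod h1 ^ m)). split; [apply Rle_trans with (1 := HB0), Rmax_l|].
      intros k Hk. destruct (Nat.eq_dec k m) as [->|]; [apply Rmax_r|].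
      apply Rle_trans with (2 := Rmax_l _ _). apply HB. lia. }
    destruct (X N) as [B [HB0 HB]]. exists (B + 2). split; [lra|]. intros k.
    destruct (Nat.lt_ge_cases k N) as [L|G]; [specialize (HB k L); lra|].
    assert (A1 := HN k G). assert (A2 := HN (S k) ltac:(lia)). cbn [psum] in A2.
    rewrite <- Cmod_pow, <- Cmod_mult.
    replace (a k * h1 ^ k)%C with ((psum a h1 k + a k * h1 ^ k - 0) + - (psum a h1 k - 0))%C by ring.
    eapply Rle_trans; [apply Cmod_triangle|]. rewrite Cmod_opp. lra. }
  destruct HB as [B [HB0 HB]].
  apply Cmod_eq_0. apply Rle_antisym; [|apply Cmod_ge_0].
  apply le_epsilon. intros eps Heps. rewrite Rplus_0_l.
  set (q := Rmin (/ 2) (eps / (2 * B + 1))).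
  assert (Hd : 0 < eps / (2 * B + 1)) by (apply Rdiv_lt_0_compat; lra).
  assert (Hq0 : 0 < q) by (apply Rmin_pos; lra).
  assert (Hq1 : q <= / 2) by apply Rmin_l. assert (Hq2 : q <= eps / (2 * B + 1)) by apply Rmin_r.
  assert (Hc : Clim (psum a (q * h1)) 0%C).
  { replace (q * h1)%C with (RtoC (q * (x0 / 2)) * e)%C by (unfold h1; rewrite RtoC_mult; ring).
    apply H. split; nra. }
  (* The form [2 q (1 - q^n)] is preserved by induction because [q <= 1/2]. *)
  assert (T : forall n, Cmod (psum a (q * h1) (S n) - a O) <= B * (2 * q * (1 - q ^ n))).
  { induction n as [|n IH].
    - cbn. replace (0 + a O * 1 - a O)%C with (RtoC 0) by ring. rewrite Cmod_0. lra.
    - change (psum a (q * h1) (S (S n))) with (psum a (q * h1) (S n) + a (S n) * (q * h1) ^ S n)%C.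
      replace (psum a (q * h1) (S n) + a (S n) * (q * h1) ^ S n - a O)%C
        with ((psum a (q * h1) (S n) - a O) + a (S n) * (q * h1) ^ S n)%C by ring.
      eapply Rle_trans; [apply Cmod_triangle|].
      assert (E : Cmod (a (S n) * (q * h1) ^ S n) <= B * q ^ S n).
      { rewrite Cmod_mult, Cmod_pow, Cmod_mult, Cmod_R, Rabs_pos_eq, Rpow_mult_distr by lra.
        specialize (HB (S n)). assert (0 <= q ^ S n) by (apply pow_le; lra). nra. }
      assert (0 <= q ^ n) by (apply pow_le; lra). cbn [pow] in *.
      assert (0 <= q * q ^ n * (1 - 2 * q)) by (apply Rmult_le_pos; [apply Rmult_le_pos|]; lra).
      apply Rle_trans with (1 := Rplus_le_compat _ _ _ _ IH E).
      rewrite <- Rmult_plus_distr_l. apply Rmult_le_compat_l; [easy|]. lra. }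
  assert (L : Clim (fun n => psum a (q * h1) (S n) - a O)%C (0 - a O)%C).
  { unfold Cminus. apply Clim_plus; [|apply Clim_const]. now apply Clim_incr_1 in Hc. }
  assert (F : Cmod (0 - a O) <= 2 * B * q).
  { apply (Clim_Cmod_le _ _ _ O L). intros n _. eapply Rle_trans; [apply T|].
    assert (0 <= q ^ n) by (apply pow_le; lra).
    assert (0 <= B * q * q ^ n) by (apply Rmult_le_pos; [nra | easy]). lra. }
  replace (0 - a O)%C with (- a O)%C in F by ring. rewrite Cmod_opp in F.
  apply Rle_trans with (1 := F).
  assert (eps / (2 * B + 1) * (2 * B + 1) = eps) by (field; lra). nra.
Qed.

(** Once the constant term is 0, dividing by the variable shifts the coefficients and keeps the sum
    equal to 0. *)
Lemma power_series_vanishing (a : nat -> C) (e : C) (x0 : R) : 0 < x0 -> e <> RtoC 0 ->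
  (forall x : R, 0 < x < x0 -> Clim (psum a (x * e)) 0%C) -> forall k, a k = 0%C.
Proof.
  intros Hx0 He H k. revert a H. induction k as [|k IH]; intros a H.
  - now apply (power_series_vanishing_coef a e x0).
  - apply (IH (fun k => a (S k))). intros x Hx.
    assert (Z := power_series_vanishing_coef a e x0 Hx0 He H).
    assert (Hn : (x * e)%C <> RtoC 0) by (apply Cmult_neq_0; [intros E; apply RtoC_inj in E; lra | easy]).
    replace (RtoC 0) with (/ (x * e) * 0)%C by ring.
    apply Clim_ext_loc with (u := fun n => (/ (x * e) * psum a (x * e) (S n))%C) (N := O).
    + intros n _. rewrite psum_S, Z. field. split; [easy|].
      intros E; apply RtoC_inj in E; lra.
    + apply Clim_mult; [apply Clim_const|]. apply (Clim_incr_1 (psum a (x * e))), H, Hx.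
Qed.

Lemma psum_0 (h : C) (a : nat -> C) (n : nat) : (forall k, a k = 0%C) -> psum a h n = 0%C.
Proof. intros H. induction n as [|n IH]; [easy|]. cbn. rewrite IH, H. ring. Qed.

Lemma power_series_local_zero (f : C -> C) (z0 e : C) (x0 : R) : power_series_at f z0 ->
  0 < x0 -> e <> RtoC 0 -> (forall x : R, 0 < x < x0 -> f (z0 + x * e)%C = 0%C) ->
  exists r, 0 < r /\ forall h, Cmod h < r -> f (z0 + h)%C = 0%C.
Proof.
  intros [a [r [Hr H]]] Hx0 He Hz. exists r. split; [easy|].
  assert (Ep : 0 < Cmod e) by now apply Cmod_gt_0.
  set (x1 := Rmin x0 (r / Cmod e)).
  assert (Hx1 : 0 < x1) by (apply Rmin_pos; [easy | now apply Rdiv_lt_0_compat]).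
  assert (A := power_series_vanishing a e x1 Hx1 He).
  assert (Za : forall k, a k = 0%C).
  { apply A. intros x Hx. rewrite <- (Hz x).
    2:{ split; [easy|]. apply Rlt_le_trans with x1; [easy | apply Rmin_l]. }
    apply H. rewrite Cmod_mult, Cmod_R, Rabs_pos_eq by lra.
    assert (x < r / Cmod e) by (apply Rlt_le_trans with x1; [easy | apply Rmin_r]).
    replace r with (r / Cmod e * Cmod e) by (field; lra). apply Rmult_lt_compat_r; lra. }
  intros h Hh. apply (Clim_unique (psum a h)); [now apply H|].
  apply Clim_ext_loc with (u := fun _ => 0%C) (N := O); [|apply Clim_const].
  intros n _. symmetry. now apply psum_0.
Qed.

(** At the supremum [m] of the parameters up to which [f] vanishes, the expansion vanishes backwards
    along the segment, hence on a disc, and the zeros extend beyond [m] unless the end is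
    reached. *)
Lemma identity_on_segment (f : C -> C) (z0 d : C) (eta : R) : d <> RtoC 0 -> 0 < eta <= 1 ->
  (forall x : R, 0 <= x <= 1 -> power_series_at f (z0 + x * d)) ->
  (forall x : R, 0 <= x <= eta -> f (z0 + x * d)%C = 0%C) ->
  f (z0 + d)%C = 0%C.
Proof.
  intros Hd Heta Hps Hz.
  set (E := fun x => 0 <= x <= 1 /\ forall y : R, 0 <= y <= x -> f (z0 + y * d)%C = 0%C).
  assert (Ee : E eta) by (split; [lra | exact Hz]).
  destruct (completeness E) as [m [Hub Hlub]].
  { exists 1. intros x [Hx _]. lra. }
  { now exists eta. }
  assert (Hm0 : eta <= m) by now apply Hub.
  assert (Hm1 : m <= 1) by (apply Hlub; intros x [Hx _]; lra).
  assert (Below : forall y, 0 <= y < m -> f (z0 + y * d)%C = 0%C).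
  { intros y Hy. destruct (classic (exists x, E x /\ y < x)) as [[x [[_ Hx] L]]|N].
    - apply Hx. lra.
    - exfalso. assert (m <= y); [|lra]. apply Hlub. intros x Hx.
      destruct (Rle_dec x y); [easy|]. exfalso. apply N. exists x. split; [easy | lra]. }
  (* The direction is [- d], back towards the known zeros; [m >= eta > 0] leaves a nontrivial
     segment there. *)
  destruct (power_series_local_zero f (z0 + m * d) (- d) m (Hps m ltac:(lra)) ltac:(lra)) as [r [Hr H]].
  { intros E0. apply Hd. replace d with (- - d)%C by ring. rewrite E0. ring. }
  { intros x Hx. rewrite <- (Below (m - x)) by lra. f_equal. rewrite RtoC_minus. ring. }
  assert (Dp : 0 < Cmod d) by now apply Cmod_gt_0.
  set (s := r / (2 * Cmod d)). assert (Hs : 0 < s) by (apply Rdiv_lt_0_compat; lra).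
  assert (Above : forall y, m <= y <= m + s -> f (z0 + y * d)%C = 0%C).
  { intros y Hy. replace (z0 + y * d)%C with (z0 + m * d + RtoC (y - m) * d)%C by (rewrite RtoC_minus; ring).
    apply H. rewrite Cmod_mult, Cmod_R, Rabs_pos_eq by lra.
    apply Rle_lt_trans with (s * Cmod d); [apply Rmult_le_compat_r; lra|].
    unfold s. replace (r / (2 * Cmod d) * Cmod d) with (r / 2) by (field; lra). lra. }
  destruct (Rle_dec 1 (m + s)) as [L|L].
  - replace d with (RtoC 1 * d)%C by ring. apply Above. lra.
  - exfalso. assert (m + s <= m); [|lra]. apply Hub. split; [lra|].
    intros y Hy. destruct (Rlt_dec y m); [apply Below; lra | apply Above; lra].
Qed.

Lemma power_series_plus (f g : C -> C) (z0 : C) :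
  power_series_at f z0 -> power_series_at g z0 -> power_series_at (fun z => f z + g z)%C z0.
Proof.
  intros [a [r [Hr Ha]]] [b [s [Hs Hb]]].
  exists (fun k => a k + b k)%C, (Rmin r s). split; [now apply Rmin_pos|]. intros h Hh.
  assert (H1 : Cmod h < r) by (apply Rlt_le_trans with (1 := Hh), Rmin_l).
  assert (H2 : Cmod h < s) by (apply Rlt_le_trans with (1 := Hh), Rmin_r).
  apply Clim_ext_loc with (2 := Clim_plus _ _ _ _ (Ha h H1) (Hb h H2)) (N := O).
  intros n _. induction n as [|n IH]; cbn; [ring|]. rewrite <- IH. ring.
Qed.

Lemma power_series_mul_affine (f : C -> C) (b z0 : C) :
  power_series_at f z0 -> power_series_at (fun z => (z + b) * f z)%C z0.
Proof.
  intros [a [r [Hr Ha]]].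
  exists (fun k => ((z0 + b) * a k + match k with O => 0 | S j => a j end)%C), r.
  split; [easy|]. intros h Hh. apply Clim_incr_1.
  assert (H1 : Clim (fun n => psum a h (S n)) (f (z0 + h)%C)) by now apply Clim_incr_1, Ha.
  assert (H2 := Clim_plus _ _ _ _ (Clim_mult _ _ _ _ (Clim_const (z0 + b)) H1)
                 (Clim_mult _ _ _ _ (Clim_const h) (Ha h Hh))).
  replace ((z0 + h + b) * f (z0 + h)%C)%C with ((z0 + b) * f (z0 + h)%C + h * f (z0 + h)%C)%C by ring.
  apply Clim_ext_loc with (2 := H2) (N := O). intros n _.
  induction n as [|n IH]; [cbn; ring|].
  cbn [psum] in IH |- *. rewrite <- IH. cbn. ring.
Qed.

Lemma power_series_const (b z0 : C) : power_series_at (fun _ => b) z0.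
Proof.
  exists (fun k => match k with O => b | S _ => 0%C end), 1. split; [lra|]. intros h _.
  apply Clim_incr_1. apply Clim_ext_loc with (u := fun _ => b) (N := O); [|apply Clim_const].
  intros n _. induction n as [|n IH]; [cbn; ring|].
  cbn [psum] in IH |- *. rewrite <- IH. ring.
Qed.

Lemma is_series_Clim (a : nat -> C) (l : C) :
  is_series (K := C_AbsRing) (V := C_NormedModule) a l ->
  Clim (fun n => sum_n (G := C_AbelianMonoid) a n) l.
Proof.
  intros H eps He. assert (He2 : 0 < eps / 2) by lra.
  destruct (proj1 (filterlim_locally _ _) H (mkposreal _ He2)) as [N HN].
  exists N. intros n Hn. destruct (HN n Hn) as [B1 B2].
  eapply Rle_lt_trans; [apply Cmod_le_Rabs|].
  change (Rabs (fst (sum_n (G := C_AbelianMonoid) a n) - fst l) < eps / 2) in B1.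
  change (Rabs (snd (sum_n (G := C_AbelianMonoid) a n) - snd l) < eps / 2) in B2.
  set (A := sum_n (G := C_AbelianMonoid) a n) in *.
  change (Rabs (fst A - fst l) + Rabs (snd A - snd l) < eps). lra.
Qed.

Lemma is_pseries_Clim (a : nat -> C) (h l : C) :
  is_pseries (K := C_AbsRing) (V := C_NormedModule) a h l -> Clim (psum a h) l.
Proof.
  intros H. apply is_series_Clim in H. apply Clim_incr_1.
  apply Clim_ext_loc with (2 := H) (N := O). intros n _.
  assert (P : forall k, pow_n (K := C_AbsRing) h k = (h ^ k)%C).
  { induction k as [|k IH]; [easy|]. cbn. now rewrite IH. }
  induction n as [|n IH].
  - rewrite sum_O, P. cbn. change (1 * a O = 0 + a O * 1)%C. ring.
  - rewrite sum_Sn, IH, P. cbn [psum]. change (psum a h n + a n * h ^ n + h ^ S n * a (S n) =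
      psum a h n + a n * h ^ n + a (S n) * h ^ S n)%C. ring.
Qed.

Lemma analytic_at_reflect (f : C -> C) (s : C) : analytic_at f (1 - s) ->
  power_series_at (fun s => f (1 - s)%C) s.
Proof.
  intros [a [r [Hr H]]]. exists (fun k => a k * (-1) ^ k)%C, r. split; [easy|]. intros h Hh.
  assert (E : (1 - s - h - (1 - s))%C = (- h)%C) by ring.
  specialize (H (1 - s - h)%C). rewrite E, Cmod_opp in H. specialize (H Hh).
  apply is_pseries_Clim in H. replace (1 - (s + h))%C with (1 - s - h)%C by ring.
  apply Clim_ext_loc with (2 := H) (N := O). intros n _.
  induction n as [|n IH]; [easy|]. cbn [psum]. rewrite IH. f_equal.
  replace (- h)%C with ((-1) * h)%C by ring. rewrite Cpow_mult_l. ring.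
Qed.

(* [saw_sum F] is the integral over [0, oo) of [(e^y - floor (e^y)) F y]. *)
Fixpoint saw_partial (F : R -> C) (n : nat) : C :=
  match n with
  | O => 0%C
  | S k => (saw_partial F k +
      Cint (fun y => RtoC (exp y - INR (S k)) * F y) (ln (INR (S k))) (ln (INR (S (S k)))))%C
  end.

Definition saw_sum (F : R -> C) : C := Clim_seq (saw_partial F).

Definition exp_bounded (F : R -> C) (B b : R) : Prop :=
  contC F /\ 0 < b /\ 0 <= B /\ forall y, 0 <= y -> Cmod (F y) <= B * exp (- b * y).

Lemma contC_saw (F : R -> C) (x : R) : contC F -> contC (fun y => RtoC (exp y - x) * F y)%C.
Proof.
  intros HF. apply contC_mult; [|easy]. intros t. apply ccont_RtoC.
  apply continuous_Rplus; [apply continuous_exp | apply continuous_const].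
Qed.

(** The sawtooth lies between 0 and 1 on each interval, so the increments are bounded by those of a
    primitive of [B e^(- b y)]. *)
Lemma saw_sum_spec (F : R -> C) (B b : R) : exp_bounded F B b ->
  Clim (saw_partial F) (saw_sum F) /\
  forall n, Cmod (saw_sum F - saw_partial F n) <= B / b * exp (- b * ln (INR (S n))).
Proof.
  intros [CF [Hb [HB HF]]].
  assert (HK : 0 <= B / b) by (apply Rdiv_le_0_compat; lra).
  destruct (Clim_of_telescoping (saw_partial F) (fun n => B / b * exp (- b * ln (INR (S n)))) 0) as [l [H1 H2]].
  - now apply is_lim_seq_power_decay.
  - intros n _. cbn [saw_partial].
    assert (P1 : 0 < INR (S n)) by (apply lt_0_INR; lia).
    assert (P2 : INR (S (S n)) = INR (S n) + 1) by apply S_INR.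
    match goal with |- Cmod (?p + ?q - ?p) <= _ => replace (p + q - p)%C with q by ring end.
    set (G := fun y => - (B / b) * exp (- b * y)).
    replace (B / b * exp (- b * ln (INR (S n))) - B / b * exp (- b * ln (INR (S (S n)))))
      with (G (ln (INR (S (S n)))) - G (ln (INR (S n)))) by (unfold G; ring).
    apply (Cint_bound _ G (fun y => B * exp (- b * y))).
    + left. apply ln_increasing; lra.
    + now apply contC_saw.
    + intros y _. unfold G. auto_derive; [easy|]. field. lra.
    + intros y [Y1 Y2].
      assert (E1 : INR (S n) <= exp y) by (rewrite <- (exp_ln (INR (S n))) by easy; now apply exp_le).
      assert (E2 : exp y <= INR (S (S n))) by (rewrite <- (exp_ln (INR (S (S n)))) by lra; now apply exp_le).
      rewrite Cmod_mult, Cmod_R, Rabs_pos_eq by lra.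
      assert (Y0 : 0 <= y).
      { apply Rle_trans with (2 := Y1). rewrite <- ln_1.
        destruct (Req_dec (INR (S n)) 1) as [->|N]; [lra|]. left. apply ln_increasing; [lra|].
        rewrite S_INR in *. generalize (pos_INR n). lra. }
      specialize (HF y Y0). assert (Q := Cmod_ge_0 (F y)). nra.
  - assert (E : saw_sum F = l) by now apply Clim_seq_unique.
    rewrite E. split; [easy|]. intros n. rewrite Cmod_minus_sym. apply H2. lia.
Qed.

Lemma saw_sum_bound (F : R -> C) (B b : R) : exp_bounded F B b -> Cmod (saw_sum F) <= B / b.
Proof.
  intros H. destruct (saw_sum_spec F B b H) as [_ H2]. specialize (H2 O). cbn [saw_partial INR] in H2.
  rewrite ln_1, Rmult_0_r, exp_0, Rmult_1_r in H2. now replace (saw_sum F - 0)%C with (saw_sum F) in H2 by ring.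
Qed.

Lemma saw_partial_lin (F G : R -> C) (k : C) (n : nat) : contC F -> contC G ->
  saw_partial (fun y => F y + k * G y)%C n = (saw_partial F n + k * saw_partial G n)%C.
Proof.
  intros CF CG. induction n as [|n IH]; [cbn; ring|]. cbn [saw_partial]. rewrite IH.
  assert (L : ln (INR (S n)) <= ln (INR (S (S n)))).
  { left. apply ln_increasing; [apply lt_0_INR; lia | apply lt_INR; lia]. }
  rewrite (Cint_ext (fun y => RtoC (exp y - INR (S n)) * (F y + k * G y))%C
    (fun y => RtoC (exp y - INR (S n)) * F y + k * (RtoC (exp y - INR (S n)) * G y))%C) by (intros; ring).
  assert (C1 := contC_saw F (INR (S n)) CF). assert (C2 := contC_saw G (INR (S n)) CG).
  rewrite Cint_plus, Cint_scal; try easy; [ring|].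
  apply contC_mult; [apply contC_const | easy].
Qed.

Lemma saw_sum_lin (F G : R -> C) (k : C) (A a B b : R) : exp_bounded F A a -> exp_bounded G B b ->
  saw_sum (fun y => F y + k * G y)%C = (saw_sum F + k * saw_sum G)%C.
Proof.
  intros HF HG. destruct (saw_sum_spec _ _ _ HF) as [LF _]. destruct (saw_sum_spec _ _ _ HG) as [LG _].
  apply Clim_seq_unique.
  apply Clim_ext_loc with (2 := Clim_plus _ _ _ _ LF (Clim_mult _ _ _ _ (Clim_const k) LG)) (N := O).
  intros n _. symmetry. apply saw_partial_lin; [apply HF | apply HG].
Qed.

(** * Analyticity of the sawtooth integral *)

Lemma pow_fact_le_exp (n : nat) (x : R) : 0 <= x -> x ^ n / INR (fact n) <= exp x.
Proof.
  intros Hx. eapply Rle_trans; [|apply (exp_ge_taylor x n Hx)].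
  destruct n as [|n]; [cbn; lra|]. rewrite tech5.
  assert (0 <= sum_f_R0 (fun k => x ^ k / INR (fact k)) n).
  { apply cond_pos_sum. intros k. apply Rdiv_le_0_compat; [now apply pow_le | apply INR_fact_lt_0]. }
  lra.
Qed.

(** The power [u^(s-1)] at [u = e^y]. As [du = u dy], its [saw_sum] is the integral of [{u} u^(s-2)]
    over [u >= 1]. *)
Definition cexp_weight (s : C) (y : R) : C := Cexp ((s - 1) * y).

Lemma contC_cexp_weight (s : C) : contC (cexp_weight s).
Proof.
  intros t. apply ccont_Cexp, ccont_mult; [apply ccont_const|].
  apply ccont_RtoC, continuous_id.
Qed.

Lemma Cmod_cexp_weight (s : C) (y : R) : Cmod (cexp_weight s y) = exp (- (1 - Re s) * y).
Proof. unfold cexp_weight. rewrite Cmod_Cexp. f_equal. cbn. unfold Re. ring. Qed.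

Lemma exp_bounded_weight (s : C) : Re s < 1 -> exp_bounded (cexp_weight s) 1 (1 - Re s).
Proof.
  intros Hs. split; [apply contC_cexp_weight|]. repeat split; try lra.
  intros y _. rewrite Cmod_cexp_weight. lra.
Qed.

(** The k-th Taylor coefficient of the weight as a function of [s]; its [saw_sum] is the coefficient
    of the power series. *)
Definition taylor_weight (s : C) (k : nat) (y : R) : C :=
  (cexp_weight s y * RtoC (y ^ k / INR (fact k)))%C.

Lemma continuous_pow_comp (k : nat) (t : R) : continuous (fun y : R => y ^ k) t.
Proof.
  induction k as [|k IH]; [apply continuous_const|].
  apply (continuous_Rmult (fun y => y) (fun y => y ^ k)); [apply continuous_id | easy].
Qed.

Lemma contC_taylor_weight (s : C) (k : nat) : contC (taylor_weight s k).
Proof.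
  apply contC_mult; [apply contC_cexp_weight|]. intros t. apply ccont_RtoC.
  apply (continuous_Rmult (fun y => y ^ k) (fun _ => / INR (fact k))); [apply continuous_pow_comp | apply continuous_const].
Qed.

(** Half of the rate [a = 1 - Re s] is given up to absorb the power:
    [y^k / k! <= (2/a)^k e^(a y / 2)]. *)
Lemma exp_bounded_taylor (s : C) (k : nat) : Re s < 1 ->
  exp_bounded (taylor_weight s k) ((2 / (1 - Re s)) ^ k) ((1 - Re s) / 2).
Proof.
  intros Hs. set (a := 1 - Re s). assert (Ha : 0 < a) by (unfold a; lra).
  assert (H2a : 0 < 2 / a) by (apply Rdiv_lt_0_compat; lra).
  split; [apply contC_taylor_weight|]. split; [lra|]. split; [apply pow_le; lra|].
  intros y Hy. unfold taylor_weight. rewrite Cmod_mult, Cmod_cexp_weight, Cmod_R. fold a.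
  assert (Fp := INR_fact_lt_0 k).
  rewrite Rabs_pos_eq by (apply Rdiv_le_0_compat; [now apply pow_le | easy]).
  assert (E := pow_fact_le_exp k (a / 2 * y) ltac:(nra)).
  assert (E2 : y ^ k / INR (fact k) = (2 / a) ^ k * ((a / 2 * y) ^ k / INR (fact k))).
  { rewrite Rpow_mult_distr. unfold Rdiv at 3.
    replace ((2 / a) ^ k * ((a / 2) ^ k * y ^ k * / INR (fact k)))
      with (((2 / a) ^ k * (a / 2) ^ k) * (y ^ k / INR (fact k))) by (unfold Rdiv; ring).
    rewrite <- Rpow_mult_distr. replace (2 / a * (a / 2)) with 1 by (field; lra). rewrite pow1. ring. }
  rewrite E2.
  replace (- (a / 2) * y) with (- a * y + a / 2 * y) by field. rewrite exp_plus.
  assert (Q := exp_pos (- a * y)). assert (0 <= (2 / a) ^ k) by (apply pow_le; lra).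
  replace ((2 / a) ^ k * (exp (- a * y) * exp (a / 2 * y))) with
    (exp (- a * y) * ((2 / a) ^ k * exp (a / 2 * y))) by ring.
  apply Rmult_le_compat_l; [lra|]. now apply Rmult_le_compat_l.
Qed.

(** The Taylor remainder of the weight at [s + h] after [n] terms. *)
Definition weight_rest (s h : C) (n : nat) (y : R) : C :=
  (cexp_weight s y * (Cexp (h * y) - Cexp_sum n (h * y)))%C.

Lemma weight_rest_S (s h : C) (n : nat) (y : R) :
  weight_rest s h (S n) y = (weight_rest s h n y + (- h ^ n) * taylor_weight s n y)%C.
Proof.
  unfold weight_rest, taylor_weight. cbn [Cexp_sum]. rewrite Cpow_mult_l.
  unfold Rdiv. rewrite RtoC_mult, RtoC_inv by apply INR_fact_neq_0. rewrite RtoC_pow. ring.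
Qed.

Lemma weight_rest_0 (s h : C) (y : R) : weight_rest s h 0 y = cexp_weight (s + h) y.
Proof.
  unfold weight_rest, cexp_weight. cbn [Cexp_sum].
  replace ((s + h - 1) * y)%C with ((s - 1) * y + h * y)%C by ring. rewrite Cexp_plus. ring.
Qed.

Lemma contC_weight_rest (s h : C) (n : nat) : contC (weight_rest s h n).
Proof.
  induction n as [|n IH]; intros t.
  - apply ccont_ext with (f := cexp_weight (s + h)); [intros; symmetry; apply weight_rest_0 | apply contC_cexp_weight].
  - apply ccont_ext with (f := fun y => (weight_rest s h n y + (- h ^ n) * taylor_weight s n y)%C);
      [intros; symmetry; apply weight_rest_S|].
    apply ccont_plus; [apply IH|]. apply ccont_mult; [apply ccont_const | apply contC_taylor_weight].
Qed.

(** The radius [a / 6] makes [(|h| y)^n / n!] at most [2^(-n) e^(a y / 3)] and the exponential of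
    [|Re (h y)|] at most [e^(a y / 6)]; together they cost half of the rate [a]. *)
Lemma exp_bounded_rest (s h : C) (n : nat) : Re s < 1 -> Cmod h <= (1 - Re s) / 6 ->
  exp_bounded (weight_rest s h n) ((/ 2) ^ n) ((1 - Re s) / 2).
Proof.
  intros Hs Hh. split; [apply contC_weight_rest|]. split; [lra|]. split; [apply pow_le; lra|].
  intros y Hy. unfold weight_rest. rewrite Cmod_mult, Cmod_cexp_weight.
  set (a := 1 - Re s) in *.
  assert (R1 := Cexp_remainder n (h * y)).
  rewrite Cmod_mult, Cmod_R, Rabs_pos_eq in R1 by easy.
  assert (R2 : Rabs (Re (h * y)) <= a / 6 * y).
  { apply Rle_trans with (1 := re_le_Cmod _). rewrite Cmod_mult, Cmod_R, Rabs_pos_eq by easy. nra. }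
  apply exp_le in R2. assert (Fp := INR_fact_lt_0 n). assert (P := Cmod_ge_0 h).
  assert (R3 : (Cmod h * y) ^ n / INR (fact n) <= (/ 2) ^ n * exp (a / 3 * y)).
  { replace ((Cmod h * y) ^ n / INR (fact n)) with ((/ 2) ^ n * ((2 * (Cmod h * y)) ^ n / INR (fact n))).
    - apply Rmult_le_compat_l; [apply pow_le; lra|].
      eapply Rle_trans; [apply pow_fact_le_exp; nra|]. apply exp_le. nra.
    - rewrite (Rpow_mult_distr 2). unfold Rdiv. rewrite <- !Rmult_assoc, <- Rpow_mult_distr.
      rewrite Rinv_l, pow1 by lra. ring. }
  assert (X0 : 0 <= (Cmod h * y) ^ n / INR (fact n)).
  { apply Rdiv_le_0_compat; [apply pow_le; nra | easy]. }
  replace ((/ 2) ^ n * exp (- (a / 2) * y)) with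
    (exp (- a * y) * ((/ 2) ^ n * exp (a / 3 * y) * exp (a / 6 * y))).
  2:{ replace (- (a / 2) * y) with (- a * y + (a / 3 * y + a / 6 * y)) by field. rewrite !exp_plus. ring. }
  apply Rmult_le_compat_l; [left; apply exp_pos|]. apply Rle_trans with (1 := R1).
  apply Rmult_le_compat; try easy. left; apply exp_pos.
Qed.

(** Peeling off one Taylor term at a time turns the partial sums into the full integral minus that
    of the remainder, which is at most a constant times [2^(-n)]. *)
Lemma power_series_saw (s : C) : Re s < 1 ->
  power_series_at (fun s => saw_sum (cexp_weight s)) s.
Proof.
  intros Hs. exists (fun k => saw_sum (taylor_weight s k)), ((1 - Re s) / 6). split; [lra|].
  intros h Hh.
  assert (E : forall n, psum (fun k => saw_sum (taylor_weight s k)) h n =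
     (saw_sum (cexp_weight (s + h)) - saw_sum (weight_rest s h n))%C).
  { induction n as [|n IH].
    - cbn [psum]. replace (saw_sum (weight_rest s h 0)) with (saw_sum (cexp_weight (s + h))); [ring|].
      unfold saw_sum, Clim_seq.
      assert (X : forall n, saw_partial (cexp_weight (s + h)) n = saw_partial (weight_rest s h 0) n).
      { induction n as [|n IH]; [easy|]. cbn [saw_partial]. rewrite IH. f_equal. apply Cint_ext.
        intros t. now rewrite weight_rest_0. }
      f_equal; f_equal; apply Lim_seq_ext; intros n; now rewrite X.
    - cbn [psum]. rewrite IH.
      assert (F : saw_sum (weight_rest s h (S n)) =
        saw_sum (fun y => weight_rest s h n y + (- h ^ n) * taylor_weight s n y)%C).
      { unfold saw_sum, Clim_seq.
        assert (X : forall m, saw_partial (weight_rest s h (S n)) m =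
          saw_partial (fun y => weight_rest s h n y + (- h ^ n) * taylor_weight s n y)%C m).
        { induction m as [|m IHm]; [easy|]. cbn [saw_partial]. rewrite IHm. f_equal. apply Cint_ext.
          intros t. now rewrite weight_rest_S. }
        f_equal; f_equal; apply Lim_seq_ext; intros m; now rewrite X. }
      rewrite F, (saw_sum_lin _ _ _ _ _ _ _ (exp_bounded_rest s h n Hs (Rlt_le _ _ Hh)) (exp_bounded_taylor s n Hs)).
      ring. }
  apply Clim_squeeze with (v := fun n => 2 / (1 - Re s) * (/ 2) ^ n) (N0 := O).
  { rewrite <- (Rmult_0_r (2 / (1 - Re s))).
    apply is_lim_seq_scal_l with (lu := Finite 0), is_lim_seq_geom. rewrite Rabs_pos_eq; lra. }
  intros n _.
  rewrite E.
  match goal with |- Cmod (?p - ?q - ?p) <= _ => replace (p - q - p)%C with (- q)%C by ring end.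
  rewrite Cmod_opp. eapply Rle_trans; [apply (saw_sum_bound _ _ _ (exp_bounded_rest s h n Hs (Rlt_le _ _ Hh)))|].
  right. field. lra.
Qed.

(** Integration by parts between consecutive logarithms: the boundary value at the right end, where
    the sawtooth reaches 1, is the new term of the Dirichlet sum, and the rest updates the term
    [n^s / s]. *)
Lemma zeta_approx_saw (s : C) (n : nat) : s <> RtoC 0 ->
  zeta_approx (S n) s = (1 - / s + (s - 1) * saw_partial (cexp_weight s) n)%C.
Proof.
  intros Hs. induction n as [|n IH].
  - unfold zeta_approx. cbn [dirichlet_sum saw_partial INR]. rewrite ln_1.
    replace (0 * (s - 1))%C with (RtoC 0) by ring. replace (0 * s)%C with (RtoC 0) by ring.
    rewrite Cexp_0. ring.
  - cbn [saw_partial]. rewrite Cmult_plus_distr_l, Cplus_assoc, <- IH.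
    set (m := S n). set (a := ln (INR m)). set (b := ln (INR (S m))).
    assert (P1 : 0 < INR m) by (apply lt_0_INR; unfold m; lia).
    assert (P2 : INR (S m) = INR m + 1) by apply S_INR.
    assert (Hab : a <= b) by (left; apply ln_increasing; lra).
    (* Differentiating the product yields the integrand plus [e^(s y)], which the last term
       removes. *)
    set (G := fun y : R => (RtoC (exp y - INR m) * Cexp ((s - 1) * y) - / s * Cexp (s * y))%C).
    assert (E : ((s - 1) * Cint (fun y => RtoC (exp y - INR m) * cexp_weight s y) a b)%C = (G b - G a)%C).
    { assert (Cw := contC_saw _ (INR m) (contC_cexp_weight s)).
      rewrite <- Cint_scal by easy. apply Cint_unique; [easy| |].
      - apply contC_mult; [apply contC_const | easy].
      - intros y _. unfold G. eapply derive_RC_eq.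
        + apply derive_RC_minus.
          * apply derive_RC_mult.
            -- apply (derive_RC_RtoC (fun y => exp y - INR m) y (exp y)). auto_derive; [easy|]. ring.
            -- apply derive_RC_Cexp, derive_RC_scal, derive_RC_id.
          * apply derive_RC_scal, derive_RC_Cexp, derive_RC_scal, derive_RC_id.
        + cbv beta. unfold cexp_weight.
          replace (s * y)%C with ((s - 1) * y + RtoC y)%C by ring. rewrite Cexp_plus, Cexp_RtoC.
          field. easy. }
    rewrite E. unfold G, a, b. rewrite !exp_ln by lra.
    unfold zeta_approx. cbn [dirichlet_sum]. fold m. fold m.
    change (dirichlet_sum (S m) s) with (dirichlet_sum m s + Cexp (ln (INR (S m)) * (s - 1)))%C.
    rewrite P2. replace (INR m + 1 - INR m) with 1 by ring. rewrite Rminus_diag.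
    rewrite !(Cmult_comm _ (RtoC (ln _))). ring.
Qed.

(** Both sides are limits of [zeta_approx]: for [Re s < 0] the Dirichlet series at [1 - s] converges
    and [n^s / s] tends to 0. *)
Lemma zeta_eq_saw_left (zeta : C -> C) (s : C) : is_riemann_zeta zeta -> Re s < 0 ->
  zeta (1 - s)%C = (1 - / s + (s - 1) * saw_sum (cexp_weight s))%C.
Proof.
  intros [Hz _] Hs.
  assert (Hn : s <> RtoC 0) by (intros ->; cbn in Hs; lra).
  destruct (saw_sum_spec _ _ _ (exp_bounded_weight s ltac:(lra))) as [L _].
  assert (L1 : Clim (fun n => zeta_approx (S n) s) (1 - / s + (s - 1) * saw_sum (cexp_weight s))%C).
  { apply Clim_ext_loc with (2 := Clim_plus _ _ _ _ (Clim_const (1 - / s)%C)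
      (Clim_mult _ _ _ _ (Clim_const (s - 1)%C) L)) (N := O).
    intros n _. symmetry. now apply zeta_approx_saw. }
  apply (Clim_unique _ _ _) with (2 := L1).
  assert (Hr : 1 < Re (1 - s)%C) by (cbn; unfold Re in Hs; lra).
  assert (S1 := is_series_Clim _ _ (Hz _ Hr)).
  assert (S2 : Clim (fun n => (- / s) * Cexp (ln (INR (S n)) * s))%C ((- / s) * 0)%C).
  { apply Clim_mult; [apply Clim_const|].
    apply Clim_squeeze with (v := fun n => 1 * exp (- - Re s * ln (INR (S n)))) (N0 := O).
    - apply is_lim_seq_power_decay; lra.
    - intros n _. replace (Cexp (ln (INR (S n)) * s) - 0)%C with (Cexp (ln (INR (S n)) * s)) by ring.
      rewrite Cmod_Cexp. right. rewrite Rmult_1_l. f_equal. cbn -[INR]. unfold Re. ring. }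
  assert (S3 := Clim_plus _ _ _ _ S1 S2).
  replace (zeta (1 - s)%C) with (zeta (1 - s)%C + - / s * 0)%C by ring.
  apply Clim_ext_loc with (2 := S3) (N := O). intros n _. unfold zeta_approx.
  assert (X : sum_n (G := C_AbelianMonoid) (fun n => Cpower (INR (S n)) (- (1 - s))) n = dirichlet_sum (S n) s).
  { assert (T : forall k, Cpower (INR (S k)) (- (1 - s)) = Cexp (ln (INR (S k)) * (s - 1))).
    { intros k. unfold Cpower. rewrite Clog_RtoC by (apply lt_0_INR; lia). f_equal. ring. }
    induction n as [|n IH].
    - rewrite sum_O, T. cbn [dirichlet_sum]. symmetry. apply Cplus_0_l.
    - rewrite sum_Sn, IH, T. reflexivity. }
  rewrite X. ring.
Qed.

(** Both sides are analytic for [Re s < 1] away from 0 and agree for [Re s < 0], so the equality is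
    continued along a segment. *)
Lemma zeta_eq_saw (zeta : C -> C) (s : C) : is_riemann_zeta zeta -> 0 < Re s < 1 ->
  zeta (1 - s)%C = (1 - / s + (s - 1) * saw_sum (cexp_weight s))%C.
Proof.
  intros Hz Hs.
  (* This is [s] times the difference of the two sides, written with affine factors [s + b] so that
     [power_series_mul_affine] applies. *)
  set (f := fun s => ((s + 0) * zeta (1 - s) + ((- (1)) * (s + -1) + (s + -1) * ((s + 0) * - saw_sum (cexp_weight s))))%C).
  assert (Hps : forall u, u <> RtoC 0 -> Re u < 1 -> power_series_at f u).
  { intros u Hu Hu1. apply power_series_plus.
    - apply power_series_mul_affine. apply analytic_at_reflect, Hz.
      intros E. apply Hu. replace u with (1 - (1 - u))%C by ring. rewrite E. ring.
    - apply power_series_plus.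
      + assert (X := power_series_mul_affine _ (-1) u (power_series_const (- (1))%C u)).
        destruct X as [a [r [Hr X]]]. exists a, r. split; [easy|]. intros h Hh.
        specialize (X h Hh). cbv beta in X |- *. now rewrite Cmult_comm.
      + do 2 apply power_series_mul_affine.
        assert (X := power_series_mul_affine _ (-1) u (power_series_saw u Hu1)).
        assert (Y := power_series_mul_affine _ 0 u (power_series_saw u Hu1)).
        destruct (power_series_saw u Hu1) as [a [r [Hr Z]]].
        exists (fun k => - a k)%C, r. split; [easy|]. intros h Hh.
        assert (W := Clim_mult _ _ _ _ (Clim_const (-1)%C) (Z h Hh)).
        replace (- saw_sum (cexp_weight (u + h)))%C with ((-1) * saw_sum (cexp_weight (u + h)))%C by ring.
        apply Clim_ext_loc with (2 := W) (N := O). intros n _.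
        induction n as [|n IH]; cbn; [ring|]. rewrite <- IH. ring. }
  assert (Hf0 : forall u, u <> RtoC 0 -> (zeta (1 - u)%C = (1 - / u + (u - 1) * saw_sum (cexp_weight u))%C <-> f u = 0%C)).
  { intros u Hu. unfold f. split.
    - intros ->. field. easy.
    - intros E. replace (zeta (1 - u)%C) with
        (((u + 0) * zeta (1 - u) + (- (1) * (u + -1) + (u + -1) * ((u + 0) * - saw_sum (cexp_weight u)))) / u +
         ((u - 1) + (u - 1) * u * saw_sum (cexp_weight u)) / u)%C by (field; easy).
      rewrite E. field. easy. }
  destruct s as [c t]. cbn in Hs.
  assert (Hsn : (c, t) <> RtoC 0) by (apply pair_neq_0; lra).
  apply Hf0; [easy|].
  (* Approach [(c, t)] along a segment that avoids the pole [0]. *)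
  set (tau := if Rle_dec 0 t then 1 else -1).
  set (d := ((c + 1, - tau) : C)).
  set (p := ((-1, t + tau) : C)).
  replace (c, t) with (p + d)%C by (apply C_ext; cbn; ring).
  assert (Hp : forall x : R, (p + x * d)%C = (-1 + x * (c + 1), t + (1 - x) * tau)).
  { intros x. apply C_ext; cbn; ring. }
  (* Up to the parameter [1 / (2 (c + 1))] the real part [-1 + x (c + 1)] is at most [- 1/2], where
     the equality is known. *)
  apply (identity_on_segment f _ d (/ (2 * (c + 1)))).
  - apply pair_neq_0. lra.
  - split; [apply Rinv_0_lt_compat; lra|]. rewrite <- Rinv_1. apply Rinv_le_contravar; lra.
  - intros x Hx. rewrite Hp. apply Hps.
    (* The imaginary part [t + (1 - x) tau] can vanish only for [t = 0] and [x = 1], and there the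
       real part is [c > 0]. *)
    + intros E. assert (E1 := f_equal fst E). assert (E2 := f_equal snd E). cbn in E1, E2.
      unfold tau in E2. destruct (Rle_dec 0 t); [|nra].
      assert (t = 0 /\ x = 1) as [_ ->] by lra. lra.
    + cbn. nra.
  - intros x Hx. rewrite Hp.
    assert (Hneg : -1 + x * (c + 1) < 0).
    { apply Rle_lt_trans with (-1 + / (2 * (c + 1)) * (c + 1)).
      - apply Rplus_le_compat_l, Rmult_le_compat_r; lra.
      - replace (/ (2 * (c + 1)) * (c + 1)) with (/ 2) by (field; lra). lra. }
    apply Hf0; [apply pair_neq_0; lra|]. now apply zeta_eq_saw_left.
Qed.

(** The two expressions differ by [s - 1] times the tail of the sawtooth integral, whose weight
    decays at the rate [1 - c]. *)
Lemma zeta_approx_error (zeta : C -> C) (c : R) : is_riemann_zeta zeta -> 0 < c < 1 ->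
  exists A, forall n t, Cmod (zeta (1 - (c, t))%C - zeta_approx (S n) (c, t)) <=
    A * exp (- (1 - c) * ln (INR (S n))) * Cmod ((c, t) - 1).
Proof.
  intros Hz Hc. exists (1 / (1 - c)). intros n t.
  rewrite (zeta_eq_saw zeta (c, t) Hz) by (cbn; lra).
  rewrite zeta_approx_saw by (apply pair_neq_0; lra).
  destruct (saw_sum_spec _ _ _ (exp_bounded_weight (c, t) ltac:(cbn; lra))) as [_ H].
  specialize (H n). cbn [Re fst] in H.
  set (Q := saw_sum (cexp_weight (c, t))) in *. set (q := saw_partial (cexp_weight (c, t)) n) in *.
  replace (1 - / (c, t) + ((c, t) - 1) * Q - (1 - / (c, t) + ((c, t) - 1) * q))%C
    with (((c, t) - 1) * (Q - q))%C by ring.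
  rewrite Cmod_mult, Rmult_comm. apply Rmult_le_compat_r; [apply Cmod_ge_0 | exact H].
Qed.

(** * The Stieltjes constant and the theorem *)

Definition log_harm (n : nat) : R := sum_n_m (fun j => ln (INR j) / INR j) 1 n.

Lemma log_harm_0 : log_harm 0 = 0.
Proof. unfold log_harm. now rewrite sum_n_m_zero by lia. Qed.

Lemma log_harm_S (n : nat) : log_harm (S n) = log_harm n + ln (INR (S n)) / INR (S n).
Proof. unfold log_harm. now rewrite sum_n_Sm by lia. Qed.

Lemma Clog_INR_div (n : nat) :
  (Clog (INR (S n)) / INR (S n))%C = RtoC (ln (INR (S n)) / INR (S n)).
Proof.
  rewrite Clog_RtoC by (apply lt_0_INR; lia).
  unfold Rdiv. rewrite RtoC_mult, RtoC_inv by (apply not_0_INR; lia). reflexivity.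
Qed.

(** The shift of index is exact because the first term of [log_harm] is [ln 1 = 0]. *)
Lemma log_sum_1 (n : nat) : log_sum 1 n = RtoC (log_harm (S n)).
Proof.
  induction n as [|n IH].
  - cbn [log_sum]. rewrite log_harm_S, log_harm_0. cbn [INR]. rewrite ln_1.
    f_equal. field.
  - cbn [log_sum]. rewrite (log_harm_S (S n)), RtoC_plus, <- IH, <- Clog_INR_div.
    do 2 f_equal; rewrite (S_INR (S n)), RtoC_plus; [now f_equal | reflexivity].
Qed.

(* The hypothesis is the case [z = 1] of [line_int_zeta_lim], which thus also gives
   the convergence of the limit defining the Stieltjes constant. *)
Lemma is_lim_stieltjes_gamma1 (l : C) :
  Clim (fun n => - 2 * log_sum 1 (S n) + Clog (INR (S n) + 1) * Clog (INR (S n) + 1))%C l ->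
  is_lim_seq (fun n => log_harm n - ln (INR n) ^ 2 / 2) stieltjes_gamma1.
Proof.
  intros H.
  assert (H2 := Clim_mult _ _ _ _ (Clim_const (RtoC (- / 2))) H).
  destruct (Clim_fst _ _ H2) as [H3 _].
  assert (H4 : is_lim_seq (fun n => log_harm n - ln (INR n) ^ 2 / 2) (fst (RtoC (- / 2) * l)%C)).
  (* The sum over [S n] terms at [z = 1] ends at [ln (n + 2) / (n + 2)], hence the shift by 2. *)
  { apply (is_lim_seq_incr_n _ 2). apply is_lim_seq_ext with (2 := H3). intros n.
    replace (n + 2)%nat with (S (S n)) by lia. rewrite log_sum_1.
    replace (INR (S n) + 1)%C with (RtoC (INR (S (S n)))) by (rewrite (S_INR (S n)), RtoC_plus; ring).
    rewrite Clog_RtoC by (apply lt_0_INR; lia). cbn -[INR log_harm]. field. }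
  assert (E : stieltjes_gamma1 = fst (RtoC (- / 2) * l)%C).
  { unfold stieltjes_gamma1. fold log_harm. exact (f_equal real (is_lim_seq_unique _ _ H4)). }
  now rewrite E.
Qed.

Lemma is_lim_seq_ln_div : is_lim_seq (fun n => ln (INR (S n)) / INR (S n)) 0.
Proof.
  apply (is_lim_seq_incr_1 (fun n => ln (INR n) / INR n)).
  apply (is_lim_comp_seq (fun x => ln x / x) INR p_infty 0).
  - apply is_lim_div_ln_p.
  - exists O. easy.
  - apply is_lim_seq_INR.
Qed.

(** With [log (x + z) = ln x + e] and [e = O(1/x)], the difference of squares is [e (2 ln x + e)],
    of order [ln x / x]. *)
Lemma Clog_sqr_asymptotic (z : C) : offcut z ->
  Clim (fun n => Clog (INR (S n) + z) * Clog (INR (S n) + z) - RtoC (ln (INR (S n)) ^ 2))%C 0%C.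
Proof.
  intros Hz. set (m := Cmod z). assert (Hm : 0 <= m) by apply Cmod_ge_0.
  destruct (nfloor_ex (2 * m)) as [M HM]; [lra|].
  apply Clim_squeeze with (N0 := M)
    (v := fun n => 4 * m * (ln (INR (S n)) / INR (S n)) + 2 * m * / INR (S n)).
  { replace 0 with (4 * m * 0 + 2 * m * 0) by ring.
    apply is_lim_seq_plus'; apply is_lim_seq_scal_l with (lu := Finite 0);
      [apply is_lim_seq_ln_div | apply is_lim_seq_inv_S]. }
  intros n Hn.
  assert (HnM : INR M <= INR n) by (apply le_INR; lia).
  assert (Hx : INR (S n) = INR n + 1) by apply S_INR.
  set (x := INR (S n)) in *. assert (Hn0 := pos_INR n).
  assert (Hx0 : 0 < x) by lra.
  assert (Hln : 0 <= ln x).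
  { rewrite <- ln_1. destruct (Req_dec x 1) as [->|]; [lra|]. left. apply ln_increasing; lra. }
  assert (E := Clog_exp_scale z (ln x) Hz). rewrite exp_ln in E by easy. rewrite <- E.
  set (e := Clog (1 + z / x)).
  assert (Ez : Cmod (z / x) = m * / x).
  { rewrite Cmod_div, Cmod_R, Rabs_pos_eq by (lra || (intros Q; apply RtoC_inj in Q; lra)). reflexivity. }
  assert (Hsmall : m * / x <= / 2).
  { apply Rmult_le_reg_r with x; [easy|]. rewrite Rmult_assoc, Rinv_l; lra. }
  assert (He2 : Cmod e <= 2 * (m * / x)).
  { rewrite <- Ez. apply Clog_near_1. lra. }
  replace ((ln x + e) * (ln x + e) - RtoC (ln x ^ 2) - 0)%C with (e * (2 * ln x + e))%C
    by (rewrite RtoC_pow; ring).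
  rewrite Cmod_mult.
  assert (T : Cmod (2 * ln x + e) <= 2 * ln x + 1).
  { eapply Rle_trans; [apply Cmod_triangle|]. rewrite <- RtoC_mult, Cmod_R, Rabs_pos_eq; lra. }
  apply Rle_trans with (2 * (m * / x) * (2 * ln x + 1)).
  - apply Rmult_le_compat; try apply Cmod_ge_0; easy.
  - right. unfold Rdiv. ring.
Qed.

Lemma offcut_add_1 (z : C) : offcut z -> offcut (z + 1)%C.
Proof.
  intros H Hi. cbn in *. unfold offcut, Re, Im in H.
  assert (Hi2 : snd z = 0) by (unfold Im in Hi; cbn in Hi; lra).
  specialize (H Hi2). unfold Re. cbn. lra.
Qed.

(** Reindexed by one, the series of [psi1 (z + 1)] is [log_sum z] without its first term, and that
    term is the isolated quotient in [psi1]. The Stieltjes limit accounts for the [log_harm]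
    part. *)
Lemma psi1_eq (z l1 l : C) : offcut z ->
  Clim (fun n => - 2 * log_sum 1 (S n) + Clog (INR (S n) + 1) * Clog (INR (S n) + 1))%C l1 ->
  Clim (fun n => - 2 * log_sum z (S n) + Clog (INR (S n) + z) * Clog (INR (S n) + z))%C l ->
  psi1 (z + 1) = (/ 2 * l)%C.
Proof.
  intros Hz H1 Hl. assert (G := is_lim_stieltjes_gamma1 _ H1).
  set (term := fun k : nat => (Clog (INR (S k) + (z + 1)) / (INR (S k) + (z + 1)) - Clog (INR (S k)) / INR (S k))%C).
  assert (Hs : forall n, sum_n (G := C_AbelianMonoid) term n =
    (log_sum z (S (S n)) - Clog (z + 1) / (z + 1) - log_harm (S n))%C).
  { assert (T : forall k : nat, term k = (Clog (INR (S (S k)) + z) / (INR (S (S k)) + z) -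
       RtoC (ln (INR (S k)) / INR (S k)))%C).
    { intros k. unfold term. rewrite Clog_INR_div.
      replace (INR (S k) + (z + 1))%C with (INR (S (S k)) + z)%C by (rewrite (S_INR (S k)), RtoC_plus; ring).
      reflexivity. }
    induction n as [|n IH].
    - rewrite sum_O, T. cbn [log_sum]. rewrite log_harm_S, log_harm_0, Rplus_0_l.
      replace (INR 1 + z)%C with (z + 1)%C by (cbn; ring). unfold Cminus.
      apply C_ext; cbn -[INR Clog ln Cdiv]; ring.
    - rewrite sum_Sn, IH, T. change plus with Cplus. rewrite (log_harm_S (S n)), RtoC_plus.
      change (log_sum z (S (S (S n)))) with
        (log_sum z (S (S n)) + Clog (INR (S (S (S n))) + z) / (INR (S (S (S n))) + z))%C.
      match goal with |- ?a = ?b => change (@eq C a b) end. ring. }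
  assert (A1 := Clim_mult _ _ _ _ (Clim_const (RtoC (- / 2))) (proj2 (Clim_incr_1 _ _) Hl)).
  assert (A2 : Clim (fun n => RtoC (log_harm (S n) - ln (INR (S n)) ^ 2 / 2)) (RtoC stieltjes_gamma1)).
  { apply Clim_RtoC. now apply is_lim_seq_incr_1 in G. }
  (* Applied at [z + 1], since [(n + 2) + z = (n + 1) + (z + 1)] aligns the logarithm with the index
     of the Stieltjes sequence. *)
  assert (A3 := Clog_sqr_asymptotic (z + 1) (offcut_add_1 z Hz)).
  assert (A4 := Clim_plus _ _ _ _ (Clim_plus _ _ _ _ A1 (Clim_const (- (Clog (z + 1) / (z + 1)))%C))
    (Clim_plus _ _ _ _ (Clim_mult _ _ _ _ (Clim_const (RtoC (-1))) A2)
       (Clim_mult _ _ _ _ (Clim_const (RtoC (/ 2))) A3))).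
  assert (Hc : RtoC (/ 2) = (/ 2)%C) by (apply RtoC_inv; lra).
  assert (Hc2 : RtoC (- / 2) = (- / 2)%C) by (now rewrite RtoC_opp, Hc).
  assert (E : Cseries term = (RtoC (- / 2) * l + - (Clog (z + 1) / (z + 1)) + (-1 * stieltjes_gamma1 + RtoC (/ 2) * 0))%C).
  { apply Clim_seq_unique.
    apply Clim_ext_loc with (2 := A4) (N := O). intros n _. rewrite Hs.
    replace (INR (S (S n)) + z)%C with (INR (S n) + (z + 1))%C by (rewrite (S_INR (S n)), RtoC_plus; ring).
    rewrite RtoC_minus. unfold Rdiv. rewrite RtoC_mult, Hc, Hc2. field.
    now apply offcut_neq_0, offcut_add_1. }
  unfold psi1. fold term. rewrite E, Hc, Hc2. field.
  now apply offcut_neq_0, offcut_add_1.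
Qed.

Theorem theorem3p3 (zeta : C -> C) (Hzeta : is_riemann_zeta zeta)
    (z : C) (Hz0 : z <> RtoC 0) (Hz : Rabs (Carg z) < PI)
    (c : R) (Hc0 : 0 < c) (Hc1 : c < 1) :
  exists I : C,
    is_vline_int
      (fun s : C =>
         (PI * zeta (1 - s) / Csin (PI * s)
          * (euler_gamma - Clog z + digamma s) * Cpower z (- s))%C)
      c I
    /\ (psi1 (z + 1) - 1 / 2 * (Clog z * Clog z) = 1 / (2 * PI * Ci) * I)%C.
Proof.
  assert (Hc : 0 < c < 1) by lra.
  assert (HPI := PI_RGT_0).
  assert (Hoff := offcut_of_Carg z Hz0 Hz).
  set (phi := fun s => (euler_gamma + digamma s)%C).
  assert (Hphi : phi_approx phi) by exact phi_approx_digamma.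
  assert (HZ := zeta_approx_error zeta c Hzeta Hc).
  assert (Hw : - PI < Im (Clog z) < PI) by exact (Carg_offcut_bound z Hoff).
  set (f := fun t => (full_kern phi c (Clog z) t * zeta (1 - (c, t)))%C).
  assert (Df : decaying f) by exact (decaying_full_kern_Z phi c (Clog z) Hphi Hc Hw (fun s => zeta (1 - s)%C) HZ).
  assert (Lf := line_int_zeta_lim phi c (Clog z) Hphi Hc Hw (fun s => zeta (1 - s)%C) HZ).
  cbv beta in Lf. fold f in Lf. rewrite Cexp_Clog in Lf by easy.
  (* The same limit at [w0 = 0], that is [z = 1], for the Stieltjes constant. *)
  assert (L1 := line_int_zeta_lim phi c 0%C Hphi Hc ltac:(cbn; lra) (fun s => zeta (1 - s)%C) HZ).
  rewrite Cexp_0 in L1.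
  (* The factor [PI] was left out of the kernel and [Ci] comes from [ds = i dt]; divided by [2 PI i]
     the integral becomes half of [line_int f]. *)
  exists (PI * Ci * line_int f)%C. split.
  - assert (E : forall t : R, (PI * Ci * f t)%C =
      (PI * zeta (1 - (c + Ci * t)) / Csin (PI * (c + Ci * t)) *
       (euler_gamma - Clog z + digamma (c + Ci * t)) * Cpower z (- (c + Ci * t)) * Ci)%C).
    { intros t. replace (c + Ci * t)%C with (c, t) by (apply C_ext; cbn; ring).
      unfold f, full_kern, kern, phi, Cpower.
      replace (- (c, t) * Clog z)%C with (- Clog z * (c, t))%C by ring.
      unfold Cdiv. ring. }
    unfold is_vline_int. apply is_line_int_RInt_gen.
    + intros t. apply ccont_ext with (1 := E). apply ccont_mult; [apply ccont_const | apply Df].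
    + apply is_line_int_ext with (1 := E). apply is_line_int_scal; [apply Df | now apply line_int_correct].
  - set (w := Clog z) in *.
    (* Restoring the subtracted [w^2] gives the limit expected by [psi1_eq]; half of it is the
       [log^2 z / 2] on the left of the theorem. *)
    assert (A1 := Clim_plus _ _ _ _ Lf (Clim_const (w * w)%C)).
    assert (A2 := Clim_plus _ _ _ _ L1 (Clim_const (0 * 0)%C)).
    rewrite (psi1_eq z (line_int (fun t => full_kern phi c 0 t * zeta (1 - (c, t)))%C + 0 * 0)%C (line_int f + w * w)%C Hoff).
    + field. split; [apply Ci_neq_0|]. intros E. apply RtoC_inj in E. lra.
    + apply Clim_ext_loc with (2 := A2) (N := O). intros n _. ring.
    + apply Clim_ext_loc with (2 := A1) (N := O). intros n _. ring.
Qed.
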